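(* Let $a\in\mathbb{R}$ and suppose that $\{\lambda_i,\varphi_i(a)\}_{i=1}^N$ is the interior spectral data at $a$ of some pair $(\omega,v)$, and that $\alpha=0$, $\beta\ne0$. If there are exactly $k\ge1$ indices $i$ with $\varphi_i(a)=0$, then infinitely many pairs $(\omega,v)$ yield the given interior spectral data $\{\lambda_i,\varphi_i(a)\}_{i=1}^N$ at $a$. Moreover: (i) if $\lambda_1>0$ or $\lambda_N<0$, then $\mathcal{F}$ is a connected manifold of dimension $k$; (ii) if $\lambda_{j_0}<0<\lambda_{j_0+1}$ for some $j_0\in\{1,\dots,N-1\}$, and $\varphi_1(a)=0$ or $\varphi_N(a)=0$, then $\mathcal{F}$ is a connected manifold of dimension $k$; (iii) if $\lambda_{j_0}<0<\lambda_{j_0+1}$ for some $j_0\in\{1,\dots,N-1\}$, and $\varphi_1(a)\ne0$, $\varphi_N(a)\ne0$, then $\mathcal{F}$ is a collection of 2 disjoint manifolds, each of dimension $k$.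
   Context: A pair $(\omega,v)$ means: for some $n\in\mathbb{N}$, $n\ge 1$, and real points $x_1<\dots<x_n$, $\omega=\sum_{i=1}^n\omega_i\delta_{x_i}$ and $v=\sum_{i=1}^n v_i\delta_{x_i}$ with $\omega_i\in\mathbb{R}$, $v_i\ge 0$ and $|\omega_i|+v_i>0$ ($\delta_x$ is the Dirac measure at $x$). The number $n$, the points and the weights may differ from pair to pair. For $z\in\mathbb{C}$ consider $-f''+\frac14 f=z\omega f+z^2vf$ on $\mathbb{R}$, meaning: $f$ is continuous, $-f''+\frac14 f=0$ on $\mathbb{R}\setminus\{x_1,\dots,x_n\}$, and $f'(x_i-)=f'(x_i+)+z\omega_if(x_i)+z^2v_if(x_i)$ for every $i$. An eigenvalue is a $z$ for which there is a nontrivial bounded solution. The eigenvalues form a finite set of nonzero real numbers $\lambda_1<\dots<\lambda_N$. For $z\in\mathbb{C}$, $\phi_\pm(z,\cdot)$ are the solutions with $\phi_\pm(z,x)=e^{\mp x/2}$ for all $x$ near $\pm\infty$. For an eigenvalue $\lambda$ put $\gamma_\lambda^2:=\int_{\mathbb{R}}|\phi_+(\lambda,x)|^2d\omega(x)+2\lambda\int_{\mathbb{R}}|\phi_+(\lambda,x)|^2dv(x)$; one has $\lambda\gamma_\lambda^2>0$. The normalized eigenfunctions are $\varphi_i(x)=\phi_+(\lambda_i,x)/\sqrt{\lambda_i\gamma_{\lambda_i}^2}$. For $a\in\mathbb{R}$, the family $\{\lambda_i,\varphi_i(a)\}_{i=1}^N$ is called the interior spectral data of $(\omega,v)$ at $a$.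 Put $\alpha:=1-\sum_{i=1}^N|\varphi_i(a)|^2$ and $\beta:=-\sum_{i=1}^N\lambda_i|\varphi_i(a)|^2$. The spectral data of a pair is the vector $(\lambda_1,\dots,\lambda_N,\lambda_1\gamma_{\lambda_1}^2,\dots,\lambda_N\gamma_{\lambda_N}^2)\in\mathbb{R}^{2N}$. For given interior spectral data at $a$, $\mathcal{F}\subset\mathbb{R}^{2N}$ denotes the set of spectral data of all pairs whose interior spectral data at $a$ is the given one. ''A collection of $m$ disjoint manifolds, each of dimension $k$'' means that the set has exactly $m$ connected components, each a manifold of dimension $k$. *)

(* Defs.v *)
From HB Require Import structures.
From mathcomp Require Import all_boot all_order all_algebra.
From mathcomp Require Import complex.
From mathcomp Require Import all_classical all_reals all_analysis.
Set Implicit Arguments.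
Unset Strict Implicit.
Unset Printing Implicit Defensive.
Import Order.TTheory GRing.Theory Num.Theory.
Import numFieldNormedType.Exports.
Local Open Scope classical_set_scope.
Local Open Scope complex_scope.
Local Open Scope ring_scope.

(* A node (x, w, u) stands for the point masses w * delta_x in omega and
   u * delta_x in v.  Since |w| + u > 0 at every node, the sorted list of nodes
   is determined by the measures (omega, v), so that equality of two
   [coef_pair]s is equality of the corresponding pairs of measures. *)
Section Nodes.
Context {R : realType}.
Definition pos (t : R * R * R) : R := t.1.1.
Definition mass (t : R * R * R) : R := t.1.2.
Definition dipole (t : R * R * R) : R := t.2.

Definition coef_pair_axiom (s : seq (R * R * R)) : bool :=
  [&& s != [::], sorted <%R [seq pos t | t <- s] &
      all (fun t => (0 <= dipole t) && (0 < `|mass t| + dipole t)) s].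
End Nodes.

Record coef_pair (R : realType) := CoefPair {
  nodes : seq (R * R * R);
  _ : coef_pair_axiom nodes }.

Section Spectral.
Context {R : realType}.
Implicit Types (p : coef_pair R) (z : R[i]) (f : R -> R[i]) (N : nat).

Definition points p : seq R := [seq pos t | t <- nodes p].

(* The integrals of g against omega and v. *)
Definition int_omega p (g : R -> R) : R :=
  \sum_(t <- nodes p) mass t * g (pos t).
Definition int_v p (g : R -> R) : R :=
  \sum_(t <- nodes p) dipole t * g (pos t).

Definition modulus z : R := ComplexField.Normc.normc z.

(* The libraries put no topology or normed R-module structure on R[i], so
   continuity, limits and derivatives of functions of a real variable with
   values in R[i] are taken on the real and imaginary parts. *)
Definition re f : R -> R := fun x => complex.Re (f x).
Definition im f : R -> R := fun x => complex.Im (f x).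

Definition ccontinuous f : Prop := continuous (re f) /\ continuous (im f).

Definition climit f (F : set_system R) (l : R[i]) : Prop :=
  re f @ F --> complex.Re l /\ im f @ F --> complex.Im l.

Definition is_cderive f (x : R) (l : R[i]) : Prop :=
  is_derive x 1 (re f) (complex.Re l) /\ is_derive x 1 (im f) (complex.Im l).

Definition solution p z f : Prop :=
  ccontinuous f /\
  exists f' f'' : R -> R[i],
    (forall x, x \notin points p ->
      [/\ is_cderive f x (f' x), is_cderive f' x (f'' x) &
          - f'' x + f x / 4 = 0]) /\
    (forall t, t \in nodes p -> exists fl fr : R[i],
      [/\ climit f' (pos t)^'- fl, climit f' (pos t)^'+ fr &
          fl = fr + z * (mass t)%:C * f (pos t)
                  + z ^+ 2 * (dipole t)%:C * f (pos t)]).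

Definition is_eigenvalue p z : Prop :=
  exists f, [/\ solution p z f, exists x, f x != 0 &
                exists M : R, forall x, modulus (f x) <= M].

(* Such a solution exists and is unique, so the default 0 is never used. *)
Definition phi_plus p z : R -> R[i] :=
  xget (fun=> 0)
    [set f | solution p z f /\ \forall x \near +oo, f x = (expR (- x / 2))%:C].

Definition gamma2 p (l : R) : R :=
  int_omega p (fun x => modulus (phi_plus p l%:C x) ^+ 2)
  + 2 * l * int_v p (fun x => modulus (phi_plus p l%:C x) ^+ 2).

Definition eigenfun p (l : R) (x : R) : R[i] :=
  phi_plus p l%:C x / (Num.sqrt (l * gamma2 p l))%:C.

Definition spectrum p N (lam : N.-tuple R) : Prop :=
  sorted <%R lam /\
  forall z, is_eigenvalue p z <-> exists2 l, l \in lam & z = l%:C.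

Definition interior_data p (a : R) N (lam : N.-tuple R) (phia : N.-tuple R[i]) :=
  spectrum p lam /\ forall i, tnth phia i = eigenfun p (tnth lam i) a.

Definition alpha N (phia : N.-tuple R[i]) : R :=
  1 - \sum_(i < N) modulus (tnth phia i) ^+ 2.

Definition beta N (lam : N.-tuple R) (phia : N.-tuple R[i]) : R :=
  - \sum_(i < N) tnth lam i * modulus (tnth phia i) ^+ 2.

Definition spectral_data p N (s : 'rV[R]_(N + N)) : Prop :=
  exists lam : N.-tuple R, spectrum p lam /\
    s = row_mx (\row_i tnth lam i) (\row_i (tnth lam i * gamma2 p (tnth lam i))).

Definition compatible_data (a : R) N (lam : N.-tuple R) (phia : N.-tuple R[i]) :
    set 'rV[R]_(N + N) :=
  [set s | exists p, interior_data p a lam phia /\ spectral_data p s].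

(* A with the topology induced by R^m is a topological manifold of dimension k;
   being Hausdorff and second countable is inherited from R^m, so only the
   charts (f with inverse g, from A `&` U onto V) are required. *)
Definition manifold m (k : nat) (A : set 'rV[R]_m) : Prop :=
  forall x, A x -> exists (U : set 'rV[R]_m) (V : set 'rV[R]_k)
      (f : 'rV[R]_m -> 'rV[R]_k) (g : 'rV[R]_k -> 'rV[R]_m),
    [/\ open U, U x & open V] /\
    [/\ {within A `&` U, continuous f}, {within V, continuous g},
        (forall y, (A `&` U) y -> V (f y) /\ g (f y) = y) &
        (forall w, V w -> (A `&` U) (g w) /\ f (g w) = w)].

Definition connected_manifold m (k : nat) (A : set 'rV[R]_m) : Prop :=
  connected A /\ manifold k A.

Definition disjoint_manifolds m (c k : nat) (A : set 'rV[R]_m) : Prop :=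
  ([set connected_component A x | x in A] #= `I_c)%card /\
  forall x, A x -> manifold k (connected_component A x).

End Spectral.

(* Main.v *)
Require Import Defs.
From HB Require Import structures.
From mathcomp Require Import all_boot all_order all_algebra.
From mathcomp Require Import complex.
From mathcomp Require Import all_classical all_reals all_analysis.
From mathcomp Require Import ring lra.
Set Implicit Arguments.
Unset Strict Implicit.
Unset Printing Implicit Defensive.
Import Order.TTheory GRing.Theory Num.Theory.
Import numFieldNormedType.Exports.
Local Open Scope classical_set_scope.
Local Open Scope complex_scope.
Local Open Scope ring_scope.

(** Substituting y = exp x and f = exp (- x / 2) g turns the equation into a
    string: g is linear in y off the nodes, and at a node the slope of g jumps
    by (z w + z^2 v) g / y.  The solution that decays at +oo starts with
    g = 1, and z is an eigenvalue exactly when g vanishes at y = 0.  So the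
    whole problem is about real polynomials in z: writing the slope as - z C,
    the pair (g, C) at a point satisfies g' C - g C' > 0 on the real line and
    Im (conj g C) has a fixed sign off it (wron_gt0, imconj_lt0).  Hence g has
    simple real roots and C / g is a sum of simple fractions with positive
    residues (profile_roots); conversely every such sum comes from a string,
    because its nodes can be peeled off one at a time as in a continued
    fraction (inverse_string).

    Cut the string at b = exp a.  The solutions from the right and from the
    left have values P and H at b, and for the characteristic polynomial W the
    quotient W / (P H) is 1 minus z times the weight of the node at b, plus z
    times a positive combination of the fractions C / g of the two halves
    (glue_intercept).  The residues of P H / W are fixed by the
    interior data, and alpha = 0 makes the fraction proper, so the product P H
    is the same polynomial for all pairs with the given data
    (has_data_green_num).  What remains free is how P H is shared out:
    - a root that is an eigenvalue l with phi l = 0 is a root of both P and H,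
      and the positive residue that it carries may be divided between the
      two sides in any ratio; the norming constant of l is a fixed multiple of
      that ratio, so it ranges over all positive reals (has_data_exists);
    - any other root belongs to one side only.  Two distinct roots of P H are always
      separated by some eigenvalue with phi <> 0 (separation), so between two
      consecutive such eigenvalues P changes sign exactly when the root there
      is one of its own: the signs of phi decide (splitting_inner).  The only
      root out of reach of this argument is one that lies beyond all of
      them on its side of 0 (an outer root), and there is at most one (outer_unique).
    The norming constants of the eigenvalues with phi <> 0 are P^2 / (b phi^2),
    so for each admissible P the spectral data form an open orthant of
    dimension k inside an affine subspace.  If all eigenvalues have one sign,
    0 already plays the role of the outer root; if an extreme eigenvalue has
    phi = 0, it is the outer root itself; in both cases P is unique and there
    is one orthant.  Otherwise beta <> 0 forces an outer root that is not an
    eigenvalue (outer_exists); giving it to P or to H yields two parallel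
    orthants, which are the two components (two_components). *)


(** * Products of simple factors and their partial fractions *)

Section nodal.
Variable F : fieldType.
Implicit Types (rs : seq F) (A C : {poly F}) (k : F -> F).

(** Normalised by the value 1 at 0, as g is in the variable z. *)
Definition nodal rs : {poly F} := \prod_(m <- rs) (1 - m^-1 *: 'X).

(** The cofactor of 'X - m.  Sealed, since otherwise the rules for evaluation and
    degree see through it. *)
Definition nodal_part rs m : {poly F} := locked (- m^-1 *: nodal (rem m rs)).

(** The numerator of the sum of the k m / (x - m) over the denominator nodal rs. *)
Definition pfnum rs k : {poly F} := \sum_(m <- rs) k m *: nodal_part rs m.

Lemma nodal_cons m rs : nodal (m :: rs) = (1 - m^-1 *: 'X) * nodal rs.
Proof. by rewrite /nodal big_cons. Qed.

Lemma nodal_perm rs rs' : perm_eq rs rs' -> nodal rs = nodal rs'.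
Proof. by move=> h; rewrite /nodal (perm_big _ h). Qed.

Lemma nodal_eval rs x : (nodal rs).[x] = \prod_(m <- rs) (1 - x / m).
Proof.
rewrite /nodal horner_prod; apply: eq_bigr => m _.
by rewrite !hornerE mulrC.
Qed.

Lemma nodal0 rs : (nodal rs).[0] = 1.
Proof. by rewrite nodal_eval big1 // => m _; rewrite mul0r subr0. Qed.

Lemma nodal_neq0 rs : nodal rs != 0.
Proof. by apply: contraTneq (oner_neq0 F) => h; rewrite -(nodal0 rs) h horner0 eqxx. Qed.

Lemma nodal_factor rs m : 0 \notin rs -> m \in rs -> nodal rs = ('X - m%:P) * nodal_part rs m.
Proof.
move=> r0 mr.
have m0 : m != 0 by apply: contraNneq r0 => <-.
rewrite (nodal_perm (perm_to_rem mr)) nodal_cons /nodal_part -lock -scalerAr scalerAl.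
congr (_ * _); rewrite scalerBr !scaleNr opprK -[m^-1 *: m%:P]mul_polyC -polyCM mulVf //.
by rewrite addrC.
Qed.

Lemma root_nodal rs x : 0 \notin rs -> root (nodal rs) x = (x \in rs).
Proof.
move=> r0; apply/idP/idP; last first.
  by move=> xr; rewrite (nodal_factor r0 xr) rootM root_XsubC eqxx.
rewrite /root nodal_eval; elim: rs r0 => [|m rs IH].
  by rewrite big_nil oner_eq0.
rewrite inE negb_or eq_sym => /andP[m0 r0]; rewrite big_cons mulf_eq0 inE.
case/orP => [|/(IH r0)->]; last by rewrite orbT.
by rewrite subr_eq0 eq_sym => /eqP h; rewrite -(divfK m0 x) h mul1r eqxx.
Qed.

Lemma size_nodal rs : 0 \notin rs -> size (nodal rs) = (size rs).+1.
Proof.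
elim: rs => [|m rs IH]; first by rewrite /nodal big_nil size_poly1.
rewrite inE negb_or eq_sym => /andP[m0 r0]; rewrite nodal_cons.
have h : 1 - m^-1 *: 'X = - m^-1 *: ('X - m%:P) :> {poly F}.
  by rewrite scalerBr !scaleNr opprK -[m^-1 *: m%:P]mul_polyC -polyCM mulVf // addrC.
rewrite h -scalerAl size_scale ?oppr_eq0 ?invr_eq0 // size_monicM ?nodal_neq0 ?monicXsubC //.
by rewrite size_XsubC IH.
Qed.

Lemma size_nodal_part rs m : 0 \notin rs -> m \in rs -> size (nodal_part rs m) = size rs.
Proof.
move=> r0 mr; have m0 : m != 0 by apply: contraNneq r0 => <-.
rewrite /nodal_part -lock size_scale ?oppr_eq0 ?invr_eq0 // size_nodal; last first.
  by apply: contra r0 => /mem_rem.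
by rewrite size_rem // prednK //; case: rs mr {r0}.
Qed.

Lemma nodal_deriv rs m : 0 \notin rs -> m \in rs -> (nodal rs)^`().[m] = (nodal_part rs m).[m].
Proof.
move=> r0 mr; rewrite (nodal_factor r0 mr) derivM derivXsubC mul1r hornerD hornerM hornerXsubC
  subrr mul0r addr0 //.
Qed.

Lemma nodal_part_other rs m x : uniq rs -> 0 \notin rs -> m \in rs -> x \in rs -> x != m ->
  (nodal_part rs m).[x] = 0.
Proof.
move=> u r0 mr xr xm.
have : root (nodal rs) x by rewrite root_nodal.
by rewrite /root (nodal_factor r0 mr) hornerM hornerXsubC mulf_eq0 subr_eq0 (negPf xm) => /eqP.
Qed.

Lemma nodal_part_self rs m : uniq rs -> 0 \notin rs -> m \in rs -> (nodal_part rs m).[m] != 0.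
Proof.
move=> u r0 mr; have m0 : m != 0 by apply: contraNneq r0 => <-.
rewrite /nodal_part -lock hornerZ mulf_neq0 ?oppr_eq0 ?invr_eq0 // -/(root _ _) root_nodal.
  by rewrite mem_rem_uniqF.
by apply: contra r0 => /mem_rem.
Qed.

Lemma pfnum_node rs k m : uniq rs -> 0 \notin rs -> m \in rs ->
  (pfnum rs k).[m] = k m * (nodal rs)^`().[m].
Proof.
move=> u r0 mr; rewrite /pfnum horner_sum (bigD1_seq m) //= hornerZ nodal_deriv //.
rewrite big_seq_cond big1 ?addr0 // => n /andP[nr nm].
by rewrite hornerZ nodal_part_other ?mulr0 // eq_sym.
Qed.

Lemma size_pfnum rs k : 0 \notin rs -> (size (pfnum rs k) <= size rs)%N.
Proof.
move=> r0; rewrite /pfnum; apply: (leq_trans (size_sum _ _ _)).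
rewrite big_seq; elim/big_ind: _ => // [x y hx hy|m mr].
  by rewrite geq_max hx.
by rewrite -(size_nodal_part r0 mr); exact: size_scale_leq.
Qed.

Lemma poly_eq_on rs A C : uniq rs -> (size A <= size rs)%N -> (size C <= size rs)%N ->
  (forall m, m \in rs -> A.[m] = C.[m]) -> A = C.
Proof.
move=> u sA sC h; apply/eqP; rewrite -subr_eq0; apply/eqP.
apply: (@roots_geq_poly_eq0 _ _ rs) => //.
  by apply/allP => m mr; rewrite /root !hornerE h // subrr.
by apply: (leq_trans (size_polyD _ _)); rewrite size_polyN geq_max sA.
Qed.

(** Both sides have degree less than the number of roots and agree at each of
    them. *)
Lemma nodal_lagrange rs C : uniq rs -> 0 \notin rs -> (size C <= size rs)%N ->
  C = pfnum rs (fun m => C.[m] / (nodal rs)^`().[m]).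
Proof.
move=> u r0 sC; apply: (poly_eq_on u sC (size_pfnum _ r0)) => m mr.
by rewrite pfnum_node // divfK // nodal_deriv // nodal_part_self.
Qed.

Lemma nodal_part_eval rs m x : 0 \notin rs -> m \in rs -> x \notin rs ->
  (nodal_part rs m).[x] = (nodal rs).[x] / (x - m).
Proof.
move=> r0 mr xr; rewrite (nodal_factor r0 mr) hornerM hornerXsubC mulrC mulKf // subr_eq0.
by apply: contraNneq xr => ->.
Qed.

Lemma pfnum_eval rs k x : 0 \notin rs -> x \notin rs ->
  (pfnum rs k).[x] = (nodal rs).[x] * \sum_(m <- rs) k m / (x - m).
Proof.
move=> r0 xr; rewrite /pfnum horner_sum mulr_sumr !big_seq; apply: eq_bigr => m mr.
by rewrite hornerZ nodal_part_eval // mulrCA.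
Qed.

Lemma coef_nodal_part rs m : 0 \notin rs -> m \in rs ->
  (nodal_part rs m)`_(size rs).-1 = lead_coef (nodal rs).
Proof.
move=> r0 mr; rewrite (nodal_factor r0 mr) lead_coefM lead_coefXsubC mul1r lead_coefE.
by rewrite size_nodal_part.
Qed.

Lemma coef_pfnum rs k : 0 \notin rs ->
  (pfnum rs k)`_(size rs).-1 = lead_coef (nodal rs) * \sum_(m <- rs) k m.
Proof.
move=> r0; rewrite /pfnum coef_sum mulr_sumr !big_seq; apply: eq_bigr => m mr.
by rewrite coefZ coef_nodal_part // mulrC.
Qed.

(** The polynomial form of the fact that the derivative of the sum of the
    k m / (x - m) is minus the sum of the k m / (x - m)^2. *)
Lemma pfnum_wronskian rs k : 0 \notin rs ->
  pfnum rs k * (nodal rs)^`() - (pfnum rs k)^`() * nodal rs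
  = \sum_(m <- rs) k m *: (nodal_part rs m) ^+ 2.
Proof.
move=> r0; rewrite /pfnum raddf_sum /= !mulr_suml -sumrB !big_seq; apply: eq_bigr => m mr.
rewrite derivZ (nodal_factor r0 mr) derivM derivXsubC -!scalerAl -scalerBr; congr (_ *: _); move:
  (nodal_part rs m) => d; move: d^`() => d1.
ring.
Qed.

Lemma poly_eq_off rs A C : (forall x, x \notin rs -> A.[x] = C.[x]) ->
  (forall n : nat, exists l : seq F, uniq l /\ size l = n) -> A = C.
Proof.
move=> h inf; apply/eqP; rewrite -subr_eq0; apply/eqP.
have [l [ul sl]] := inf (size (A - C)%R + size rs)%N.
apply: (@roots_geq_poly_eq0 _ _ [seq x <- l | x \notin rs]).
- by apply/allP => x; rewrite mem_filter => /andP[xr _]; rewrite /root !hornerE h // subrr.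
- exact: filter_uniq.
rewrite size_filter -(leq_add2r (count (mem rs) l)).
have -> : (count [pred x | x \notin rs] l + count (mem rs) l = size l)%N.
  by rewrite addnC -(count_predC (mem rs) l).
rewrite sl leq_add2l -size_filter; apply: uniq_leq_size; first exact: filter_uniq.
by move=> x; rewrite mem_filter => /andP[].
Qed.

End nodal.

(** * Real polynomials seen from the complex plane *)

Section Split.
Context {R : realType}.
Implicit Types (P : {poly R}) (z : R[i]).

Definition cpoly P : {poly R[i]} := map_poly (real_complex R) P.

Lemma cpoly_inj : injective cpoly.
Proof. exact: map_poly_inj. Qed.

Lemma cpoly_real P x : (cpoly P).[x%:C] = (P.[x])%:C.
Proof. by rewrite /cpoly horner_map. Qed.

Lemma cpolyM_eval P P' z : (cpoly (P * P')).[z] = (cpoly P).[z] * (cpoly P').[z].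
Proof. by rewrite /cpoly rmorphM hornerM. Qed.

Lemma cpolyD_eval P P' z : (cpoly (P + P')).[z] = (cpoly P).[z] + (cpoly P').[z].
Proof. by rewrite /cpoly rmorphD hornerD. Qed.

Lemma cpolyN_eval P z : (cpoly (- P)).[z] = - (cpoly P).[z].
Proof. by rewrite /cpoly rmorphN hornerN. Qed.

Lemma cpolyZ_eval a P z : (cpoly (a *: P)).[z] = a%:C * (cpoly P).[z].
Proof. by rewrite /cpoly map_polyZ hornerZ. Qed.

Lemma cpolyX_eval z : (cpoly 'X).[z] = z.
Proof. by rewrite /cpoly map_polyX hornerX. Qed.

Lemma cpolyC_eval a z : (cpoly a%:P).[z] = a%:C.
Proof. by rewrite /cpoly map_polyC hornerC. Qed.

(** Over the complex numbers P is a product of linear factors; they are all real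
    by the first hypothesis and distinct by the second. *)
Lemma real_split P : P.[0] = 1 ->
  (forall z, complex.Im z != 0 -> (cpoly P).[z] != 0) ->
  (forall x, P.[x] = 0 -> (P^`()).[x] != 0) ->
  exists rs, [/\ uniq rs, 0 \notin rs & P = nodal rs].
Proof.
move=> P0 nonreal simp.
have [r hr] := closed_field_poly_normal (cpoly P).
have Pn0 : P != 0 by apply: contraTneq (oner_neq0 R) => h; rewrite -P0 h horner0 eqxx.
have lcP : lead_coef (cpoly P) = (lead_coef P)%:C by rewrite /cpoly lead_coef_map.
have rreal z : z \in r -> z = (complex.Re z)%:C.
  move=> zr; have : (cpoly P).[z] = 0.
    apply/eqP; rewrite -/(root _ _) hr rootZ ?root_prod_XsubC //.
    by rewrite lead_coef_eq0 -[0](rmorph0 (map_poly (real_complex R))) (inj_eq cpoly_inj).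
  case: (eqVneq (complex.Im z) 0) => [h _|/nonreal/negP h /eqP//].
  by case: z h {zr} => a b /= ->.
pose rs := [seq complex.Re z | z <- r].
have hP : P = lead_coef P *: \prod_(x <- rs) ('X - x%:P).
  apply: cpoly_inj; rewrite hr lcP /cpoly map_polyZ /= /rs big_map rmorph_prod /=.
  congr (_ *: _); rewrite !big_seq; apply: eq_bigr => z zr.
  by rewrite rmorphB /= map_polyX map_polyC /= -rreal.
have rootP x : (P.[x] == 0) = (x \in rs).
  by rewrite -/(root _ _) hP rootZ ?lead_coef_eq0 // root_prod_XsubC.
have urs : uniq rs.
  suff h2 (l1 l2 l3 : seq R) x : rs != l1 ++ x :: l2 ++ x :: l3.
    have : forall l1 l2, rs = l1 ++ l2 -> uniq l2.
      move=> l1 l2; elim: l2 l1 => // x l2 IH l1 e /=.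
      rewrite (IH (rcons l1 x)) ?cat_rcons // andbT; apply/negP => xl2.
      by case/splitPr: xl2 e => l3 l4 e; have := h2 l1 l3 l4 x; rewrite e eqxx.
    by move=> /(_ [::] rs erefl).
  apply/eqP => e; have : P.[x] = 0 by apply/eqP; rewrite rootP e mem_cat inE eqxx orbT.
  have [p1 [p2 [p3 eP]]] : exists p1 p2 p3 : {poly R},
      P = lead_coef P *: (p1 * (('X - x%:P) * (p2 * (('X - x%:P) * p3)))).
    exists (\prod_(x <- l1) ('X - x%:P)), (\prod_(x <- l2) ('X - x%:P)), (\prod_(x <- l3) ('X -
      x%:P)).
    by rewrite {1}hP e big_cat big_cons big_cat big_cons.
  have d0 : ('X - x%:P).[x] = 0 by rewrite hornerXsubC subrr.
  move/simp; rewrite eP derivZ !derivM derivXsubC.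
  move: ('X - x%:P) d0 => d d0; rewrite !(hornerZ, hornerD, hornerM) d0.
  by rewrite !(mul0r, mulr0, addr0, add0r) eqxx.
have r0 : 0 \notin rs by rewrite -rootP P0 oner_eq0.
exists rs; split => //.
have e : \prod_(x <- rs) ('X - x%:P) = (\prod_(x <- rs) (- x)) *: nodal rs :> {poly R}.
  move: r0; elim: rs {hP rootP urs} => [|x l IH]; first by rewrite /nodal !big_nil scale1r.
  rewrite inE negb_or eq_sym => /andP[x0 l0]; rewrite !big_cons nodal_cons IH //.
  have -> : 'X - x%:P = - x *: (1 - x^-1 *: 'X).
    by rewrite scalerBr scalerA mulNr mulfV // scaleN1r opprK scaleNr -mul_polyC mulr1 addrC.
  by rewrite -scalerAl -scalerAr scalerA.
have : P.[0] = 1 by [].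
by rewrite hP e scalerA hornerZ nodal0 mulr1 => ->; rewrite scale1r.
Qed.

End Split.

(** * Strings with finitely many nodes *)

Section String.
Context {R : realType}.
Implicit Types (t : R * R * R) (s : seq (R * R * R)).

Definition node_poly t : {poly R} := (mass t)%:P + dipole t *: 'X.

Lemma node_poly_eval t z : (node_poly t).[z] = mass t + dipole t * z.
Proof. by rewrite /node_poly !hornerE. Qed.

Definition good_node t := (0 <= dipole t) && (0 < `|mass t| + dipole t).

(** The solution with g = 1 to the right of all nodes equals A - z C y to the left
    of s; the two components are A and C, as polynomials in z. *)
Fixpoint string_coefs s : {poly R} * {poly R} :=
  if s is t :: s' then
    let g := (string_coefs s').1 - pos t *: ('X * (string_coefs s').2) in
    ((string_coefs s').1 - 'X * (node_poly t * g), (string_coefs s').2 - (pos t)^-1 *: (node_poly t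
      * g))
  else (1, 0).

Definition intercept s := (string_coefs s).1.
(** The slope divided by - z. *)
Definition rslope s := (string_coefs s).2.
(** The value at y of the linear piece to the left of s. *)
Definition profile s y : {poly R} := intercept s - y *: ('X * rslope s).

Fixpoint is_string (c : R) s : bool :=
  if s is t :: s' then [&& c < pos t, good_node t & is_string (pos t) s'] else true.

Lemma intercept_profile s : intercept s = profile s 0.
Proof. by rewrite /profile scale0r subr0. Qed.

Lemma intercept_cons t s : intercept (t :: s) = intercept s - 'X * (node_poly t * profile s (pos
  t)).
Proof. by []. Qed.

Lemma rslope_cons t s : rslope (t :: s) = rslope s - (pos t)^-1 *: (node_poly t * profile s (pos
  t)).
Proof. by []. Qed.

Lemma profile_shift s y x : profile s y = profile s x + (x - y) *: ('X * rslope s).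
Proof. by rewrite /profile scalerBl; ring. Qed.

Lemma profile_cons t s y : pos t != 0 ->
  profile (t :: s) y = profile s (pos t) + (pos t - y) *: ('X * rslope (t :: s)).
Proof.
move=> t0; rewrite (profile_shift _ y (pos t)); congr (_ + _).
have e : (pos t)%:P * (pos t)^-1%:P = 1 :> {poly R} by rewrite -polyCM mulfV.
rewrite {1}/profile intercept_cons rslope_cons -!mul_polyC.
have eg : profile s (pos t) = intercept s - (pos t)%:P * ('X * rslope s) by rewrite /profile
  mul_polyC.
move: (profile s (pos t)) eg => g eg.
transitivity (intercept s - (pos t)%:P * ('X * rslope s)
  + ((pos t)%:P * (pos t)^-1%:P - 1) * ('X * (node_poly t * g))); first by ring.
by rewrite e subrr mul0r addr0 eg.
Qed.

Lemma profile0 s y : (profile s y).[0] = 1.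
Proof.
elim: s y => [|t s IH] y; first by rewrite /profile /intercept /rslope /= mulr0 scaler0 subr0
  hornerC.
rewrite /profile hornerD hornerN hornerZ [('X * _).[0]]hornerM hornerX mul0r mulr0 subr0.
by rewrite intercept_cons hornerD hornerN hornerM hornerX mul0r subr0 intercept_profile IH.
Qed.

(** At a root of the profile g this is g' C, so its sign controls both the
    simplicity of the root and the residue of C / g there. *)
Definition wron s y := (profile s y)^`() * rslope s - profile s y * (rslope s)^`().

(** Passing a node adds a square weighted by v, moving left adds a square weighted
    by the distance: the Wronskian can only grow. *)
Lemma wron_cons t s y : pos t != 0 ->
  wron (t :: s) y = wron s (pos t) + (dipole t / pos t) *: (profile s (pos t)) ^+ 2
                    + (pos t - y) *: (rslope (t :: s)) ^+ 2.
Proof.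
move=> t0; rewrite /wron profile_cons // rslope_cons /node_poly.
move: (profile s (pos t)) (rslope s) => g C.
rewrite !(derivD, derivN, derivB, derivZ, derivM, derivC, derivX).
rewrite -!mul_polyC polyCM !polyCB.
set y1 := (pos t)^-1; ring.
Qed.

Lemma is_string_cons_neq0 c t s : 0 <= c -> is_string c (t :: s) -> 0 < pos t.
Proof. by move=> c0 /and3P[h _ _]; exact: le_lt_trans h. Qed.

Lemma wron_gt0 c s y z : 0 <= c -> is_string c s -> y <= c -> s != [::] -> 0 < (wron s y).[z].
Proof.
elim: s c y => // t s IH c y c0 hs yc _; have t0 := is_string_cons_neq0 c0 hs.
have tn0 : pos t != 0 by rewrite gt_eqF.
case/and3P: hs => ct /andP[v0 wv] hs.
have yt : 0 < pos t - y by rewrite subr_gt0; exact: le_lt_trans ct.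
rewrite wron_cons // 2!hornerD 2!hornerZ 2!horner_exp.
have h1 : 0 <= dipole t / pos t * (profile s (pos t)).[z] ^+ 2.
  by rewrite mulr_ge0 ?sqr_ge0 // divr_ge0 // ltW.
have h2 : 0 <= (pos t - y) * (rslope (t :: s)).[z] ^+ 2.
  by rewrite mulr_ge0 ?sqr_ge0 // ltW.
case: s IH hs h1 h2 => [_ _ h1 h2|t' s IH hs h1 h2]; last first.
  have := IH (pos t) (pos t) (ltW t0) hs (lexx _) isT.
  by move=> h; apply: ltr_wpDr => //; apply: ltr_wpDr.
have w0 : wron [::] (pos t) = 0 by rewrite /wron /profile /rslope /intercept /= !mulr0 deriv0 mulr0
  subr0.
rewrite w0 horner0 add0r.
have g1 : (profile [::] (pos t)).[z] = 1 by rewrite /profile /intercept /rslope /= mulr0 scaler0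
  subr0 hornerC.
have -> : (rslope [:: t]).[z] = - ((pos t)^-1 * (mass t + dipole t * z)).
  by rewrite rslope_cons hornerD hornerN hornerZ hornerM g1 node_poly_eval /rslope /= horner0 mulr1
    sub0r.
rewrite g1 expr1n mulr1; move: h1 h2 => _ _.
case: (eqVneq (dipole t) 0) wv v0 => [->|v1 _ v0].
  rewrite addr0 normr_gt0 => m0 _; rewrite !mul0r addr0 add0r.
  by rewrite mulr_gt0 // exprn_even_gt0 //= oppr_eq0 mulf_neq0 // invr_eq0.
apply: ltr_pwDl; first by rewrite divr_gt0 // lt0r v1.
by apply: mulr_ge0; [exact: ltW|exact: sqr_ge0].
Qed.

Lemma node_poly_neq0 t : good_node t -> node_poly t != 0.
Proof.
move=> /andP[_ wv]; apply: contraTneq wv => h.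
have e1 : (node_poly t)`_0 = 0 by rewrite h coef0.
have e2 : (node_poly t)`_1 = 0 by rewrite h coef0.
move: e1 e2; rewrite /node_poly !coefE /= mulr0 addr0 mulr1 add0r => -> ->.
by rewrite normr0 addr0 ltxx.
Qed.

(** A node contributes 1 to the degree if it has no dipole, and 2 otherwise. *)
Lemma size_string c s y : 0 <= c -> is_string c s -> y <= c ->
  (size (rslope s) < size (profile s y))%N /\
  (size (profile s y) = (\sum_(t <- s) size (node_poly t)).+1)%N.
Proof.
elim: s c y => [|t s IH] c y c0 hs yc.
  by rewrite /profile /intercept /rslope /= mulr0 scaler0 subr0 size_poly0 size_poly1 big_nil.
have t0 := is_string_cons_neq0 c0 hs; have tn0 : pos t != 0 by rewrite gt_eqF.
case/and3P: hs => ct gt hs.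
have yt : 0 < pos t - y by rewrite subr_gt0; exact: le_lt_trans ct.
have := IH (pos t) (pos t) (ltW t0) hs (lexx _).
set g := profile s (pos t) => -[sg sgE].
have gn0 : g != 0 by rewrite -size_poly_gt0; apply: leq_ltn_trans sg.
have qn0 := node_poly_neq0 gt.
have sq : (size g <= size (node_poly t * g)%R)%N.
  by rewrite size_mul // (polySpred qn0) /= leq_addl.
have sC : size (rslope (t :: s)) = size (node_poly t * g)%R.
  rewrite rslope_cons addrC size_polyDl ?size_polyN ?size_scale ?invr_eq0 //.
  exact: leq_trans sq.
have Cn0 : rslope (t :: s) != 0 by rewrite -size_poly_gt0 sC size_poly_gt0 mulf_neq0.
have sX : size ((pos t - y) *: ('X * rslope (t :: s))) = (size (rslope (t :: s))).+1.
  by rewrite size_scale ?gt_eqF // mulrC size_mulX.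
rewrite (profile_cons _ _ tn0) [profile s _ + _]addrC.
have -> : size ((pos t - y) *: ('X * rslope (t :: s)) + g) = (size (rslope (t :: s))).+1.
  by rewrite -sX; apply: size_polyDl; rewrite sX ltnS sC.
split; first exact: ltnSn.
by rewrite sC size_mul // sgE addnS big_cons.
Qed.

(** The imaginary part of conj a * b. *)
Definition imconj (a b : R[i]) : R :=
  complex.Re a * complex.Im b - complex.Im a * complex.Re b.
Definition sqmod (a : R[i]) : R := complex.Re a ^+ 2 + complex.Im a ^+ 2.

Lemma imconj_node (g C z : R[i]) (m v : R) :
  imconj g (C - (m%:C + v%:C * z) * g) = imconj g C - v * complex.Im z * sqmod g.
Proof. by case: g C z => a b [c d] [x y]; rewrite /imconj /sqmod /=; simpc; rewrite /=; ring. Qed.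

Lemma imconj_shift (g C z : R[i]) (d : R) :
  imconj (g + d%:C * (z * C)) C = imconj g C - d * complex.Im z * sqmod C.
Proof. by case: g C z => a b [c e] [x y]; rewrite /imconj /sqmod /=; simpc; rewrite /=; ring. Qed.

Lemma sqmod_ge0 a : 0 <= sqmod a.
Proof. by rewrite addr_ge0 // sqr_ge0. Qed.

Lemma sqmod_gt0 a : a != 0 -> 0 < sqmod a.
Proof.
move=> a0; rewrite lt0r sqmod_ge0 andbT paddr_eq0 ?sqr_ge0 // !sqrf_eq0.
by apply: contra a0 => /andP[]; case: a => x y /= /eqP -> /eqP ->.
Qed.

Lemma imconj0l a : imconj 0 a = 0. Proof. by rewrite /imconj /= !mul0r subr0. Qed.
Lemma imconj0r a : imconj a 0 = 0. Proof. by rewrite /imconj /= !mulr0 subr0. Qed.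

Lemma node_neq0 (m v y : R) z : 0 < `|m| + v -> y != 0 -> complex.Im z != 0 ->
  (m / y)%:C + (v / y)%:C * z != 0.
Proof.
case: z => a b /= h y0 b0; apply: contraTneq h; simpc => -[e1 /eqP].
rewrite !mulf_eq0 invr_eq0 (negPf b0) (negPf y0) !orbF => /eqP vv.
move/eqP: e1; rewrite vv !mul0r addr0 mulf_eq0 invr_eq0 (negPf y0) orbF => /eqP ->.
by rewrite normr0 addr0 ltxx.
Qed.

(** The analogue of wron_gt0 off the real axis: neither a node nor a move to the
    left can increase the quantity, and the first node makes it negative. *)
Lemma imconj_lt0 c s y z : 0 <= c -> is_string c s -> y <= c -> s != [::] -> complex.Im z != 0 ->
  complex.Im z * imconj (cpoly (profile s y)).[z] (cpoly (rslope s)).[z] < 0.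
Proof.
move=> + + + + z0; elim: s c y => // t s IH c y c0 hs yc _.
have t0 := is_string_cons_neq0 c0 hs; have tn0 : pos t != 0 by rewrite gt_eqF.
case/and3P: hs => ct /andP[v0 wv] hs.
have yt : 0 < pos t - y by rewrite subr_gt0; exact: le_lt_trans ct.
set C' := (cpoly (rslope (t :: s))).[z].
set g := (cpoly (profile s (pos t))).[z]; set C := (cpoly (rslope s)).[z].
have eg : (cpoly (profile (t :: s) y)).[z] = g + (pos t - y)%:C * (z * C').
  rewrite profile_cons // /cpoly rmorphD /= map_polyZ /= rmorphM /= map_polyX !hornerE.
  by rewrite /g /C' /cpoly.
have eC : C' = C - ((mass t / pos t)%:C + (dipole t / pos t)%:C * z) * g.
  rewrite /C' rslope_cons /cpoly rmorphB /= map_polyZ /= rmorphM /= /node_poly rmorphD /=.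
  rewrite map_polyC map_polyZ /= map_polyX !hornerE /= -/(cpoly _) -/C -/(cpoly _) -/g.
  rewrite !rmorphM /=; ring.
have IH' : (s = [::]) \/ complex.Im z * imconj g C < 0.
  case: s IH hs @g @C {eg eC C'} => [|t' s] IH hs; first by left.
  by right; apply: IH (ltW t0) hs _ _.
rewrite eg imconj_shift.
have -> : complex.Im z * (imconj g C' - (pos t - y) * complex.Im z * sqmod C') =
  complex.Im z * imconj g C' - (pos t - y) * complex.Im z ^+ 2 * sqmod C' by ring.
have iz2 : 0 < complex.Im z ^+ 2 by rewrite exprn_even_gt0.
have eT : complex.Im z * imconj g C' =
   complex.Im z * imconj g C - (dipole t / pos t) * complex.Im z ^+ 2 * sqmod g.
  by rewrite eC imconj_node; ring.
have hv : 0 <= dipole t / pos t by rewrite divr_ge0 // ltW.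
have T' : complex.Im z * imconj g C' <= complex.Im z * imconj g C.
  by rewrite eT gerBl mulr_ge0 ?sqmod_ge0 // mulr_ge0 // ltW.
have h2 : 0 <= (pos t - y) * complex.Im z ^+ 2 * sqmod C'.
  by rewrite mulr_ge0 ?sqmod_ge0 // mulr_ge0 // ltW.
case: IH' => [s0|h]; last first.
  by rewrite subr_lt0; apply: lt_le_trans h2; apply: le_lt_trans h.
have C0 : C = 0 by rewrite /C s0 /rslope /= /cpoly rmorph0 horner0.
have g1 : g = 1.
  by rewrite /g s0 /profile /intercept /rslope /= mulr0 scaler0 subr0 /cpoly rmorph1 hornerC.
move: T'; rewrite C0 imconj0r mulr0 => T'.
rewrite subr_lt0; apply: le_lt_trans T' _; rewrite mulr_gt0 //; first exact: mulr_gt0.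
apply: sqmod_gt0.
by rewrite eC C0 g1 mulr1 sub0r oppr_eq0 node_neq0.
Qed.

(** A non-real root would make the imaginary part of conj g * C vanish, and at a
    real one the Wronskian reduces to g' C. *)
Theorem profile_roots c s y : 0 <= c -> is_string c s -> y <= c ->
  exists rs, [/\ uniq rs, 0 \notin rs, profile s y = nodal rs, (size (rslope s) <= size rs)%N &
    forall m, m \in rs -> 0 < (rslope s).[m] * (nodal rs)^`().[m]].
Proof.
move=> c0 hs yc.
case: (eqVneq s [::]) => [->|sn].
  exists [::]; split => //; last by rewrite /rslope /= size_poly0.
  by rewrite /nodal big_nil /profile /intercept /rslope /= mulr0 scaler0 subr0.
have pos x : (profile s y).[x] = 0 -> 0 < (rslope s).[x] * (profile s y)^`().[x].
  by move=> gx; have := wron_gt0 x c0 hs yc sn; rewrite /wron hornerD hornerN !hornerM gx mul0r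
    subr0 mulrC.
have [||rs [u r0 e]] := real_split (profile0 s y).
- move=> z z0; apply: contraTneq (imconj_lt0 c0 hs yc sn z0) => ->.
  by rewrite imconj0l mulr0 ltxx.
- by move=> x /pos h; apply: contraTneq h => ->; rewrite mulr0 ltxx.
exists rs; split => //.
  by have [] := size_string c0 hs yc; rewrite e size_nodal.
by move=> m mr; rewrite -e; apply: pos; apply/eqP; rewrite e -/(root _ _) root_nodal.
Qed.

(** The derivative in z of the node weights, integrated against g^2. *)
Fixpoint norming_sum s (z : R) : R :=
  if s is t :: s' then
    (mass t + 2 * z * dipole t) * ((profile s' (pos t)).[z] ^+ 2 / pos t) + norming_sum s' z
  else 0.

(** The right-hand side does not depend on y between two nodes and changes at a
    node by the corresponding term of the sum. *)
Lemma norming_sum_wron c s y z : 0 <= c -> is_string c s ->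
  norming_sum s z = z * (wron s y).[z] - (profile s y).[z] * (rslope s).[z].
Proof.
elim: s c y => [|t s IH] c y c0 hs.
  by rewrite /wron /profile /rslope /intercept /= !mulr0 deriv0 mulr0 subr0 horner0 !mulr0 subr0.
have t0 := is_string_cons_neq0 c0 hs; have tn0 : pos t != 0 by rewrite gt_eqF.
case/and3P: hs => ct _ hs.
rewrite /= (IH (pos t) (pos t) (ltW t0) hs) wron_cons // profile_cons //.
rewrite rslope_cons; move: (wron s _) (profile s _) (rslope s) => w g C.
by rewrite /node_poly !(hornerD, hornerN, hornerM, hornerZ, hornerX, hornerC, horner_exp); field.
Qed.

End String.

(** * The inverse problem for a half-string *)

Definition horner_ops := (hornerD, hornerN, hornerM, hornerZ, hornerX, hornerC, horner_exp).

Section Inverse.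
Context {R : realType}.
Implicit Types (t : R * R * R) (s : seq (R * R * R)) (rs : seq R) (k : R -> R).

(** Follows from x / (x - m) = 1 + m / (x - m). *)
Lemma pfnum_mulX rs k : 0 \notin rs ->
  'X * pfnum rs k = (\sum_(m <- rs) k m) *: nodal rs + pfnum rs (fun m => k m * m).
Proof.
move=> r0; rewrite /pfnum mulr_sumr scaler_suml -big_split /= !big_seq.
apply: eq_bigr => m mr; rewrite {1}(nodal_factor r0 mr) -!mul_polyC polyCM; ring.
Qed.

Lemma size_pfnum_eq rs k : 0 \notin rs -> \sum_(m <- rs) k m != 0 ->
  size (pfnum rs k) = size rs.
Proof.
move=> r0 k0; have rs0 : (0 < size rs)%N by case: rs k0 {r0} => //; rewrite big_nil eqxx.
apply/eqP; rewrite eqn_leq size_pfnum //= -(prednK rs0).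
have : (pfnum rs k)`_(size rs).-1 != 0.
  by rewrite coef_pfnum // mulf_neq0 // lead_coef_eq0 nodal_neq0.
by rewrite ltnNge; apply: contra => h; rewrite nth_default.
Qed.

Lemma Im_sum (I : Type) (r : seq I) (f : I -> R[i]) :
  complex.Im (\sum_(i <- r) f i) = \sum_(i <- r) complex.Im (f i).
Proof. by elim/big_rec2: _ => // i y [a b] _ /= ->; case: (f i). Qed.

Lemma cnodal_neq0 rs (z : R[i]) : 0 \notin rs -> complex.Im z != 0 -> (cpoly (nodal rs)).[z] != 0.
Proof.
move=> r0 z0; rewrite /cpoly /nodal rmorph_prod horner_prod; rewrite big_seq.
elim/big_ind: _ => [|x y|m mr]; [exact: oner_neq0|exact: mulf_neq0|].
have m0 : m != 0 by apply: contraNneq r0 => <-.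
rewrite rmorphB /= rmorph1 map_polyZ /= map_polyX !horner_ops.
apply: contra z0; case: z => a b; simpc; rewrite eq_complex /= => /andP[_].
by rewrite oppr_eq0 mulf_eq0 invr_eq0 (negPf m0).
Qed.

Lemma cpfnum_eval rs k (z : R[i]) : 0 \notin rs -> complex.Im z != 0 ->
  (cpoly (pfnum rs k)).[z] = (cpoly (nodal rs)).[z] * \sum_(m <- rs) (k m)%:C / (z - m%:C).
Proof.
move=> r0 z0; rewrite /cpoly /pfnum raddf_sum /= horner_sum mulr_sumr !big_seq.
apply: eq_bigr => m mr; have zm : z - m%:C != 0.
  by apply: contra z0; rewrite subr_eq0 => /eqP ->.
rewrite (nodal_factor r0 mr) map_polyZ /= rmorphM /= rmorphB /= map_polyX map_polyC /= !horner_ops.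
by field.
Qed.

(** The imaginary part of c / (z - m) has the sign opposite to that of Im z. *)
Lemma Im_term_lt0 (c m : R) (z : R[i]) : 0 < c -> complex.Im z != 0 ->
  0 < - (complex.Im z * complex.Im (c%:C / (z - m%:C))).
Proof.
case: z => a b c0 /= b0.
have d0 : 0 < (a - m) ^+ 2 + b ^+ 2 by rewrite ltr_wpDl ?sqr_ge0 // exprn_even_gt0.
simpc; rewrite /= ?mul0r ?addr0 ?subr0 ?oppr0.
have -> : b * (c * (b / ((a - m) ^+ 2 + b ^+ 2))) =
   c * b ^+ 2 / ((a - m) ^+ 2 + b ^+ 2) by ring.
by rewrite divr_gt0 // mulr_gt0 // exprn_even_gt0.
Qed.

Section Peel.
Variables (rs : seq R) (C : {poly R}).
Hypotheses (u : uniq rs) (r0 : 0 \notin rs) (sC : (size C <= size rs)%N).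
Hypothesis hpos : forall m, m \in rs -> 0 < C.[m] * (nodal rs)^`().[m].
Hypothesis rs0 : rs != [::].

Let k m := C.[m] / (nodal rs)^`().[m].
Let K := \sum_(m <- rs) k m.
Let g := nodal rs - K^-1 *: ('X * C).

Let kpos m : m \in rs -> 0 < k m.
Proof.
move=> /hpos h; have d0 : (nodal rs)^`().[m] != 0.
  by apply: contraTneq h => ->; rewrite mulr0 ltxx.
by rewrite /k -(pmulr_lgt0 _ (_ : 0 < (nodal rs)^`().[m] ^+ 2)) ?exprn_even_gt0 // expr2 mulrA
  divfK.
Qed.

Lemma sum_seq_gt0 (f : R -> R) : (forall m, m \in rs -> 0 < f m) -> 0 < \sum_(m <- rs) f m.
Proof.
move: rs0; case: rs => // m l _ h; rewrite big_cons ltr_pwDl ?h ?mem_head // big_seq.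
by apply: sumr_ge0 => n nl; apply/ltW/h; rewrite inE nl orbT.
Qed.

Lemma peel_gt0 : 0 < K. Proof. exact: sum_seq_gt0. Qed.

Let CE : C = pfnum rs k. Proof. exact: nodal_lagrange. Qed.

Let K0 : K != 0. Proof. by rewrite gt_eqF // peel_gt0. Qed.

(** Subtracting the value K at infinity lowers the degree: x / (x - m) - 1 is
    m / (x - m). *)
Let gE : g = - K^-1 *: pfnum rs (fun m => k m * m).
Proof.
have e := pfnum_mulX k r0; rewrite -CE -/K in e.
by rewrite /g e scalerDr scalerA mulVf // scale1r opprD addNKr scaleNr.
Qed.

Let rsm m : m \in rs -> m != 0. Proof. by move=> mr; apply: contraNneq r0 => <-. Qed.

(** At a root of g the fraction with residues k m * m vanishes; multiplied by z, it
    shows that the one with residues k m * m^2 is real there, although each of its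
    terms has an imaginary part of the same strict sign. *)
Let g_nonreal (z : R[i]) : complex.Im z != 0 -> (cpoly g).[z] != 0.
Proof.
move=> z0; apply/negP => /eqP; rewrite gE cpolyZ_eval => /eqP; rewrite mulf_eq0.
have -> : ((- K^-1)%:C == 0) = false by rewrite eq_complex /= eqxx andbT oppr_eq0 invr_eq0 (negPf
  K0).
move=> /eqP h; have := congr1 (fun p => (cpoly p).[z]) (pfnum_mulX (fun m => k m * m) r0).
rewrite cpolyM_eval h mulr0 cpolyD_eval cpolyZ_eval cpfnum_eval // [_%:C * _]mulrC -mulrDr =>
  /esym/eqP.
rewrite mulf_eq0 (negPf (cnodal_neq0 r0 z0)) /= addrC addr_eq0 => /eqP/(congr1 (@complex.Im R)).
rewrite Im_sum /= oppr0 => hI.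
suff : 0 < - (complex.Im z * \sum_(m <- rs) complex.Im ((k m * m * m)%:C / (z - m%:C))).
  by rewrite hI mulr0 oppr0 ltxx.
rewrite mulr_sumr -sumrN; apply: sum_seq_gt0 => m mr.
by apply: Im_term_lt0 => //; rewrite -mulrA mulr_gt0 ?kpos // -expr2 exprn_even_gt0 //= rsm.
Qed.

(** By the Cauchy-Schwarz inequality with weights k, in the sharp form of a sum of
    squares of the deviations of the cofactors from their mean C / K. *)
Let g_pos x : g.[x] = 0 -> 0 < C.[x] * g^`().[x].
Proof.
move=> gx.
have KA : K * (nodal rs).[x] = x * C.[x].
  move: gx; rewrite /g !horner_ops => /eqP; rewrite subr_eq0 => /eqP ->; rewrite mulrA mulfV //
    mul1r.
  by [].
have e1 : C * g^`() - C^`() * g = (C * (nodal rs)^`() - C^`() * nodal rs) - K^-1 *: C ^+ 2.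
  rewrite /g derivB derivZ derivM derivX -!mul_polyC; ring.
have e2 : C.[x] * g^`().[x] = \sum_(m <- rs) k m * (nodal_part rs m).[x] ^+ 2 - K^-1 * C.[x] ^+ 2.
  (* The Wronskian of C and nodal rs is the sum of the k m times the squares of the cofactors. *)
  have W := pfnum_wronskian k r0; rewrite -CE in W; rewrite W in e1.
  have := congr1 (horner^~ x) e1; rewrite /= 2!hornerD 2!hornerN 2!hornerM gx mulr0 subr0.
  rewrite hornerZ horner_exp horner_sum => ->.
  by congr (_ - _); apply: eq_bigr => m _; rewrite hornerZ horner_exp.
have Cs : C.[x] = \sum_(m <- rs) k m * (nodal_part rs m).[x].
  by rewrite {1}CE /pfnum horner_sum; apply: eq_bigr => m _; rewrite hornerZ.
have -> : C.[x] * g^`().[x] = \sum_(m <- rs) k m * ((nodal_part rs m).[x] - C.[x] / K) ^+ 2.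
  have ee m : k m * ((nodal_part rs m).[x] - C.[x] / K) ^+ 2 = k m * (nodal_part rs m).[x] ^+ 2
      - 2 * (C.[x] / K) * (k m * (nodal_part rs m).[x]) + (C.[x] / K) ^+ 2 * k m by ring.
  rewrite e2 (eq_bigr _ (fun m _ => ee m)) big_split sumrB /= -!mulr_sumr -Cs -/K.
  field; exact: K0.
apply: sum_seq_gt0 => m mr; rewrite mulr_gt0 ?kpos // exprn_even_gt0 //= subr_eq0.
apply/negP => /eqP h.
have Ax : (nodal rs).[x] = (x - m) * (nodal_part rs m).[x] by rewrite {1}(nodal_factor r0 mr)
  !horner_ops.
have : m * C.[x] = 0.
  have h2 : C.[x] = K * (nodal_part rs m).[x] by rewrite h mulrC divfK.
  by move: KA; rewrite Ax h2 => KA; move/eqP: KA; rewrite -subr_eq0 => /eqP KA; nra.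
move/eqP; rewrite mulf_eq0 (negPf (rsm mr)) /= => /eqP Cx0.
have : x \in rs.
  rewrite -root_nodal // /root; move/eqP: KA; rewrite Cx0 mulr0 mulf_eq0 (negPf K0) //.
by move/hpos; rewrite Cx0 mul0r ltxx.
Qed.

Let size_rs : (0 < size rs)%N. Proof. by case: rs rs0. Qed.

(** One step of the continued fraction.  The constant K is the value at infinity of
    - slope / value, hence the reciprocal of the distance to the next node; g is
    the value of the solution at that node, and q, the polynomial part of C / g,
    is minus the weight of the node divided by its position. *)
Lemma peel : exists q : {poly R}, exists rs', [/\
  nodal rs - K^-1 *: ('X * C) = nodal rs', uniq rs', 0 \notin rs' & (size rs' < size rs)%N] /\
  [/\ (size q <= 2)%N, q`_1 <= 0, q`_0 != 0 \/ q`_1 != 0,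
      (size (C - q * nodal rs')%R <= size rs')%N &
      forall m, m \in rs' -> 0 < (C - q * nodal rs').[m] * (nodal rs')^`().[m]].
Proof.
have g0 : g.[0] = 1 by rewrite /g !horner_ops nodal0 mul0r mulr0 subr0.
have [x gx|rs' [u' r0' e]] := real_split g0 g_nonreal.
  by apply: contraTneq (g_pos gx) => ->; rewrite mulr0 ltxx.
have gn0 : g != 0 by rewrite e nodal_neq0.
exists (C %/ g), rs'; rewrite -/g -e.
have sg : (size g <= size rs)%N.
  by rewrite gE; apply: leq_trans (size_scale_leq _ _) _; exact: size_pfnum.
have sg' : size g = (size rs').+1 by rewrite e size_nodal.
split; first by split => //; rewrite -sg'.
have sCe : size C = size rs by rewrite CE size_pfnum_eq.
have Cn0 : C != 0 by rewrite -size_poly_gt0 sCe.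
have sq : size (C %/ g) = (size rs - (size g).-1)%N by rewrite size_divp // sCe.
have modE : C - C %/ g * g = C %% g by rewrite {1}(divp_eq C g) addrC addKr.
have last2 : (size (C - C %/ g * g)%R <= size rs')%N.
  by rewrite modE -ltnS -sg' ltn_modp.
have last3 m : m \in rs' -> 0 < (C - C %/ g * g).[m] * g^`().[m].
  move=> mr; have gm : g.[m] = 0 by apply/eqP; rewrite -/(root _ _) e root_nodal.
  by rewrite hornerD hornerN hornerM gm mulr0 subr0; apply: g_pos.
(* The degree of g drops by one more exactly when S1 vanishes; that is when the node carries a
  dipole. *)
pose S1 := \sum_(m <- rs) k m * m.
have [S10|S10] := eqVneq S1 0; last first.
  have sgE : size g = size rs.
    by rewrite gE size_scale ?oppr_eq0 ?invr_eq0 // size_pfnum_eq.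
  have sq1 : size (C %/ g) = 1%N.
    by rewrite sq sgE -{1}(prednK size_rs) subSnn.
  have q1 : (C %/ g)`_1 = 0 by rewrite nth_default // sq1.
  split => //; [by rewrite sq1|by rewrite q1|left].
  have := lead_coef_eq0 (C %/ g); rewrite lead_coefE sq1 /= => ->.
  by rewrite -size_poly_eq0 sq1.
have S20 : 0 < \sum_(m <- rs) k m * m * m.
  apply: sum_seq_gt0 => m mr; rewrite -mulrA mulr_gt0 ?kpos // -expr2 exprn_even_gt0 //=.
  exact: rsm.
have Xg : 'X * g = - K^-1 *: pfnum rs (fun m => k m * m * m).
  by rewrite gE -scalerAr pfnum_mulX // -/S1 S10 scale0r add0r.
have sXg : (size g).+1 = size rs.
  rewrite -(size_mulX gn0) mulrC Xg size_scale ?oppr_eq0 ?invr_eq0 // size_pfnum_eq //.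
  by rewrite gt_eqF.
have sq2 : size (C %/ g) = 2%N.
  rewrite sq -sXg; have : (0 < size g)%N by rewrite size_poly_gt0.
  by case: (size g) => // n _ /=; rewrite -addn2 addKn.
have lg : lead_coef g = - K^-1 * (lead_coef (nodal rs) * \sum_(m <- rs) k m * m * m).
  rewrite -(lead_coefMX g) mulrC Xg lead_coefZ lead_coefE size_pfnum_eq ?gt_eqF //.
  by rewrite coef_pfnum.
have lC : lead_coef C = lead_coef (nodal rs) * K.
  by rewrite lead_coefE sCe CE coef_pfnum.
have lq : lead_coef (C %/ g) * lead_coef g = lead_coef C.
  rewrite -lead_coefM {2}(divp_eq C g) lead_coefDl //.
  apply: leq_trans (_ : (size g <= _)%N); first by rewrite ltn_modp.
  by rewrite size_mul // ?sq2 ?leqnSn // -size_poly_eq0 sq2.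
have l0 : lead_coef (nodal rs) != 0 by rewrite lead_coef_eq0 nodal_neq0.
have q1 : (C %/ g)`_1 < 0.
  have := lq; rewrite {1}lead_coefE sq2 /= lg lC; move: (lead_coef _) l0 K0 S20 peel_gt0.
  move: (\sum_(m <- rs) _) => S2 L L0 K0' S2p Kp h.
  have h2 : (C %/ g)`_1 = - (K ^+ 2 / S2).
    apply: (mulIf (_ : - K^-1 * (L * S2) != 0)).
      by rewrite !mulf_neq0 ?oppr_eq0 ?invr_eq0 // gt_eqF.
    by rewrite h; field; rewrite K0' gt_eqF.
  by rewrite h2 oppr_lt0 divr_gt0 // exprn_gt0.
split => //; [by rewrite sq2|exact: ltW|right; by rewrite lt_eqF].
Qed.

End Peel.

(** Induction on the number of roots: peel off the leftmost node and apply the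
    induction hypothesis beyond it. *)
Theorem inverse_string rs (C : {poly R}) (y0 : R) :
  uniq rs -> 0 \notin rs -> (size C <= size rs)%N ->
  (forall m, m \in rs -> 0 < C.[m] * (nodal rs)^`().[m]) -> 0 <= y0 ->
  exists s, [/\ is_string y0 s, profile s y0 = nodal rs & rslope s = C].
Proof.
move: {2}(size rs).+1 (ltnSn (size rs)) => n.
elim: n rs C y0 => // n IH rs C y0; rewrite ltnS => sn u r0 sC hpos y00.
have [rs0|rs0] := eqVneq rs [::].
  exists [::]; move: sC; rewrite rs0 leqn0 size_poly_eq0 => /eqP ->.
  by rewrite /profile /intercept /rslope /= mulr0 scaler0 subr0 /nodal big_nil.
have [q [rs' [[e u' r0' srs'] [sq q1 q01 sC' hpos']]]] := peel u r0 sC hpos rs0.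
have K0 := peel_gt0 hpos rs0.
set K := \sum_(m <- rs) _ in K0 e.
(* The distance to the next node is the reciprocal of the value at infinity. *)
pose y1 := y0 + K^-1.
have y1p : 0 < y1 by rewrite ltr_wpDl // invr_gt0.
have [s [hs gs ss]] := IH rs' _ y1 (leq_trans srs' sn) u' r0' sC' hpos' (ltW y1p).
pose t : R * R * R := (y1, - y1 * q`_0, - y1 * q`_1).
have qE : node_poly t = - y1 *: q.
  apply/polyP => i; rewrite /node_poly /t /mass /dipole /= !coefE.
  case: i => [|[|i]] /=; rewrite ?mulr0 ?addr0 ?add0r ?mulr1 //.
  by rewrite nth_default ?mulr0 //; apply: leq_trans sq _.
have Cs : rslope (t :: s) = C.
  rewrite rslope_cons gs ss qE {1}/t /pos /= -scalerAl scalerA mulrN mulVf ?gt_eqF //.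
  by rewrite scaleN1r opprK subrK.
exists (t :: s); split => //.
  rewrite /= hs andbT {1}/pos /= ltrDl invr_gt0 K0 /= /good_node /t /mass /dipole /=.
  rewrite mulNr oppr_ge0 pmulr_rle0 // q1 /=.
  have v0 : 0 <= - (y1 * q`_1) by rewrite oppr_ge0 pmulr_rle0.
  case: q01 => h; first by rewrite ltr_pwDl // normr_gt0 mulf_neq0 // oppr_eq0 gt_eqF.
  by rewrite ltr_wpDl // lt0r v0 andbT oppr_eq0 mulf_neq0 // gt_eqF.
have yK : pos t - y0 = K^-1 by rewrite /pos /= /y1 addrC addKr.
by rewrite profile_cons ?gt_eqF // yK Cs gs -e subrK.
Qed.

(** The substitution y -> 1 / y exchanges the two ends of the string; it is the
    substitution x -> - x in the original variable. *)
Definition reflect s := rev [seq ((pos t)^-1, mass t, dipole t) | t <- s].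

Lemma reflect_rcons s t :
  reflect (rcons s t) = ((pos t)^-1, mass t, dipole t) :: reflect s.
Proof. by rewrite /reflect map_rcons rev_rcons. Qed.

Lemma profile_eval s y l : (profile s y).[l] = (intercept s).[l] - y * (l * (rslope s).[l]).
Proof. by rewrite /profile hornerD hornerN hornerZ hornerM hornerX. Qed.

Lemma intercept_cons_eval t s l :
  (intercept (t :: s)).[l] = (intercept s).[l] - l * ((node_poly t).[l] * (profile s (pos t)).[l]).
Proof. by rewrite intercept_cons hornerD hornerN 2!hornerM hornerX. Qed.

Lemma rslope_cons_eval t s l :
  (rslope (t :: s)).[l] = (rslope s).[l] - (pos t)^-1 * ((node_poly t).[l] * (profile s (pos
    t)).[l]).
Proof. by rewrite rslope_cons hornerD hornerN hornerZ hornerM. Qed.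

(** The right-hand side is the Wronskian of the solutions from the right and from
    the left, which does not depend on the point where the string is cut. *)
Lemma intercept_cat s1 s : all (fun t => pos t != 0) s1 ->
  intercept (s1 ++ s) = intercept s * intercept (reflect s1) - 'X ^+ 2 * (rslope s * rslope
    (reflect s1)).
Proof.
elim/last_ind: s1 s => [|s1 t IH] s; first by rewrite /intercept /rslope /= !mulr0 subr0 mulr1.
rewrite all_rcons => /andP[t0 h]; rewrite cat_rcons IH // reflect_rcons.
set t' := (_, _, _); rewrite !intercept_cons !rslope_cons.
have -> : node_poly t' = node_poly t by [].
have -> : pos t' = (pos t)^-1 by [].
rewrite invrK.
have eg y s' : profile s' y = intercept s' - y%:P * ('X * rslope s') by rewrite /profile mul_polyC.
rewrite -!mul_polyC !eg; move: (node_poly t) (intercept s) (rslope s) (intercept (reflect s1))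
  (rslope (reflect s1)).
move: (pos t)%:P (pos t)^-1%:P => y y' q A C H J; ring.
Qed.

(** At a root of the characteristic polynomial the solutions from the two ends are
    proportional; the factor is - l times the reduced slope at 0. *)
Lemma cat_root s1 s (l : R) : all (fun t => pos t != 0) s1 -> (intercept (s1 ++ s)).[l] = 0 ->
  (intercept s).[l] = l ^+ 2 * ((rslope (s1 ++ s)).[l] * (rslope (reflect s1)).[l]) /\
  (rslope s).[l] = (rslope (s1 ++ s)).[l] * (intercept (reflect s1)).[l].
Proof.
elim/last_ind: s1 s => [|s1 t IH] s.
  by move=> _ /= ->; rewrite /intercept /rslope /= horner0 !mulr0 hornerC mulr1.
rewrite all_rcons => /andP[t0 h]; rewrite cat_rcons => e.
have [e1 e2] := IH _ h e; rewrite reflect_rcons; set t' := (_, _, _).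
move: e1 e2; rewrite !intercept_cons_eval !rslope_cons_eval.
have -> : node_poly t' = node_poly t by [].
have -> : pos t' = (pos t)^-1 by [].
rewrite invrK !profile_eval.
set Cf := (rslope (s1 ++ t :: s)).[l]; move: (node_poly t).[l] (intercept s).[l] (rslope s).[l].
move: (intercept (reflect s1)).[l] (rslope (reflect s1)).[l] => H J q A C e1 e2.
have eC : C = Cf * H + (pos t)^-1 * (q * (A - pos t * (l * C))) by rewrite -e2; ring.
have eA : A = l ^+ 2 * (Cf * J) + l * (q * (A - pos t * (l * C))) by rewrite -e1; ring.
move: eA eC; move eg: (A - pos t * (l * C)) => g eA eC.
have gE : g = - (l * pos t * Cf * (H - (pos t)^-1 * (l * J))).
  by rewrite -eg eA eC; field; exact: t0.
split; first by rewrite eA gE; field; exact: t0.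
by rewrite eC gE; field; exact: t0.
Qed.

Lemma is_stringE c s : is_string c s = path <%R c (map pos s) && all good_node s.
Proof.
elim: s c => //= t s IH c; rewrite IH; case: (c < pos t); case: (good_node t) => //=.
by rewrite andbF.
Qed.

Lemma is_string_all c s t : is_string c s -> t \in s -> c < pos t.
Proof.
rewrite is_stringE path_sortedE; last exact: lt_trans.
by case/andP => /andP[/allP h _] _ ts; apply: h; apply: map_f.
Qed.

Lemma is_string_reflect c s b : 0 < b -> 0 <= c -> is_string c s -> (forall t, t \in s -> pos t <
  b) ->
  is_string b^-1 (reflect s).
Proof.
move=> b0; elim: s c => // t s IH c c0 hs hb; have t0 := is_string_cons_neq0 c0 hs.
case/and3P: hs => ct gt hs.
have -> : reflect (t :: s) = reflect s ++ [:: ((pos t)^-1, mass t, dipole t)].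
  by rewrite /reflect /= rev_cons -cats1.
have tb : pos t < b by apply: hb; exact: mem_head.
pose d := (pos t)^-1.
have hr : is_string b^-1 (reflect s).
  by apply: (IH (pos t)) => //; [exact: ltW|move=> t' ts; apply: hb; rewrite inE ts orbT].
rewrite is_stringE map_cat cat_path all_cat /=; move: hr; rewrite is_stringE => /andP[-> ->] /=.
have -> : good_node ((pos t)^-1, mass t, dipole t) by exact: gt.
rewrite !andbT.
case: s {IH} hs hb => [|t' s] hs hb.
  by rewrite /reflect /= ltf_pV2.
have -> : reflect (t' :: s) = rcons (reflect s) ((pos t')^-1, mass t', dipole t').
  by rewrite /reflect /= rev_cons.
rewrite map_rcons last_rcons {1}/pos /= {2}/pos /=.
by case/and3P: hs => h _ _; rewrite ltf_pV2 // posrE; exact: lt_trans h.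
Qed.

Lemma reflectK s : reflect (reflect s) = s.
Proof.
rewrite /reflect map_rev revK -map_comp; rewrite -[RHS]map_id; apply: eq_map => t /=.
by case: t => [[y m] v]; rewrite /pos /mass /dipole /= invrK.
Qed.

End Inverse.

(** * Solutions between the nodes *)

Section Exp.
Context {R : realType}.

Definition decay (x : R) : R := expR (- x / 2).
Definition growth (x : R) : R := expR (x / 2).

Lemma decay_growth x : decay x * growth x = 1.
Proof. by rewrite /decay /growth -expRD mulNr addNr expR0. Qed.

Lemma decay_gt0 x : 0 < decay x. Proof. exact: expR_gt0. Qed.
Lemma growth_gt0 x : 0 < growth x. Proof. exact: expR_gt0. Qed.

Lemma growth_sqr x : growth x ^+ 2 = expR x.
Proof. by rewrite /growth expr2 -expRD -splitr. Qed.

Lemma decay_sqr x : decay x ^+ 2 = (expR x)^-1.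
Proof. by rewrite /decay expr2 -expRD -splitr expRN. Qed.

Lemma decay_growthV x : decay x = growth x * (expR x)^-1.
Proof. by rewrite /decay /growth -expRN -expRD; congr expR; rewrite {3}(splitr x); ring. Qed.

Definition expsol (A B x : R) : R := A * decay x + B * growth x.
Definition expsol1 (A B x : R) : R := (- A * decay x + B * growth x) / 2.

Lemma is_derive_decay (x : R) : is_derive x 1 decay (- decay x / 2).
Proof.
rewrite /decay; apply: is_derive_eq; rewrite /GRing.scale /=; ring.
Qed.

Lemma is_derive_growth (x : R) : is_derive x 1 growth (growth x / 2).
Proof.
rewrite /growth; apply: is_derive_eq; rewrite /GRing.scale /=; ring.
Qed.

Lemma is_derive_expsol (A B x : R) : is_derive x 1 (expsol A B) (expsol1 A B x).
Proof.
have h1 := is_derive_decay x; have h2 := is_derive_growth x.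
have -> : expsol A B = (cst A * decay) + (cst B * growth) by [].
apply: is_derive_eq; rewrite /GRing.scale /= /expsol1; ring.
Qed.

Lemma is_derive_expsol1 (A B x : R) : is_derive x 1 (expsol1 A B) (expsol A B x / 4).
Proof.
have -> : expsol1 A B = expsol (- A / 2) (B / 2) by apply/funext => y; rewrite /expsol1 /expsol;
  field.
have -> : expsol A B x / 4 = expsol1 (- A / 2) (B / 2) x by rewrite /expsol1 /expsol; field.
exact: is_derive_expsol.
Qed.

Lemma is_derive_cont (f : R -> R) (x d : R) : is_derive x 1 f d -> f @ x --> f x.
Proof. by move=> h; apply/differentiable_continuous/derivable1_diffP. Qed.

Lemma expsol_cont (A B x : R) : expsol A B @ x --> expsol A B x.
Proof. exact: is_derive_cont (is_derive_expsol A B x). Qed.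

Lemma expsol1_cont (A B x : R) : expsol1 A B @ x --> expsol1 A B x.
Proof. exact: is_derive_cont (is_derive_expsol1 A B x). Qed.

Lemma derive0_const (I : set R) (c : R -> R) :
  (forall x y z, I x -> I y -> x <= z <= y -> I z) ->
  (forall x, I x -> is_derive x 1 c 0) -> forall x y, I x -> I y -> c x = c y.
Proof.
move=> hI hc; suff h x y : I x -> I y -> x <= y -> c x = c y.
  by move=> x y Ix Iy; case/orP: (le_total x y) => /h; [exact|move=> ->].
move=> Ix Iy xy; have inI z : z \in `[x, y] -> I z by rewrite in_itv /=; exact: hI.
have [||w _] := @MVT_segment R c (fun=> 0) x y xy.
- by move=> z zxy; apply/hc/inI; exact: subset_itv_oo_cc.
- apply: continuous_in_subspaceT => z; rewrite inE /= => /inI /hc; exact: is_derive_cont.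
by rewrite mul0r => /eqP; rewrite subr_eq0 => /eqP ->.
Qed.

(** The combinations (f / 2 - f') e^(x/2) and (f / 2 + f') e^(-x/2) have derivative
    zero. *)
Lemma real_ode (I : set R) (f f1 f2 : R -> R) :
  (forall x y z, I x -> I y -> x <= z <= y -> I z) ->
  (forall x, I x -> [/\ is_derive x 1 f (f1 x), is_derive x 1 f1 (f2 x) & f2 x = f x / 4]) ->
  exists A B, forall x, I x -> f x = expsol A B x /\ f1 x = expsol1 A B x.
Proof.
move=> hI h; case: (pselect (exists x0, I x0)) => [[x0 Ix0]|no]; last first.
  by exists 0, 0 => x Ix; case: no; exists x.
pose a x := (f x / 2 - f1 x) * growth x; pose b x := (f x / 2 + f1 x) * decay x.
have ha x : I x -> is_derive x 1 a 0.
  move=> /h[h1 h2 h3]; have h4 := is_derive_growth x.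
  have -> : a = (cst 2^-1 * f - f1) * growth by apply/funext => y; rewrite /a /= [f y / 2]mulrC.
  apply: is_derive_eq; rewrite /GRing.scale /= h3.
  have -> : (cst 2^-1 * f - f1) x = 2^-1 * f x - f1 x by [].
  by field.
have hb x : I x -> is_derive x 1 b 0.
  move=> /h[h1 h2 h3]; have h4 := is_derive_decay x.
  have -> : b = (cst 2^-1 * f + f1) * decay by apply/funext => y; rewrite /b /= [f y / 2]mulrC.
  apply: is_derive_eq; rewrite /GRing.scale /= h3.
  have -> : (cst 2^-1 * f + f1) x = 2^-1 * f x + f1 x by [].
  by field.
exists (a x0), (b x0); move=> x Ix.
rewrite (derive0_const hI ha Ix0 Ix) (derive0_const hI hb Ix0 Ix) /expsol /expsol1 /a /b.
have e := decay_growth x; split.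
  transitivity (f x * (decay x * growth x)); first by rewrite e mulr1.
  by field.
transitivity (f1 x * (decay x * growth x)); first by rewrite e mulr1.
by field.
Qed.

Lemma expsol_bounded_r A B M X : (forall x, X <= x -> `|expsol A B x| <= M) -> B = 0.
Proof.
move=> h; apply/eqP/negPn/negP => B0.
have nB : 0 < `|B| by rewrite normr_gt0.
(* The growing term is at least |B| (1 + x / 2), which exceeds the bound at this x. *)
pose x := Num.max (Num.max X 0) (2 * (`|M| + `|A|) / `|B|).
have xX : X <= x by rewrite /x !le_max lexx.
have x0 : 0 <= x by rewrite /x !le_max lexx orbT.
have xb : (`|M| + `|A|) <= `|B| * (x / 2).
  have : 2 * (`|M| + `|A|) / `|B| <= x by rewrite /x !le_max lexx !orbT.
  rewrite ler_pdivrMr // mulrA ler_pdivlMr // => hh.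
  by rewrite mulrC [`|B| * x]mulrC.
clearbody x.
have e1 : 1 + x / 2 <= growth x by exact: expR_ge1Dx.
have e2 : decay x <= 1.
  by rewrite -[leRHS]expR0 ler_expR mulNr oppr_le0 divr_ge0.
have := h x xX; apply/negP; rewrite -ltNge; apply: le_lt_trans (ler_norm M) _.
have t1 : `|B| * growth x <= `|expsol A B x| + `|A|.
  have -> : `|B| * growth x = `|expsol A B x - A * decay x|.
    by rewrite /expsol addrAC subrr add0r normrM (gtr0_norm (growth_gt0 x)).
  apply: le_trans (ler_normB _ _) _; rewrite lerD2l normrM (gtr0_norm (decay_gt0 x)).
  by rewrite ler_piMr.
have t2 : `|B| * (1 + x / 2) <= `|B| * growth x by rewrite ler_pM2l.
lra.
Qed.

Lemma expsol_bounded_l A B M X : (forall x, x <= X -> `|expsol A B x| <= M) -> A = 0.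
Proof.
move=> h; apply: (@expsol_bounded_r B A M (- X)) => x xX.
have := h (- x); rewrite /expsol {1}/decay {1}/growth opprK -/(growth x) -/(decay x) addrC; apply.
by rewrite lerNl.
Qed.

End Exp.

(** * The nodes to the right of a moving point *)

Section NearList.
Context {R : realType}.
Implicit Types (t : R * R * R) (s : seq (R * R * R)).

Definition nodes_gt x s := [seq t <- s | x < pos t].
Definition nodes_ge x s := [seq t <- s | x <= pos t].

Lemma near_right_gt s (x0 : R) : \forall x \near x0^'+, nodes_gt x s = nodes_gt x0 s.
Proof.
elim: s => [|t s IH]; first by near=> x.
case: (ltP x0 (pos t)) => h; near=> x.
  rewrite /nodes_gt /= h; have -> : x < pos t by near: x; exact: nbhs_right_lt.
  by congr (_ :: _); near: x.
rewrite /nodes_gt /= [x0 < _]ltNge h /=; have -> : (x < pos t) = false.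
  by apply/negbTE; rewrite -leNgt; apply: le_trans h _; near: x; exact: nbhs_right_ge.
by near: x.
Unshelve. all: by end_near. Qed.

Lemma near_left_ge s (x0 : R) : \forall x \near x0^'-, nodes_gt x s = nodes_ge x0 s.
Proof.
elim: s => [|t s IH]; first by near=> x.
case: (leP x0 (pos t)) => h; near=> x.
  rewrite /nodes_gt /nodes_ge /= h; have -> : x < pos t.
    by apply: lt_le_trans h; near: x; exact: nbhs_left_lt.
  by congr (_ :: _); near: x.
rewrite /nodes_gt /nodes_ge /= [x0 <= _]leNgt h /=; have -> : (x < pos t) = false.
  by apply/negbTE; rewrite -leNgt; near: x; exact: nbhs_left_ge.
by near: x.
Unshelve. all: by end_near. Qed.

Lemma nodes_ge_out s x : x \notin [seq pos t | t <- s] -> nodes_ge x s = nodes_gt x s.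
Proof.
move=> xs; apply: eq_in_filter => t ts; rewrite le_eqVlt.
by case: eqP => // e; move/negP: xs; case; rewrite e; apply: map_f.
Qed.

Lemma nodes_gt_nil s x : all (fun t => x < pos t) s -> nodes_gt x s = s.
Proof. by move=> h; apply/all_filterP. Qed.

Lemma nodes_ge_in s t : sorted <%R [seq pos t | t <- s] -> t \in s ->
  nodes_ge (pos t) s = t :: nodes_gt (pos t) s.
Proof.
elim: s => //= t' s IH; rewrite path_sortedE; last exact: lt_trans.
move=> /andP[h1 h2]; rewrite inE => /predU1P[->|ts].
  rewrite /nodes_ge /nodes_gt /= lexx ltxx; congr (_ :: _); apply: eq_in_filter => u us.
  have : pos t' < pos u by apply: (allP h1); exact: map_f.
  by move=> h; rewrite h ltW.
have : pos t' < pos t by apply: (allP h1); exact: map_f.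
move=> h; rewrite /nodes_ge /nodes_gt /= leNgt h /= -/(nodes_ge _ _) IH //.
by rewrite /nodes_gt lt_gtF.
Qed.

Lemma sorted_split s x : sorted <%R [seq pos t | t <- s] -> x \notin [seq pos t | t <- s] ->
  s = [seq t <- s | pos t < x] ++ nodes_gt x s.
Proof.
elim: s => //= t s IH; rewrite path_sortedE; last exact: lt_trans.
move=> /andP[h1 h2]; rewrite inE negb_or => /andP[xt xs].
case: (ltgtP (pos t) x) xt => // h _.
  by rewrite /= -/(nodes_gt _ _) -IH.
have -> : [seq t <- s | pos t < x] = [::].
  rewrite -(filter_pred0 s); apply: eq_in_filter => u us /=.
  have hu : pos t < pos u by apply: (allP h1); exact: map_f.
  by rewrite lt_gtF // (lt_trans h).
rewrite /= -/(nodes_gt _ _) nodes_gt_nil //; apply/allP => u us.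
by apply: lt_trans h _; apply: (allP h1); exact: map_f.
Qed.

End NearList.

(** * Solutions across the nodes *)

Section Solutions.
Context {R : realType}.
Implicit Types (p : coef_pair R) (z : R[i]) (f : R -> R[i]) (t : R * R * R)
  (s : seq (R * R * R)) (c : R[i] * R[i]).

Definition cexpsol c x : R[i] := c.1 * (decay x)%:C + c.2 * (growth x)%:C.
Definition cexpsol1 c x : R[i] := (- c.1 * (decay x)%:C + c.2 * (growth x)%:C) / 2.

Lemma Re_cexpsol c x : complex.Re (cexpsol c x) = expsol (complex.Re c.1) (complex.Re c.2) x.
Proof. by case: c => [[a b] [d e]]; rewrite /cexpsol /expsol /=; simpc. Qed.

Lemma Im_cexpsol c x : complex.Im (cexpsol c x) = expsol (complex.Im c.1) (complex.Im c.2) x.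
Proof. by case: c => [[a b] [d e]]; rewrite /cexpsol /expsol /=; simpc. Qed.

Lemma half_complex (z : R[i]) : z / 2 = (complex.Re z / 2) +i* (complex.Im z / 2).
Proof.
have -> : 2 = (2 : R)%:C :> R[i] by rewrite -[2]/(1 + 1) rmorphD rmorph1.
rewrite -fmorphV; case: z => a b /=; by simpc.
Qed.

Lemma Re_cexpsol1 c x : complex.Re (cexpsol1 c x) = expsol1 (complex.Re c.1) (complex.Re c.2) x.
Proof. by rewrite /cexpsol1 half_complex; case: c => [[a b] [d e]]; rewrite /expsol1 /=; simpc. Qed.

Lemma Im_cexpsol1 c x : complex.Im (cexpsol1 c x) = expsol1 (complex.Im c.1) (complex.Im c.2) x.
Proof. by rewrite /cexpsol1 half_complex; case: c => [[a b] [d e]]; rewrite /expsol1 /=; simpc. Qed.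

Lemma complex_eq (a b : R[i]) :
  complex.Re a = complex.Re b -> complex.Im a = complex.Im b -> a = b.
Proof. by case: a b => [a b] [c d] /= -> ->. Qed.

Lemma quarter_complex (z w : R[i]) : - w + z / 4 = 0 ->
  complex.Re w = complex.Re z / 4 /\ complex.Im w = complex.Im z / 4.
Proof.
have -> : 4 = (4 : R)%:C :> R[i] by rewrite -[4%:R]/(1 *+ 4) rmorphMn rmorph1.
rewrite -fmorphV addrC => /eqP; rewrite subr_eq0 => /eqP <-.
by case: z => a b /=; simpc.
Qed.

(** The coefficients to the left of the node t, given those to its right. *)
Definition node_step z t c : R[i] * R[i] :=
  let q := z * (mass t)%:C + z ^+ 2 * (dipole t)%:C in
  (c.1 - q * cexpsol c (pos t) * (growth (pos t))%:C, c.2 + q * cexpsol c (pos t) * (decay (pos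
    t))%:C).

Definition transfer z s c := foldr (node_step z) c s.

(** The solution with coefficients c near +oo, its coefficients at x being obtained
    by crossing the nodes to the right of x. *)
Definition Phi z s c x : R[i] := cexpsol (transfer z (nodes_gt x s) c) x.
Definition Phi1 z s c x : R[i] := cexpsol1 (transfer z (nodes_gt x s) c) x.

Lemma decay_growthC x : (decay x)%:C * (growth x)%:C = 1 :> R[i].
Proof. by rewrite -rmorphM decay_growth rmorph1. Qed.

Lemma node_step_cont z t c : cexpsol (node_step z t c) (pos t) = cexpsol c (pos t).
Proof.
rewrite {1}/cexpsol /node_step /=; set q := z * _ + _; set F := cexpsol c (pos t).
rewrite mulrBl mulrDl; have -> : F = c.1 * (decay (pos t))%:C + c.2 * (growth (pos t))%:C by [].
ring.
Qed.

Lemma node_step_jump z t c : cexpsol1 (node_step z t c) (pos t) = cexpsol1 c (pos t)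
  + z * (mass t)%:C * cexpsol c (pos t) + z ^+ 2 * (dipole t)%:C * cexpsol c (pos t).
Proof.
have e := decay_growthC (pos t); rewrite /cexpsol1 /node_step /=; set F := cexpsol c (pos t).
set q := z * _ + z ^+ 2 * _.
rewrite -[RHS]addrA -mulrDl -/q.
transitivity ((- c.1 * (decay (pos t))%:C + c.2 * (growth (pos t))%:C) / 2
  + q * F * ((decay (pos t))%:C * (growth (pos t))%:C)); last by rewrite e mulr1.
by field.
Qed.

(** Continuity and the jump of the derivative are two independent linear equations
    for the two coefficients on the left. *)
Lemma node_stepP z t c d : cexpsol d (pos t) = cexpsol c (pos t) ->
  cexpsol1 d (pos t) = cexpsol1 c (pos t) + z * (mass t)%:C * cexpsol c (pos t)
    + z ^+ 2 * (dipole t)%:C * cexpsol c (pos t) -> d = node_step z t c.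
Proof.
rewrite -node_step_jump -(node_step_cont z t c) => h1 h2; move: (node_step z t c) h1 h2 => [a b].
case: d => [a' b']; rewrite /cexpsol /cexpsol1 /=; move: (pos t) => x h1 h2.
have em0 : (decay x)%:C != 0 :> R[i] by rewrite eq_complex /= negb_and gt_eqF // decay_gt0.
have ep0 : (growth x)%:C != 0 :> R[i] by rewrite eq_complex /= negb_and gt_eqF // growth_gt0.
have two0 : (2 : R[i]) != 0 by rewrite pnatr_eq0.
have h3 : - a' * (decay x)%:C + b' * (growth x)%:C = - a * (decay x)%:C + b * (growth x)%:C.
  by have := congr1 (fun w => w * 2) h2; rewrite !divfK.
have hb : b' * (growth x)%:C = b * (growth x)%:C.
  apply: (mulfI two0); rewrite !mulr2n ?mulrDl.
  transitivity ((a' * (decay x)%:C + b' * (growth x)%:C) + (- a' * (decay x)%:C + b' * (growth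
    x)%:C)).
    by ring.
  by rewrite h1 h3; ring.
have {}hb := mulIf ep0 hb; rewrite hb.
by move: h1; rewrite hb => /addIr /(mulIf em0) ->.
Qed.

Lemma climit_unique f (F : set_system R) (FF : ProperFilter F) a b :
  climit f F a -> climit f F b -> a = b.
Proof.
move=> [a1 a2] [b1 b2]; apply: complex_eq.
  exact: (norm_cvg_unique a1 b1).
exact: (norm_cvg_unique a2 b2).
Qed.

Lemma climit_near f g (F : set_system R) (FF : Filter F) a :
  (\forall x \near F, f x = g x) -> climit f F a -> climit g F a.
Proof.
move=> h [a1 a2]; split.
  by apply: cvg_trans a1; apply: near_eq_cvg; near=> x; rewrite /re (near h x).
by apply: cvg_trans a2; apply: near_eq_cvg; near=> x; rewrite /im (near h x).
Unshelve. all: by end_near. Qed.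

Lemma re_cexpsol c : re (cexpsol c) = expsol (complex.Re c.1) (complex.Re c.2).
Proof. by apply/funext => x; exact: Re_cexpsol. Qed.
Lemma im_cexpsol c : im (cexpsol c) = expsol (complex.Im c.1) (complex.Im c.2).
Proof. by apply/funext => x; exact: Im_cexpsol. Qed.
Lemma re_cexpsol1 c : re (cexpsol1 c) = expsol1 (complex.Re c.1) (complex.Re c.2).
Proof. by apply/funext => x; exact: Re_cexpsol1. Qed.
Lemma im_cexpsol1 c : im (cexpsol1 c) = expsol1 (complex.Im c.1) (complex.Im c.2).
Proof. by apply/funext => x; exact: Im_cexpsol1. Qed.

Lemma cexpsol_climit c (x0 : R) : climit (cexpsol c) (nbhs x0) (cexpsol c x0).
Proof. by split; rewrite ?re_cexpsol ?im_cexpsol ?Re_cexpsol ?Im_cexpsol; exact: expsol_cont. Qed.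

Lemma cexpsol1_climit c (x0 : R) : climit (cexpsol1 c) (nbhs x0) (cexpsol1 c x0).
Proof. by split; rewrite ?re_cexpsol1 ?im_cexpsol1 ?Re_cexpsol1 ?Im_cexpsol1; exact: expsol1_cont.
  Qed.

Lemma climit_within f (x0 : R) (D : set R) l :
  climit f (nbhs x0) l -> climit f (within D (nbhs x0)) l.
Proof. by move=> [h1 h2]; split; exact: cvg_within_filter. Qed.

Lemma Phi_right z s c x0 : climit (Phi z s c) x0^'+ (Phi z s c x0).
Proof.
apply: (@climit_near (cexpsol (transfer z (nodes_gt x0 s) c))).
  by have h := near_right_gt s x0; near=> x; rewrite /Phi (near h x).
apply: climit_within; exact: cexpsol_climit.
Unshelve. all: by end_near. Qed.

Lemma Phi1_right z s c x0 : climit (Phi1 z s c) x0^'+ (cexpsol1 (transfer z (nodes_gt x0 s) c) x0).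
Proof.
apply: (@climit_near (cexpsol1 (transfer z (nodes_gt x0 s) c))).
  by have h := near_right_gt s x0; near=> x; rewrite /Phi1 (near h x).
apply: climit_within; exact: cexpsol1_climit.
Unshelve. all: by end_near. Qed.

Lemma Phi_left z s c x0 : climit (Phi z s c) x0^'- (cexpsol (transfer z (nodes_ge x0 s) c) x0).
Proof.
apply: (@climit_near (cexpsol (transfer z (nodes_ge x0 s) c))).
  by have h := near_left_ge s x0; near=> x; rewrite /Phi (near h x).
apply: climit_within; exact: cexpsol_climit.
Unshelve. all: by end_near. Qed.

Lemma Phi1_left z s c x0 : climit (Phi1 z s c) x0^'- (cexpsol1 (transfer z (nodes_ge x0 s) c) x0).
Proof.
apply: (@climit_near (cexpsol1 (transfer z (nodes_ge x0 s) c))).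
  by have h := near_left_ge s x0; near=> x; rewrite /Phi1 (near h x).
apply: climit_within; exact: cexpsol1_climit.
Unshelve. all: by end_near. Qed.

Lemma Phi_ge z s c x0 : sorted <%R [seq pos t | t <- s] ->
  cexpsol (transfer z (nodes_ge x0 s) c) x0 = Phi z s c x0.
Proof.
move=> hs; case: (boolP (x0 \in [seq pos t | t <- s])) => [/mapP[t ts ->]|h].
  by rewrite nodes_ge_in //= node_step_cont.
by rewrite nodes_ge_out.
Qed.

Lemma Phi_cont z s c : sorted <%R [seq pos t | t <- s] -> ccontinuous (Phi z s c).
Proof.
move=> hs; split => x; apply/left_right_continuousP.
  have [h _] := Phi_left z s c x; have [h' _] := Phi_right z s c x.
  by rewrite Phi_ge // in h; split.
have [_ h] := Phi_left z s c x; have [_ h'] := Phi_right z s c x.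
by rewrite Phi_ge // in h; split.
Qed.

Lemma near_gt_const s (x0 : R) : x0 \notin [seq pos t | t <- s] ->
  \forall x \near x0, nodes_gt x s = nodes_gt x0 s.
Proof.
move=> h; have hr := near_right_gt s x0; have := near_left_ge s x0.
rewrite nodes_ge_out // => hl.
move: hr hl; rewrite !near_withinE => hr hl; near=> x.
by case: (ltgtP x x0) => [hx|hx|-> //]; [apply: (near hl x)|apply: (near hr x)].
Unshelve. all: by end_near. Qed.

Lemma pair_sorted p : sorted <%R [seq pos t | t <- nodes p].
Proof. by case: p => s /= /and3P[]. Qed.

Lemma Phi_solution p z c : solution p z (Phi z (nodes p) c).
Proof.
have hs := pair_sorted p; split; first exact: Phi_cont.
exists (Phi1 z (nodes p) c), (fun x => Phi z (nodes p) c x / 4); split.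
  move=> x xp; have h := near_gt_const xp; split.
  - split.
      apply: (@near_eq_is_derive _ _ _ (re (cexpsol (transfer z (nodes_gt x (nodes p)) c)))).
        by near=> y; rewrite /re /Phi (near h y).
      by rewrite re_cexpsol Re_cexpsol1; exact: is_derive_expsol.
    apply: (@near_eq_is_derive _ _ _ (im (cexpsol (transfer z (nodes_gt x (nodes p)) c)))).
      by near=> y; rewrite /im /Phi (near h y).
    by rewrite im_cexpsol Im_cexpsol1; exact: is_derive_expsol.
  - have e4 : - (Phi z (nodes p) c x / 4) + Phi z (nodes p) c x / 4 = 0 by rewrite addNr.
    have [e4r e4i] := quarter_complex e4; split.
      apply: (@near_eq_is_derive _ _ _ (re (cexpsol1 (transfer z (nodes_gt x (nodes p)) c)))).
        by near=> y; rewrite /re /Phi1 (near h y).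
      by rewrite re_cexpsol1 e4r /Phi Re_cexpsol; exact: is_derive_expsol1.
    apply: (@near_eq_is_derive _ _ _ (im (cexpsol1 (transfer z (nodes_gt x (nodes p)) c)))).
      by near=> y; rewrite /im /Phi1 (near h y).
    by rewrite im_cexpsol1 e4i /Phi Im_cexpsol; exact: is_derive_expsol1.
  - by rewrite addNr.
move=> t tp; exists (cexpsol1 (transfer z (nodes_ge (pos t) (nodes p)) c) (pos t)),
  (cexpsol1 (transfer z (nodes_gt (pos t) (nodes p)) c) (pos t)); split.
- exact: Phi1_left.
- exact: Phi1_right.
- by rewrite nodes_ge_in //= node_step_jump.
Unshelve. all: by end_near. Qed.

Lemma near_left_all s (x0 : R) : all (fun t => pos t < x0) s ->
  \forall x \near x0^'-, all (fun t => pos t < x) s.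
Proof.
elim: s => [|t s IH] /=; first by move=> _; near=> x.
move=> /andP[h1 h2]; near=> x; apply/andP; split.
  by near: x; exact: nbhs_left_gt.
by near: x; exact: IH.
Unshelve. all: by end_near. Qed.

Lemma near_right_all s (x0 : R) : all (fun t => x0 < pos t) s ->
  \forall x \near x0^'+, all (fun t => x < pos t) s.
Proof.
elim: s => [|t s IH] /=; first by move=> _; near=> x.
move=> /andP[h1 h2]; near=> x; apply/andP; split.
  by near: x; exact: nbhs_right_lt.
by near: x; exact: IH.
Unshelve. all: by end_near. Qed.

Lemma solution_gap p z f f' f'' (s1 s2 : seq (R * R * R)) :
  (forall x, x \notin points p ->
      [/\ is_cderive f x (f' x), is_cderive f' x (f'' x) & - f'' x + f x / 4 = 0]) ->
  nodes p = s1 ++ s2 -> exists c, forall x, all (fun t => pos t < x) s1 ->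
    all (fun t => x < pos t) s2 -> f x = cexpsol c x /\ f' x = cexpsol1 c x.
Proof.
move=> h e; pose I : set R := [set x | all (fun t => pos t < x) s1 && all (fun t => x < pos t) s2].
have hI x y w : I x -> I y -> x <= w <= y -> I w.
  move=> /andP[/allP x1 _] /andP[_ /allP y2] /andP[xw wy]; apply/andP; split; apply/allP => t ts.
    by apply: lt_le_trans xw; exact: x1.
  by apply: le_lt_trans wy _; exact: y2.
have Ip x : I x -> x \notin points p.
  move=> /andP[/allP x1 /allP x2]; apply/negP; rewrite /points e map_cat mem_cat.
  by case/orP => /mapP[t ts ex]; [have := x1 _ ts|have := x2 _ ts]; rewrite ex ltxx.
have [Ar [Br hr]] : exists A B, forall x, I x -> re f x = expsol A B x /\ re f' x = expsol1 A B x.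
  apply: (@real_ode _ I (re f) (re f') (re f'')) hI _ => x /Ip/h[[h1 _] [h2 _] h3].
  by split => //; have [] := quarter_complex h3.
have [Ai [Bi hi]] : exists A B, forall x, I x -> im f x = expsol A B x /\ im f' x = expsol1 A B x.
  apply: (@real_ode _ I (im f) (im f') (im f'')) hI _ => x /Ip/h[[_ h1] [_ h2] h3].
  by split => //; have [] := quarter_complex h3.
exists (Ar +i* Ai, Br +i* Bi) => x x1 x2; have Ix : I x by apply/andP.
have [r1 r2] := hr x Ix; have [i1 i2] := hi x Ix.
by split; apply: complex_eq; rewrite ?Re_cexpsol ?Im_cexpsol ?Re_cexpsol1 ?Im_cexpsol1.
Qed.

(** The coefficients are transported from +oo to the left, node by node. *)
Lemma solution_off p z f : solution p z f -> exists c, forall x, x \notin points p ->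
  f x = Phi z (nodes p) c x.
Proof.
move=> [[fcr fci] [f' [f'' [hode hjump]]]]; have hs := pair_sorted p.
have [c hc] := solution_gap z hode (esym (cats0 (nodes p))).
suff H s2 s1 : nodes p = s1 ++ s2 -> forall x, all (fun t => pos t < x) s1 ->
    all (fun t => x < pos t) s2 -> f x = cexpsol (transfer z s2 c) x /\ f' x = cexpsol1 (transfer z
      s2 c) x.
  exists c => x xp; have e := sorted_split hs xp.
  by have [] := H _ _ e x (filter_all _ _) (filter_all _ _).
elim: s2 s1 => [|t s2 IH] s1 e; first by rewrite cats0 in e; rewrite -e.
have e' : nodes p = rcons s1 t ++ s2 by rewrite cat_rcons.
have {}IH := IH _ e'.
have [d hd] := solution_gap z hode e.
have tp : t \in nodes p by rewrite e mem_cat mem_head orbT.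
have [fl [fr [hl hr hj]]] := hjump t tp.
have s1t : all (fun u => pos u < pos t) s1 /\ all (fun u => pos t < pos u) s2.
  move: hs; rewrite e map_cat /= sorted_pairwise; last exact: lt_trans.
  rewrite pairwise_cat /= => /and3P[/allrelP h1 _ /andP[/allP h2 _]]; split; apply/allP => u us.
    by apply: h1; [exact: map_f|exact: mem_head].
  by apply: h2; exact: map_f.
case: s1t => s1t s2t.
pose Pl x := all (fun u => pos u < x) s1 /\ all (fun u => x < pos u) (t :: s2).
pose Pr x := all (fun u => pos u < x) (rcons s1 t) /\ all (fun u => x < pos u) s2.
have nl : \forall x \near (pos t)^'-, Pl x.
  have h1 := near_left_all s1t; near=> x; split; first by apply: (near h1 x).
  have xt : x < pos t by near: x; exact: nbhs_left_lt.
  rewrite /= xt /=; apply/allP => u us; apply: lt_trans xt _; exact: (allP s2t).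
have nr : \forall x \near (pos t)^'+, Pr x.
  have h1 := near_right_all s2t; near=> x; split; last by apply: (near h1 x).
  have xt : pos t < x by near: x; exact: nbhs_right_gt.
  rewrite all_rcons xt /=; apply/allP => u us; apply: lt_trans xt; exact: (allP s1t).
have flim : climit f (nbhs (pos t)) (f (pos t)) by split; [exact: fcr|exact: fci].
have el : f (pos t) = cexpsol d (pos t).
  apply: (@climit_unique f (pos t)^'-); first exact: climit_within.
  apply: (@climit_near (cexpsol d)); last by apply: climit_within; exact: cexpsol_climit.
  near=> x; have [a1 a2] : Pl x by near: x.
  by have [] := hd x a1 a2.
have er : f (pos t) = cexpsol (transfer z s2 c) (pos t).
  apply: (@climit_unique f (pos t)^'+); first exact: climit_within.
  apply: (@climit_near (cexpsol (transfer z s2 c))); last by apply: climit_within; exact: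
    cexpsol_climit.
  near=> x; have [a1 a2] : Pr x by near: x.
  by have [] := IH x a1 a2.
have el1 : fl = cexpsol1 d (pos t).
  apply: (@climit_unique f' (pos t)^'-); first exact: hl.
  apply: (@climit_near (cexpsol1 d)); last by apply: climit_within; exact: cexpsol1_climit.
  near=> x; have [a1 a2] : Pl x by near: x.
  by have [] := hd x a1 a2.
have er1 : fr = cexpsol1 (transfer z s2 c) (pos t).
  apply: (@climit_unique f' (pos t)^'+); first exact: hr.
  apply: (@climit_near (cexpsol1 (transfer z s2 c))); last by apply: climit_within; exact:
    cexpsol1_climit.
  near=> x; have [a1 a2] : Pr x by near: x.
  by have [] := IH x a1 a2.
have -> : transfer z (t :: s2) c = d.
  rewrite /=; apply/esym/node_stepP; first by rewrite -el -er.
  by rewrite -el1 hj er1 er.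
move=> x x1 x2; exact: hd.
Unshelve. all: by end_near. Qed.

Lemma near_right_notin (l : seq R) (x : R) : \forall y \near x^'+, y \notin l.
Proof.
elim: l => [|m l IH]; first by near=> y.
have hm : \forall y \near x^'+, (y : R) != m.
  case: (ltP x m) => ht; near=> y.
    by apply/negbT/lt_eqF; near: y; exact: nbhs_right_lt.
  by apply/negbT/gt_eqF; apply: le_lt_trans ht _; near: y; exact: nbhs_right_gt.
near=> y; rewrite inE negb_or; apply/andP; split; by near: y.
Unshelve. all: by end_near. Qed.

(** At the nodes themselves the equality follows by continuity from the right. *)
Lemma solutionE p z f : solution p z f -> exists c, f = Phi z (nodes p) c.
Proof.
move=> sf; have [c hc] := solution_off sf; exists c; apply/funext => x.
have hs := pair_sorted p; have [fcr fci] := sf.1.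
apply: (@climit_unique f x^'+).
  by apply: climit_within; split; [exact: fcr|exact: fci].
apply: (@climit_near (Phi z (nodes p) c)); last exact: Phi_right.
have h := near_right_notin (points p) x.
near=> y; rewrite hc //; by near: y.
Unshelve. all: by end_near. Qed.

End Solutions.

(** * From the differential equation to the string *)

Section Link.
Context {R : realType}.
Implicit Types (p : coef_pair R) (z : R[i]) (f : R -> R[i]) (t : R * R * R)
  (s : seq (R * R * R)).

(** The positions in the variable y = exp x; the weights are divided by y when a
    node is crossed, not here. *)
Definition liouville s : seq (R * R * R) := [seq (expR (pos t), mass t, dipole t) | t <- s].
Definition string_of p := liouville (nodes p).

(** This identifies the differential equation with the string: decay x times the
    profile at exp x is the solution at x. *)
Lemma transferE z k s : transfer z s (k, 0) =
  (k * (cpoly (intercept (liouville s))).[z], - (z * k * (cpoly (rslope (liouville s))).[z])).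
Proof.
elim: s => [|t s IH].
  by rewrite /intercept /rslope /= /cpoly rmorph1 rmorph0 horner0 hornerC mulr1 mulr0 oppr0.
rewrite [transfer _ _ _]/= -/(transfer z s _) IH /node_step /cexpsol [liouville _]/= -/(liouville
  s).
set u := (expR (pos t), mass t, dipole t); rewrite intercept_cons rslope_cons.
have -> : pos u = expR (pos t) by [].
have -> : node_poly u = (mass t)%:P + dipole t *: 'X by [].
rewrite /profile !(cpolyD_eval, cpolyN_eval, cpolyM_eval, cpolyZ_eval, cpolyX_eval, cpolyC_eval).
rewrite [(_, _).1]/= [(_, _).2]/=.
have e1 := decay_growthC (pos t); have e2 : (growth (pos t))%:C ^+ 2 = (expR (pos t))%:C.
  by rewrite -rmorphXn growth_sqr.
have e3 : (decay (pos t))%:C ^+ 2 = ((expR (pos t))^-1)%:C by rewrite -rmorphXn decay_sqr.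
have e4 : (expR (pos t))%:C * ((expR (pos t))^-1)%:C = 1.
  by rewrite -rmorphM mulfV ?gt_eqF ?expR_gt0 // rmorph1.
move: (cpoly _).[z] (cpoly _).[z] e1 e2 e3 e4 => C A.
move: (decay _)%:C (growth _)%:C (expR _)%:C (_^-1)%:C (mass t)%:C (dipole t)%:C => e e' y y' m v.
move=> e1 e2 e3 e4; congr (_, _).
  transitivity (k * A - (z * m + z ^+ 2 * v) * (k * A * (e * e') - (z * k * C) * e' ^+ 2)).
    by ring.
  rewrite e1 e2; ring.
transitivity (- (z * k * C) + (z * m + z ^+ 2 * v) * (k * A * e ^+ 2 - (z * k * C) * (e * e'))).
  by ring.
rewrite e1 e3 -[(z * k * C) * 1](_ : z * k * C * (y * y') = _); last by rewrite e4.
ring.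
Qed.

Lemma Phi_real s (l x : R) :
  Phi l%:C s (1, 0) x = (decay x * (profile (liouville (nodes_gt x s)) (expR x)).[l])%:C.
Proof.
rewrite /Phi transferE /cexpsol /= !cpoly_real profile_eval.
have -> : growth x = decay x * expR x.
  by rewrite decay_growthV -mulrA mulVf ?mulr1 // gt_eqF // expR_gt0.
rewrite !(rmorphM, rmorphB) /= mul1r mulr1; ring.
Qed.

Lemma Phi_far z s c x : all (fun t => pos t <= x) s -> Phi z s c x = cexpsol c x.
Proof.
move=> h; rewrite /Phi; have -> // : nodes_gt x s = [::].
by rewrite -(filter_pred0 s); apply: eq_in_filter => t /(allP h); rewrite leNgt => /negbTE.
Qed.

Lemma Phi_near z s c x : all (fun t => x < pos t) s -> Phi z s c x = cexpsol (transfer z s c) x.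
Proof. by move=> h; rewrite /Phi nodes_gt_nil. Qed.

Lemma exists_right s : exists X : R, all (fun t => pos t <= X) s.
Proof.
elim: s => [|t s [X hX]]; first by exists 0.
exists (Num.max X (pos t)); rewrite /= le_max lexx orbT /=.
by apply: sub_all hX => u h; rewrite le_max h.
Qed.

Lemma exists_left s : exists X : R, all (fun t => X < pos t) s.
Proof.
elim: s => [|t s [X hX]]; first by exists 0.
exists (Num.min X (pos t - 1)); rewrite /=; apply/andP; split.
  by rewrite gt_min gtrBl ltr01 orbT.
by apply: sub_all hX => u h; rewrite gt_min h.
Qed.

Lemma cexpsol_inj (c d : R[i] * R[i]) x y : x != y -> cexpsol c x = cexpsol d x -> cexpsol c y =
  cexpsol d y -> c = d.
Proof.
have key w : cexpsol c w = cexpsol d w ->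
    (c.1 - d.1) + (c.2 - d.2) * (expR w)%:C = 0.
  rewrite /cexpsol => h; apply: (mulfI (_ : (decay w)%:C != 0)).
    by rewrite eq_complex /= negb_and gt_eqF // decay_gt0.
  have e : (growth w)%:C = (decay w)%:C * (expR w)%:C.
    by rewrite -rmorphM decay_growthV -mulrA mulVf ?mulr1 // gt_eqF // expR_gt0.
  move: h; rewrite e mulr0 => /eqP; rewrite -subr_eq0 => /eqP <-; ring.
move=> xy /key hx /key hy.
have h2 : (c.2 - d.2) * ((expR x)%:C - (expR y)%:C) = 0.
  by rewrite -[RHS](subrr 0) -{1}hx -hy; ring.
have c2 : c.2 = d.2.
  apply/eqP; move/eqP: h2; rewrite mulf_eq0 !subr_eq0 => /orP[//|/eqP /(congr1 (@complex.Re R)) /=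
    h].
  have {}h := expR_inj h.
  by case/eqP: xy.
move: hx; rewrite c2 subrr mul0r addr0 => /eqP; rewrite subr_eq0 => /eqP c1.
by case: c d c1 c2 {key hy h2} => [? ?] [? ?] /= -> ->.
Qed.

Lemma phi_plusE p z : phi_plus p z = Phi z (nodes p) (1, 0).
Proof.
have [X hX] := exists_right (nodes p).
have e0 x : cexpsol (1, 0) x = (expR (- x / 2))%:C by rewrite /cexpsol /= mul1r mul0r addr0.
have hP : [set f | solution p z f /\ \forall x \near +oo, f x = (expR (- x / 2))%:C]
    (Phi z (nodes p) (1, 0)).
  split; first exact: Phi_solution.
  near=> x; rewrite Phi_far ?e0 //; apply: sub_all hX => t h; apply: (le_trans h).
  by near: x; apply: nbhs_pinfty_ge; exact: num_real.
have := xgetPex (fun=> 0) (ex_intro _ _ hP); rewrite -/(phi_plus p z) => -[/solutionE[c ec] hn].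
rewrite ec in hn *; congr Phi; case: hn => M [_ hM].
pose x := Num.max X M + 1.
have hx : X <= x /\ M < x.
  by rewrite /x; split; [apply: ler_wpDr; rewrite // le_max lexx|rewrite ltr_pwDr // le_max lexx
    orbT].
have hy : X <= x + 1 /\ M < x + 1.
  by case: hx => h1 h2; split; [rewrite ler_wpDr|rewrite ltr_wpDr].
have far w : X <= w -> all (fun t => pos t <= w) (nodes p).
  by move=> h; apply: sub_all hX => t ht; exact: le_trans ht h.
apply: (@cexpsol_inj _ _ x (x + 1)).
- by rewrite lt_eqF // ltrDl.
- by rewrite e0 -hM; [rewrite Phi_far // far; case: hx|case: hx].
- by rewrite e0 -hM; [rewrite Phi_far // far; case: hy|case: hy].
Unshelve. all: by end_near. Qed.

Lemma modulus_ge_re z : `|complex.Re z| <= modulus z.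
Proof.
case: z => a b; rewrite /modulus /= -sqrtr_sqr ler_wsqrtr // lerDl sqr_ge0 //.
Qed.

Lemma modulus_ge_im z : `|complex.Im z| <= modulus z.
Proof.
case: z => a b; rewrite /modulus /= -sqrtr_sqr ler_wsqrtr // lerDr sqr_ge0 //.
Qed.

Lemma modulus_le z : modulus z <= `|complex.Re z| + `|complex.Im z|.
Proof.
case: z => a b; rewrite /modulus /= -[leRHS]ger0_norm ?addr_ge0 // -sqrtr_sqr.
rewrite ler_wsqrtr // sqrrD !real_normK ?num_real // addrAC lerDl.
by rewrite mulrn_wge0 // mulr_ge0.
Qed.

Lemma modulus_sqr_real (x : R) : modulus x%:C ^+ 2 = x ^+ 2.
Proof. by rewrite /modulus /= expr0n addr0 sqr_sqrtr // sqr_ge0. Qed.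

Lemma cexpsol_bounded_r (c : R[i] * R[i]) M X :
  (forall x, X <= x -> modulus (cexpsol c x) <= M) -> c.2 = 0.
Proof.
move=> h; apply: complex_eq => /=.
  apply: (@expsol_bounded_r _ (complex.Re c.1) _ M X) => x /h; apply: le_trans.
  by rewrite -Re_cexpsol; exact: modulus_ge_re.
apply: (@expsol_bounded_r _ (complex.Im c.1) _ M X) => x /h; apply: le_trans.
by rewrite -Im_cexpsol; exact: modulus_ge_im.
Qed.

Lemma cexpsol_bounded_l (c : R[i] * R[i]) M X :
  (forall x, x <= X -> modulus (cexpsol c x) <= M) -> c.1 = 0.
Proof.
move=> h; apply: complex_eq => /=.
  apply: (@expsol_bounded_l _ _ (complex.Re c.2) M X) => x /h; apply: le_trans.
  by rewrite -Re_cexpsol; exact: modulus_ge_re.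
apply: (@expsol_bounded_l _ _ (complex.Im c.2) M X) => x /h; apply: le_trans.
by rewrite -Im_cexpsol; exact: modulus_ge_im.
Qed.

Lemma real_bounded (f : R -> R) a b A B : continuous f -> a <= b ->
  (forall x, x <= a -> f x = A * growth x) -> (forall x, b <= x -> f x = B * decay x) ->
  exists M, forall x, `|f x| <= M.
Proof.
move=> cf ab hl hr.
have cn : {within `[a, b], continuous (fun x => `|f x|)}.
  by apply: continuous_subspaceT => x; apply: continuous_comp; [exact: cf|exact: norm_continuous].
have [w _ hw] := EVT_max ab cn.
exists (`|A| * growth a + `|B| * decay b + `|f w|) => x.
have pA : 0 <= `|A| * growth a by rewrite mulr_ge0 // ltW // growth_gt0.
have pB : 0 <= `|B| * decay b by rewrite mulr_ge0 // ltW // decay_gt0.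
case: (leP x a) => xa.
  have : `|f x| <= `|A| * growth a.
    rewrite hl // normrM (gtr0_norm (growth_gt0 x)) ler_wpM2l // /growth ler_expR.
    by rewrite ler_pM2r.
  by move=> h; have := normr_ge0 (f w); lra.
case: (leP b x) => xb.
  have : `|f x| <= `|B| * decay b.
    rewrite hr // normrM (gtr0_norm (decay_gt0 x)) ler_wpM2l // /decay ler_expR.
    by rewrite ler_pM2r // lerN2.
  by move=> h; have := normr_ge0 (f w); lra.
have : `|f x| <= `|f w| by apply: hw; rewrite in_itv /= !ltW.
by move=> h; lra.
Qed.

(** Boundedness at +oo leaves only the multiples of the decaying solution, and at
    -oo it forces the coefficient of e^(-x/2), the intercept, to vanish. *)
Lemma eigenvalueP p z : is_eigenvalue p z <-> (cpoly (intercept (string_of p))).[z] = 0.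
Proof.
have [X hX] := exists_right (nodes p); have [Y hY] := exists_left (nodes p).
split.
  move=> [f [/solutionE[c ->] [x0 fx0] [M hM]]].
  have c2 : c.2 = 0.
    apply: (@cexpsol_bounded_r c M X) => x hx; rewrite -(@Phi_far z (nodes p)) //.
    by apply: sub_all hX => t ht; exact: le_trans ht hx.
  have c1 : c.1 != 0.
    apply: contraNneq fx0 => c1; have -> : c = (0, 0) by case: c c1 c2 {hM} => ? ? /= -> ->.
    by rewrite /Phi transferE /cexpsol /= !(mul0r, mulr0) oppr0 mul0r addr0.
  have : (transfer z (nodes p) c).1 = 0.
    apply: (@cexpsol_bounded_l _ M Y) => x hx; rewrite -Phi_near //.
    by apply: sub_all hY => t ht; exact: le_lt_trans hx ht.
  have -> : c = (c.1, 0) by case: c c2 {hM c1 fx0} => ? ? /= ->.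
  by rewrite transferE /= => /eqP; rewrite mulf_eq0 (negPf c1) => /eqP.
move=> hz; exists (Phi z (nodes p) (1, 0)); split; first exact: Phi_solution.
  exists X; rewrite Phi_far // /cexpsol /= mul1r mul0r addr0 eq_complex /= negb_and gt_eqF //.
  exact: decay_gt0.
have hs := pair_sorted p; have [cr ci] := Phi_cont z (1, 0) hs.
have XY : Num.min X Y <= Num.max X Y by rewrite ge_min !le_max lexx.
have far x : Num.max X Y <= x -> Phi z (nodes p) (1, 0) x = cexpsol (1, 0) x.
  rewrite ge_max => /andP[h _]; rewrite Phi_far //.
  by apply: sub_all hX => t ht; exact: le_trans ht h.
have [b eb] : exists b, transfer z (nodes p) (1, 0) = (0, b).
  by rewrite transferE -/(string_of p) hz mulr0; eexists.
have near x : x <= Num.min X Y -> Phi z (nodes p) (1, 0) x = cexpsol (0, b) x.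
  rewrite le_min => /andP[_ h]; rewrite Phi_near ?eb //.
  by apply: sub_all hY => t ht; exact: le_lt_trans h ht.
have [M1 h1] : exists M, forall x, `|re (Phi z (nodes p) (1, 0)) x| <= M.
  apply: (@real_bounded _ _ _ (complex.Re b) 1 cr XY) => x hx.
    by rewrite /re near // Re_cexpsol /expsol /= mul0r add0r.
  rewrite /re far // Re_cexpsol.
  by transitivity (1 * decay x + 0 * growth x); last by rewrite mul0r addr0.
have [M2 h2] : exists M, forall x, `|im (Phi z (nodes p) (1, 0)) x| <= M.
  apply: (@real_bounded _ _ _ (complex.Im b) 0 ci XY) => x hx.
    by rewrite /im near // Im_cexpsol /expsol /= mul0r add0r.
  by rewrite /im far // Im_cexpsol /expsol /= !mul0r addr0.
by exists (M1 + M2) => x; apply: le_trans (modulus_le _) (lerD (h1 x) (h2 x)).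
Qed.

Lemma nodes_gt_cat s1 t s2 : sorted <%R [seq pos t | t <- s1 ++ t :: s2] ->
  nodes_gt (pos t) (s1 ++ t :: s2) = s2.
Proof.
rewrite map_cat /= sorted_pairwise; last exact: lt_trans.
rewrite pairwise_cat /= => /and3P[/allrelP h1 _ /andP[/allP h2 _]].
rewrite /nodes_gt filter_cat /= ltxx.
have -> : [seq u <- s1 | pos t < pos u] = [::].
  rewrite -(filter_pred0 s1); apply: eq_in_filter => u us /=; apply: lt_gtF.
  by apply: h1; [exact: map_f|exact: mem_head].
by apply/all_filterP/allP => u us; apply: h2; exact: map_f.
Qed.

Lemma gamma2E p l : gamma2 p l = norming_sum (string_of p) l.
Proof.
have hs := pair_sorted p.
rewrite /gamma2 /int_omega /int_v phi_plusE mulr_sumr -big_split /=.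
suff H s2 s1 : nodes p = s1 ++ s2 ->
    \sum_(t <- s2) (mass t * modulus (Phi l%:C (nodes p) (1, 0) (pos t)) ^+ 2 +
     2 * l * (dipole t * modulus (Phi l%:C (nodes p) (1, 0) (pos t)) ^+ 2)) = norming_sum
       (liouville s2) l.
  exact: (H _ [::]).
elim: s2 s1 => [|t s2 IH] s1 e; first by rewrite big_nil.
rewrite big_cons (IH (rcons s1 t)) ?cat_rcons //= {1}/pos /= {1}/mass /= {1}/dipole /=.
congr (_ + _); rewrite Phi_real modulus_sqr_real e nodes_gt_cat -?e //.
by rewrite exprMn decay_sqr /mass /dipole /pos /=; ring.
Qed.

Lemma eigenfun_num p l x :
  phi_plus p l%:C x = (decay x * (profile (liouville (nodes_gt x (nodes p))) (expR x)).[l])%:C.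
Proof. by rewrite phi_plusE Phi_real. Qed.

Lemma is_string_liouville s : sorted <%R [seq pos t | t <- s] -> all good_node s -> is_string 0
  (liouville s).
Proof.
move=> h1 h2; rewrite is_stringE path_sortedE; last exact: lt_trans.
apply/andP; split; [apply/andP; split|].
- by rewrite /liouville -map_comp; apply/allP => y /mapP[t _ ->] /=; exact: expR_gt0.
- rewrite /liouville -map_comp; have -> : map (pos \o (fun t => (expR (pos t), mass t, dipole t)))
  s =
    map expR (map pos s) by rewrite -map_comp.
  by rewrite (@homo_sorted _ _ expR <%R) // => x y; rewrite ltr_expR.
- by rewrite /liouville all_map.
Qed.

Lemma string_of_is_string p : is_string 0 (string_of p).
Proof.
by rewrite /string_of; case: p => s /= /and3P[_ h1 h2]; exact: is_string_liouville.
Qed.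

Lemma string_of_neq0 p : string_of p != [::].
Proof. by rewrite /string_of; case: p => -[]. Qed.

Lemma pair_of_string s : is_string 0 s -> s != [::] -> exists p, string_of p = s.
Proof.
move=> hs sn; pose s' := [seq (ln (pos t), mass t, dipole t) | t <- s].
have hs' := hs; move: hs'; rewrite is_stringE path_sortedE; last exact: lt_trans.
move=> /andP[/andP[/allP h0 h1] h2].
have ax : coef_pair_axiom s'.
  apply/and3P; split.
  - by rewrite /s'; case: s sn {hs h0 h1 h2 s'}.
  - have -> : [seq pos t | t <- s'] = map (@ln R) (map pos s) by rewrite /s' -!map_comp.
    apply: (@homo_sorted_in _ _ [pred x : R | 0 < x] _ <%R) h1; last by apply/allP.
    by move=> x y; rewrite !inE => x0 y0 xy; rewrite ltr_ln // posrE.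
  - by rewrite /s' all_map.
exists (CoefPair ax); rewrite /string_of /liouville /= /s' -map_comp -[RHS]map_id.
apply/eq_in_map => t ts /=; rewrite {1}/pos /= lnK //; last by rewrite posrE; apply: h0; exact:
  map_f.
by case: t {ts} => [[? ?] ?].
Qed.

Lemma spectrumP p N (lam : N.-tuple R) : spectrum p lam <->
  [/\ sorted <%R lam, 0 \notin lam & intercept (string_of p) = nodal lam].
Proof.
have hs := string_of_is_string p.
have [rs [u r0 e _ _]] := profile_roots (lexx 0) hs (lexx 0).
rewrite -intercept_profile in e.
have eig (l : seq R) : 0 \notin l -> forall z, (cpoly (nodal l)).[z] = 0 <-> exists2 x, x \in l & z
  = x%:C.
  move=> l0 z; split.
    case: (eqVneq (complex.Im z) 0) => [h|h /eqP]; last by rewrite (negPf (cnodal_neq0 l0 h)).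
    have ez : z = (complex.Re z)%:C by case: z h => a b /= ->.
    rewrite ez cpoly_real => /eqP; rewrite eq_complex /= ?eqxx ?andbT => h2.
    by exists (complex.Re z) => //; rewrite -root_nodal.
  move=> [x xl ->]; rewrite cpoly_real; suff -> : (nodal l).[x] = 0 by [].
  by apply/eqP; rewrite -/(root _ _) root_nodal.
split.
  move=> [sl h]; have ul : uniq lam by apply: sorted_uniq sl; [exact: lt_trans|exact: ltxx].
  have lr : lam =i rs.
    move=> x; apply/idP/idP => hx.
      have : is_eigenvalue p x%:C by apply/h; exists x.
      move/eigenvalueP; rewrite e => /(eig _ r0)[x' x'r /(congr1 (@complex.Re R)) /= ->].
      by [].
    have : is_eigenvalue p x%:C by apply/eigenvalueP; rewrite e; apply/(eig _ r0); exists x.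
    by move/h => [x' x'r /(congr1 (@complex.Re R)) /= ->].
  split => //; first by rewrite lr.
  by rewrite e; apply: nodal_perm; apply: uniq_perm.
move=> [sl l0 h]; split => // z; split.
  by move/eigenvalueP; rewrite h => /(eig _ l0).
by move=> hz; apply/eigenvalueP; rewrite h; apply/(eig _ l0).
Qed.

End Link.

(** * Cutting a string in two *)

Section Glue.
Context {R : realType}.
Implicit Types (t : R * R * R) (s : seq (R * R * R)).

Variables (b : R) (s1 sb s2 : seq (R * R * R)).
Hypotheses (b0 : 0 < b) (hs : is_string 0 (s1 ++ sb ++ s2)).
Hypothesis hsb : sb = [::] \/ exists2 t, sb = [:: t] & pos t = b.

Let node_sum : {poly R} := \sum_(t <- sb) node_poly t.
Let right_sol := profile s2 b.
Let right_slope := rslope s2.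
Let left_sol := profile (reflect s1) b^-1.
Let left_slope := rslope (reflect s1).

Let s1n0 : all (fun t => pos t != 0) s1.
Proof.
apply/allP => t ts; rewrite gt_eqF //; apply: (is_string_all hs).
by rewrite mem_cat ts.
Qed.

Let intercept_sb : intercept (sb ++ s2) = right_sol + b *: ('X * right_slope) - 'X * (node_sum *
  right_sol).
Proof.
rewrite /node_sum; case: hsb => [->|[t -> tb]].
  by rewrite big_nil mul0r mulr0 subr0 /right_sol /profile subrK.
by rewrite big_seq1 intercept_cons tb /right_sol {2}/profile subrK.
Qed.

Let rslope_sb : rslope (sb ++ s2) = right_slope - b^-1 *: (node_sum * right_sol).
Proof.
rewrite /node_sum; case: hsb => [->|[t -> tb]]; first by rewrite big_nil mul0r scaler0 subr0.
by rewrite big_seq1 rslope_cons tb.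
Qed.

Let intercept_h : intercept (reflect s1) = left_sol + b^-1 *: ('X * left_slope).
Proof. by rewrite /left_sol /profile subrK. Qed.

(** Only the value and the reduced slope of each half at b enter. *)
Lemma glue_intercept : intercept (s1 ++ sb ++ s2) =
  right_sol * left_sol * (1 - 'X * node_sum) + 'X * (b^-1 *: (right_sol * left_slope) + b *:
    (left_sol * right_slope)).
Proof.
rewrite intercept_cat // intercept_h intercept_sb rslope_sb -/left_slope -!mul_polyC.
have e : b%:P * b^-1%:P = 1 :> {poly R} by rewrite -polyCM mulfV // gt_eqF.
move: right_sol right_slope left_sol left_slope node_sum => P C H J q; move: b%:P b^-1%:P e => y y'
  e.
apply/eqP; rewrite -subr_eq0; apply/eqP.
transitivity ((y * y' - 1) * ('X ^+ 2 * C * J)); first by ring.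
by rewrite e subrr mul0r.
Qed.

(** At an eigenvalue the solutions from the two sides are proportional, and here the
    factor is read off at b from the values. *)
Lemma glue_root l : (intercept (s1 ++ sb ++ s2)).[l] = 0 ->
  right_sol.[l] = - (b * l * (rslope (s1 ++ sb ++ s2)).[l] * left_sol.[l]).
Proof.
move=> h; have [e1 e2] := cat_root s1n0 h.
have -> : right_sol = intercept (sb ++ s2) - b *: ('X * rslope (sb ++ s2)).
  rewrite intercept_sb rslope_sb -!mul_polyC.
  have e : b%:P * b^-1%:P = 1 :> {poly R} by rewrite -polyCM mulfV // gt_eqF.
  move: right_sol right_slope node_sum => P C q; move: b%:P b^-1%:P e => y y' e.
  apply/eqP; rewrite -subr_eq0; apply/eqP.
  transitivity ((1 - y * y') * ('X * q * P)); first by ring.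
  by rewrite e subrr mul0r.
rewrite hornerD hornerN hornerZ hornerM hornerX e1 e2 intercept_h hornerD hornerZ hornerM hornerX
  -/left_slope.
by field; rewrite gt_eqF.
Qed.

(** When both values vanish at b, the factor is read off from the slopes instead. *)
Lemma glue_root2 l : (intercept (s1 ++ sb ++ s2)).[l] = 0 -> right_sol.[l] = 0 -> left_sol.[l] = 0
  ->
  right_slope.[l] = (rslope (s1 ++ sb ++ s2)).[l] * (b^-1 * (l * left_slope.[l])).
Proof.
move=> h p0 h0; have [_ e2] := cat_root s1n0 h; move: e2.
rewrite rslope_sb intercept_h; move: right_sol left_sol right_slope left_slope node_sum p0 h0 => P
  H C J q p0 h0; rewrite !(hornerD, hornerN, hornerZ, hornerM, hornerX) p0 h0.
by rewrite !mulr0 oppr0 addr0 add0r.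
Qed.

Lemma glue_deriv l : right_sol.[l] = 0 -> left_sol.[l] = 0 ->
  (intercept (s1 ++ sb ++ s2))^`().[l] =
  l * (b^-1 * (right_sol^`().[l] * left_slope.[l]) + b * (left_sol^`().[l] * right_slope.[l])).
Proof.
move=> p0 h0; rewrite glue_intercept; move: right_sol left_sol right_slope left_slope node_sum p0
  h0 => P H C J q p0 h0.
rewrite !(derivD, derivB, derivZ, derivM, derivX, derivC).
rewrite !(hornerD, hornerN, hornerZ, hornerM, hornerX, hornerC) p0 h0; ring.
Qed.

End Glue.

Section Cut.
Context {R : realType}.
Implicit Types (t : R * R * R) (s : seq (R * R * R)) (p : coef_pair R).

Definition left_of (b : R) s := [seq t <- s | pos t < b].
Definition at_node (b : R) s := [seq t <- s | pos t == b].
Definition right_of (b : R) s := [seq t <- s | b < pos t].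

Lemma split_string c b s : is_string c s -> [/\ s = left_of b s ++ at_node b s ++ right_of b s,
  is_string c (left_of b s), is_string b (right_of b s) &
  at_node b s = [::] \/ exists2 t, at_node b s = [:: t] & pos t = b].
Proof.
have low c' s' : is_string c' s' -> b < c' ->
    [/\ left_of b s' = [::], at_node b s' = [::] & right_of b s' = s'].
  move=> hs bc; split.
  - rewrite -(filter_pred0 s'); apply: eq_in_filter => u us; apply: lt_gtF.
    exact: lt_trans bc (is_string_all hs us).
  - rewrite -(filter_pred0 s'); apply: eq_in_filter => u us; apply: gt_eqF.
    exact: lt_trans bc (is_string_all hs us).
  - by apply/all_filterP/allP => u us; exact: lt_trans bc (is_string_all hs us).
elim: s c => [|t s IH] c; first by move=> _; split => //; left.
case/and3P => ct gt hs; rewrite /left_of /at_node /right_of /=.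
case: (ltgtP (pos t) b) => h.
- have [e h1 h2 h3] := IH _ hs; split => //=; first by rewrite -e.
  by rewrite ct gt.
- have [e1 e2 e3] := low _ _ hs h.
  rewrite -/(left_of b s) -/(at_node b s) -/(right_of b s) e1 e2 e3; split => //; last by left.
  by rewrite /= h gt.
have [e1 e2 e3] : [/\ left_of b s = [::], at_node b s = [::] & right_of b s = s].
  rewrite -h; split.
  - rewrite -(filter_pred0 s); apply: eq_in_filter => u us; apply: lt_gtF.
    exact: (is_string_all hs us).
  - rewrite -(filter_pred0 s); apply: eq_in_filter => u us; apply: gt_eqF.
    exact: (is_string_all hs us).
  - by apply/all_filterP/allP => u us; exact: (is_string_all hs us).
rewrite -/(left_of b s) -/(at_node b s) -/(right_of b s) e1 e2 e3; split => //.
  by rewrite -h.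
by right; exists t.
Qed.

Lemma right_of_cat b s1 sb s2 : (forall t, t \in s1 -> pos t < b) ->
  (forall t, t \in sb -> pos t = b) -> is_string b s2 -> right_of b (s1 ++ sb ++ s2) = s2.
Proof.
move=> h1 h2 h3; rewrite /right_of !filter_cat.
have -> : [seq t <- s1 | b < pos t] = [::].
  by rewrite -(filter_pred0 s1); apply: eq_in_filter => u us; apply: lt_gtF; exact: h1.
have -> : [seq t <- sb | b < pos t] = [::].
  by rewrite -(filter_pred0 sb); apply: eq_in_filter => u us; rewrite h2 // ltxx.
by apply/all_filterP/allP => u us; exact: (is_string_all h3 us).
Qed.

Lemma left_of_cat b s1 sb s2 : (forall t, t \in s1 -> pos t < b) ->
  (forall t, t \in sb -> pos t = b) -> is_string b s2 -> left_of b (s1 ++ sb ++ s2) = s1.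
Proof.
move=> h1 h2 h3; rewrite /left_of !filter_cat.
have -> : [seq t <- s2 | pos t < b] = [::].
  by rewrite -(filter_pred0 s2); apply: eq_in_filter => u us; apply: lt_gtF; exact: (is_string_all
    h3 us).
have -> : [seq t <- sb | pos t < b] = [::].
  by rewrite -(filter_pred0 sb); apply: eq_in_filter => u us; rewrite h2 // ltxx.
by rewrite !cats0; apply/all_filterP/allP.
Qed.

Lemma right_of_string_of p (a : R) : right_of (expR a) (string_of p) = liouville (nodes_gt a (nodes
  p)).
Proof.
rewrite /right_of /string_of /liouville /nodes_gt filter_map; congr map.
by apply: eq_filter => t /=; rewrite {1}/pos /= ltr_expR.
Qed.

Lemma is_string_weaken c d s : c <= d -> is_string d s -> is_string c s.
Proof. by move=> cd; case: s => //= t s /and3P[h -> ->]; rewrite (le_lt_trans cd h). Qed.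

End Cut.

(** * What the interior data determine *)

Section Data.
Context {R : realType}.
Implicit Types (p : coef_pair R).
Variables (a : R) (lam : seq R) (phi : R -> R).
Hypotheses (ulam : uniq lam) (lam0 : 0 \notin lam) (phi1 : \sum_(l <- lam) phi l ^+ 2 = 1).

Let b := expR a.
Let b0 : 0 < b. Proof. exact: expR_gt0. Qed.

(** The norming constant that enters the spectral data. *)
Definition norming p (l : R) := l * gamma2 p l.

(** The interior data in terms of polynomials; phi assigns to an eigenvalue the value
    at a of its normalised eigenfunction. *)
Definition has_data p := intercept (string_of p) = nodal lam /\
  forall l, l \in lam -> phi l = decay a * (profile (right_of b (string_of p)) b).[l] / Num.sqrt
    (norming p l).

(** The numerator of the diagonal Green function at a over the denominator nodal lam,
    as prescribed by its residues. *)
Definition green_num : {poly R} := pfnum lam (fun l => - l * phi l ^+ 2).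

Lemma root_lam l : l \in lam -> (nodal lam).[l] = 0.
Proof. by move=> h; apply/eqP; rewrite -/(root _ _) root_nodal. Qed.

Lemma lam_neq0 l : l \in lam -> l != 0.
Proof. by apply: contraTneq => ->. Qed.

Lemma normingE p l : intercept (string_of p) = nodal lam -> l \in lam ->
  norming p l = l ^+ 2 * ((nodal lam)^`().[l] * (rslope (string_of p)).[l]) /\ 0 < norming p l.
Proof.
move=> h hl; have h0 := root_lam hl.
have e := norming_sum_wron 0 l (lexx 0) (string_of_is_string p).
have W0 := wron_gt0 l (lexx 0) (string_of_is_string p) (lexx 0) (string_of_neq0 p).
move: e W0; rewrite /wron -intercept_profile h hornerD hornerN !hornerM h0 !mul0r !subr0 => e W0.
rewrite /norming gamma2E e mulrA -expr2; split => //.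
by rewrite mulr_gt0 // exprn_even_gt0 //= lam_neq0.
Qed.

Section Forward.
Variable p : coef_pair R.
Hypothesis hp : intercept (string_of p) = nodal lam.

Let s := string_of p.
Let s1 := left_of b s.
Let sb := at_node b s.
Let s2 := right_of b s.
Definition right_sol := profile s2 b.
Definition left_sol := profile (reflect s1) b^-1.
Definition right_slope := rslope s2.
Definition left_slope := rslope (reflect s1).
Definition node_sum : {poly R} := \sum_(t <- sb) node_poly t.

Let hsplit := split_string b (string_of_is_string p).
Let es : s = s1 ++ sb ++ s2. Proof. by case: hsplit. Qed.
Let hsb : sb = [::] \/ exists2 t, sb = [:: t] & pos t = b. Proof. by case: hsplit. Qed.
Let hs : is_string 0 (s1 ++ sb ++ s2). Proof. rewrite -es; exact: string_of_is_string. Qed.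

Lemma data_intercept : nodal lam =
  right_sol * left_sol * (1 - 'X * node_sum) + 'X * (b^-1 *: (right_sol * left_slope) + b *:
    (left_sol * right_slope)).
Proof. by rewrite -hp -/s es (glue_intercept b0). Qed.

Lemma data_root l : l \in lam -> right_sol.[l] = - (b * l * (rslope s).[l] * left_sol.[l]).
Proof.
move=> hl; rewrite /right_sol /left_sol es; apply: glue_root => //.
by rewrite -es hp root_lam.
Qed.

Lemma data_root2 l : l \in lam -> right_sol.[l] = 0 -> left_sol.[l] = 0 ->
  right_slope.[l] = (rslope s).[l] * (b^-1 * (l * left_slope.[l])).
Proof.
move=> hl p0 h0; rewrite {1}es; apply: glue_root2 => //.
by rewrite -es hp root_lam.
Qed.

Lemma data_deriv l : right_sol.[l] = 0 -> left_sol.[l] = 0 -> (nodal lam)^`().[l] =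
  l * (b^-1 * (right_sol^`().[l] * left_slope.[l]) + b * (left_sol^`().[l] * right_slope.[l])).
Proof. by move=> p0 h0; rewrite -hp -/s es; exact: glue_deriv. Qed.

Lemma is_string_s2 : is_string b s2. Proof. by case: hsplit. Qed.

Lemma is_string_s1 : is_string b^-1 (reflect s1).
Proof.
apply: (@is_string_reflect _ 0) => //; first by case: hsplit.
by move=> t; rewrite mem_filter => /andP[].
Qed.

Let bV0 : 0 <= b^-1. Proof. by rewrite invr_ge0 ltW. Qed.

(** Degrees add up over the nodes, and the left-hand side lacks those at b. *)
Lemma data_size : (size (right_sol * left_sol)%R <= (size lam).+1)%N.
Proof.
have [_ eP] := size_string (ltW b0) is_string_s2 (lexx b).
have [_ eH] := size_string bV0 is_string_s1 (lexx b^-1).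
have [_ eW] := size_string (lexx 0) (string_of_is_string p) (lexx 0).
rewrite -intercept_profile hp size_nodal // in eW.
have Pn0 : right_sol != 0 by rewrite -size_poly_gt0 eP.
have Hn0 : left_sol != 0 by rewrite -size_poly_gt0 eH.
rewrite size_mul // eP eH eW addSn addnS /= ltnS -/s es !big_cat /= addnC leq_add //; last exact:
  leq_addl.
rewrite /reflect (perm_big _ (permEl (perm_rev _))) big_map /=.
by apply: leq_sum.
Qed.

Lemma data_right : exists rp, [/\ uniq rp, 0 \notin rp, right_sol = nodal rp, (size right_slope <=
  size rp)%N &
  forall m, m \in rp -> 0 < right_slope.[m] * (nodal rp)^`().[m]].
Proof. exact: (profile_roots (ltW b0) is_string_s2 (lexx b)). Qed.

Lemma data_left : exists rh, [/\ uniq rh, 0 \notin rh, left_sol = nodal rh, (size left_slope <=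
  size rh)%N &
  forall m, m \in rh -> 0 < left_slope.[m] * (nodal rh)^`().[m]].
Proof. exact: (profile_roots bV0 is_string_s1 (lexx b^-1)). Qed.

End Forward.

(** Together with has_data_phi2 this says that P H / nodal lam has residue
    - l * phi l ^+ 2 at l. *)
Lemma norming_right_sol p l : intercept (string_of p) = nodal lam -> l \in lam ->
  (right_sol p * left_sol p).[l] * (b * norming p l) = - l * (nodal lam)^`().[l] * (right_sol
    p).[l] ^+ 2.
Proof.
move=> hp hl; have [-> _] := normingE hp hl.
rewrite hornerM; have := data_root hp hl; move: (right_sol p).[l] (left_sol p).[l] => P H e.
move: (rslope (string_of p)).[l] (nodal lam)^`().[l] e => C W e.
transitivity (- l * W * P * - (b * l * C * H)); first by ring.
by rewrite -e; ring.
Qed.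

Lemma decay_a2 : decay a ^+ 2 = b^-1. Proof. by rewrite decay_sqr. Qed.

Lemma has_data_phi2 p l : has_data p -> l \in lam ->
  phi l ^+ 2 * (b * norming p l) = (right_sol p).[l] ^+ 2 /\ 0 <= phi l * (right_sol p).[l].
Proof.
move=> [hp hd] hl; have [_ n0] := normingE hp hl; rewrite hd // -/(right_sol p).
set P := (right_sol p).[l]; split.
  rewrite !exprMn decay_a2 exprVn sqr_sqrtr ?ltW //; field.
  by rewrite !gt_eqF.
have -> : decay a * P / Num.sqrt (norming p l) * P = decay a / Num.sqrt (norming p l) * P ^+ 2 by
  ring.
by rewrite mulr_ge0 ?sqr_ge0 // divr_ge0 ?sqrtr_ge0 // ltW // decay_gt0.
Qed.

(** The two polynomials agree at the eigenvalues, so they differ by a multiple of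
    the characteristic polynomial, and the multiple is alpha, which is 0 because
    of phi1: compare the values at 0. *)
Lemma has_data_green_num p : has_data p -> right_sol p * left_sol p = green_num.
Proof.
move=> hd; have [hp _] := hd.
have vals l : l \in lam -> (right_sol p * left_sol p).[l] = - l * phi l ^+ 2 * (nodal lam)^`().[l].
  move=> hl; have [_ n0] := normingE hp hl; have e := norming_right_sol hp hl.
  have [e2 _] := has_data_phi2 hd hl.
  apply: (mulIf (_ : b * norming p l != 0)); first by rewrite mulf_neq0 // gt_eqF.
  by rewrite e -e2; ring.
(* The value of the Green function at z = oo, that is, alpha. *)
pose e0 := (right_sol p * left_sol p)`_(size lam) / lead_coef (nodal lam).
have l0 : lead_coef (nodal lam) != 0 by rewrite lead_coef_eq0 nodal_neq0.
have sD : (size (right_sol p * left_sol p - e0 *: nodal lam)%R <= size lam)%N.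
  apply/leq_sizeP => j; rewrite leq_eqVlt => /predU1P[<-|hj]; rewrite coefB coefZ.
    have -> : (nodal lam)`_(size lam) = lead_coef (nodal lam) by rewrite lead_coefE size_nodal.
    by rewrite /e0 divfK // subrr.
  rewrite !nth_default ?mulr0 ?subr0 // ?size_nodal //.
  exact: leq_trans (data_size hp) _.
have eD : right_sol p * left_sol p - e0 *: nodal lam = green_num.
  rewrite [LHS](nodal_lagrange ulam lam0 sD) /green_num /pfnum !big_seq; apply: eq_bigr => l hl.
  congr (_ *: _); rewrite hornerD hornerN hornerZ root_lam // mulr0 subr0 vals // mulfK //.
  by rewrite nodal_deriv // nodal_part_self.
have Q0 : green_num.[0] = 1.
  rewrite /green_num pfnum_eval // nodal0 mul1r -phi1 !big_seq; apply: eq_bigr => l hl.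
  by rewrite sub0r invrN mulrN mulNr mulNr opprK mulrAC mulfV ?mul1r // lam_neq0.
clearbody e0; have := congr1 (horner^~ 0) eD.
rewrite /= hornerD hornerN hornerZ hornerM nodal0 mulr1 Q0 /right_sol /left_sol !profile0 mulr1 =>
  h.
have e00 : e0 = 0 by lra.
by rewrite -eD e00 scale0r subr0.
Qed.

End Data.

(** * Sharing the roots between the two sides *)

Section Gap.
Context {R : realType}.
Variables (lam : seq R) (phi : R -> R).
Hypotheses (ulam : uniq lam) (lam0 : 0 \notin lam) (phi1 : \sum_(l <- lam) phi l ^+ 2 = 1).

Let Q := green_num lam phi.

Lemma seq_argmax (f : R -> R) (P : pred R) (s : seq R) : has P s ->
  exists x, [/\ x \in s, P x & forall y, y \in s -> P y -> f y <= f x].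
Proof.
elim: s => //= x s IH; case: (boolP (has P s)) => [/IH[y [ys Py hy]] _|h].
  case: (boolP (P x && (f y <= f x))) => [/andP[Px yx]|h].
    exists x; rewrite mem_head; split => // w; rewrite inE => /predU1P[-> //|ws Pw].
    exact: le_trans (hy _ ws Pw) yx.
  exists y; rewrite inE ys orbT; split => // w; rewrite inE => /predU1P[-> Px|]; last exact: hy.
  by move: h; rewrite Px /= -ltNge => /ltW.
rewrite orbF => Px; exists x; rewrite mem_head; split => // w.
rewrite inE => /predU1P[-> //|ws Pw]; case/negP: h; by apply/hasP; exists w.
Qed.

(** The point m lies, on its side of 0, beyond every eigenvalue with phi l <> 0. *)
Definition outer (m : R) := forall l, l \in lam -> phi l != 0 -> l / m < 1.

(** The condition for z G(z) to vanish at x, where G is the diagonal Green function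
    with the summands that cancel left out.  Multiplying by z makes 0 a zero like
    the others and gives all residues the same sign. *)
Definition green_zero (x : R) := (forall l, l \in lam -> phi l != 0 -> l != x) /\
  \sum_(l <- lam) l ^+ 2 * phi l ^+ 2 / (l - x) = \sum_(l <- lam) l * phi l ^+ 2.

Lemma green_num_at_lam l : l \in lam -> Q.[l] = - l * phi l ^+ 2 * (nodal lam)^`().[l].
Proof. by move=> h; rewrite /Q /green_num pfnum_node. Qed.

Lemma phi_root_lam l : l \in lam -> Q.[l] = 0 -> phi l = 0.
Proof.
move=> h; rewrite green_num_at_lam // => /eqP; rewrite !mulf_eq0 oppr_eq0.
rewrite (negPf (lam_neq0 lam0 h)) nodal_deriv // (negPf (nodal_part_self ulam lam0 h)) orbF /= orbb.
by move/eqP.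
Qed.

Lemma green_zero0 : green_zero 0.
Proof.
split=> [l hl _|]; first exact: lam_neq0 hl.
rewrite !big_seq; apply: eq_bigr => l hl; rewrite subr0; field; exact: lam_neq0 hl.
Qed.

Lemma green_zero_sum x : (forall l, l \in lam -> phi l != 0 -> l != x) ->
  \sum_(l <- lam) l * phi l ^+ 2 / (l - x) = 0 -> green_zero x.
Proof.
move=> h1 h2; split => //; apply/eqP; rewrite -subr_eq0 -sumrB; apply/eqP.
transitivity (x * \sum_(l <- lam) l * phi l ^+ 2 / (l - x)); last by rewrite h2 mulr0.
rewrite mulr_sumr !big_seq; apply: eq_bigr => l hl.
have [->|pn] := eqVneq (phi l) 0; first by rewrite expr0n /= !(mulr0, mul0r) subr0.
by field; rewrite subr_eq0; exact: h1.
Qed.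

Lemma green_zero_off x : x \notin lam -> Q.[x] = 0 -> green_zero x.
Proof.
move=> xl; have nx l : l \in lam -> l != x by apply: contraTneq => ->.
rewrite /Q /green_num pfnum_eval // => /eqP; rewrite mulf_eq0 -/(root _ _) root_nodal // (negPf xl)
  /=.
move=> /eqP h; apply: green_zero_sum => [l hl _|]; first exact: nx.
transitivity (\sum_(l <- lam) - l * phi l ^+ 2 / (x - l)); last exact: h.
rewrite !big_seq; apply: eq_bigr => l hl.
by field; rewrite !subr_eq0 nx // eq_sym nx.
Qed.

(** An eigenvalue with phi x = 0 cancels once in the fraction, so it is still a zero
    if it was a double root of the numerator. *)
Lemma green_zero_double x : x \in lam -> phi x = 0 -> Q^`().[x] = 0 -> green_zero x.
Proof.
move=> xl px; set D := nodal_part lam x; have D0 : D.[x] != 0 := nodal_part_self ulam lam0 xl.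
have -> : Q^`().[x] = D.[x] * \sum_(l <- lam) l * phi l ^+ 2 / (l - x).
  rewrite /Q /green_num /pfnum raddf_sum /= horner_sum mulr_sumr !big_seq.
  apply: eq_bigr => l hl; rewrite derivZ hornerZ.
  have [->|lx] := eqVneq l x; first by rewrite px expr0n /= !(mulr0, mul0r).
  have e : ('X - l%:P) * nodal_part lam l = ('X - x%:P) * D by rewrite -!nodal_factor.
  have := congr1 (fun P => P^`().[x]) e.
  rewrite /= !derivM !derivXsubC !mul1r !hornerD !hornerM !hornerXsubC subrr mul0r addr0.
  rewrite (nodal_part_other ulam lam0 hl xl) 1?eq_sym // add0r => <-.
  by field; rewrite subr_eq0.
move/eqP; rewrite mulf_eq0 (negPf D0) /= => /eqP h; apply: green_zero_sum => // l hl.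
by apply: contraNneq => ->; rewrite px.
Qed.

Lemma separation_sum x y : green_zero x -> green_zero y -> x != y ->
  \sum_(l <- lam) l ^+ 2 * phi l ^+ 2 / ((l - x) * (l - y)) = 0.
Proof.
move=> [hx sx] [hy sy] xy; have xy0 : x - y != 0 by rewrite subr_eq0.
apply: (mulfI xy0); rewrite mulr0 mulr_sumr.
transitivity (\sum_(l <- lam) l ^+ 2 * phi l ^+ 2 / (l - x) -
   \sum_(l <- lam) l ^+ 2 * phi l ^+ 2 / (l - y)); last by rewrite sx sy subrr.
rewrite -sumrB !big_seq; apply: eq_bigr => l hl.
have [->|pn] := eqVneq (phi l) 0; first by rewrite expr0n /= !(mulr0, mul0r) subr0.
by field; rewrite !subr_eq0 hx // hy.
Qed.

Lemma weighted_sum_gt0 (f : R -> R) : (forall l, l \in lam -> phi l != 0 -> 0 < f l) ->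
  0 < \sum_(l <- lam) l ^+ 2 * phi l ^+ 2 / f l.
Proof.
move=> h; have tpos l : l \in lam -> 0 <= l ^+ 2 * phi l ^+ 2 / f l.
  move=> hl; have [->|pn] := eqVneq (phi l) 0; first by rewrite expr0n /= mulr0 mul0r.
  by apply: divr_ge0; [rewrite mulr_ge0 ?sqr_ge0|exact/ltW/h].
rewrite lt0r big_seq sumr_ge0 // andbT psumr_eq0 //.
apply/negP => /allP hall.
have : \sum_(l <- lam) phi l ^+ 2 = 0.
  rewrite big_seq big1 // => l hl; have := hall l hl; rewrite hl /=.
  have [->|pn] := eqVneq (phi l) 0; first by rewrite expr0n.
  rewrite !mulf_eq0 invr_eq0 (negPf (lam_neq0 lam0 hl)) (negPf pn) /= gt_eqF //.
  exact: h.
by rewrite phi1 => /eqP; rewrite oner_eq0.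
Qed.

(** The difference of two values of a sum of a / (l - x) with all a >= 0 is x - y times a sum
    of a / ((l - x) (l - y)): if it vanishes, terms of both signs must occur. *)
Lemma separation x y : green_zero x -> green_zero y -> x != y ->
  (exists l, [/\ l \in lam, phi l != 0 & (l - x) * (l - y) < 0]) /\
  (exists l, [/\ l \in lam, phi l != 0 & 0 < (l - x) * (l - y)]).
Proof.
move=> zx zy xy; have s0 := separation_sum zx zy xy.
have nz l : l \in lam -> phi l != 0 -> (l - x) * (l - y) != 0.
  by move=> hl pl; rewrite mulf_neq0 // subr_eq0; [apply: zx.1|apply: zy.1].
split; apply: contrapT => no.
  suff : 0 < \sum_(l <- lam) l ^+ 2 * phi l ^+ 2 / ((l - x) * (l - y)) by rewrite s0 ltxx.
  apply: weighted_sum_gt0 => l hl pl; rewrite lt0r nz //= leNgt; apply/negP => h.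
  by apply: no; exists l.
suff : 0 < \sum_(l <- lam) l ^+ 2 * phi l ^+ 2 / - ((l - x) * (l - y)).
  under eq_bigr => l _ do rewrite invrN mulrN.
  by rewrite sumrN s0 oppr0 ltxx.
apply: weighted_sum_gt0 => l hl pl; rewrite oppr_gt0 lt_neqAle nz //= leNgt; apply/negP => h.
by apply: no; exists l.
Qed.

(** Two outer points lie in the same interval of the projective line minus the
    eigenvalues with phi l <> 0, against separation. *)
Lemma outer_unique m n : m != 0 -> n != 0 -> green_zero m -> green_zero n -> outer m -> outer n ->
  m = n.
Proof.
move=> m0 n0 zm zn om on; apply/eqP/negPn/negP => mn.
have [[l [hl pl h]] [l' [hl' pl' h']]] := separation zm zn mn.
have e w : (w - m) * (w - n) = (m * n) * ((1 - w / m) * (1 - w / n)) by field; rewrite m0 n0.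
have pos w : w \in lam -> phi w != 0 -> 0 < (1 - w / m) * (1 - w / n).
  by move=> hw pw; rewrite mulr_gt0 // subr_gt0; [exact: om|exact: on].
rewrite e pmulr_llt0 ?pos // in h; rewrite e pmulr_lgt0 ?pos // in h'.
by move: (lt_trans h h'); rewrite ltxx.
Qed.

(** The ways of sharing the roots of the Green numerator between the two sides that
    respect the signs of phi. *)
Definition splitting (rp rh : seq R) := [/\ uniq rp, uniq rh, 0 \notin rp & 0 \notin rh] /\
  [/\ nodal rp * nodal rh = Q, (forall l, l \in lam -> phi l = 0 -> l \in rp /\ l \in rh),
      (forall l, l \in lam -> phi l != 0 -> 0 < phi l * (nodal rp).[l]) &
      (forall m, m \in rp -> m \in rh -> m \in lam)].

Lemma splitting_root rp rh m : splitting rp rh -> (Q.[m] == 0) = (m \in rp ++ rh).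
Proof.
by move=> [[_ _ p0 h0] [<- _ _ _]]; rewrite hornerM mulf_eq0 -!/(root _ _) !root_nodal // mem_cat.
Qed.

Lemma splitting_green_zero rp rh m : splitting rp rh -> Q.[m] = 0 -> green_zero m.
Proof.
move=> v Qm; case: (boolP (m \in lam)) => [ml|]; last by move=> h; exact: green_zero_off.
have pm := phi_root_lam ml Qm; apply: green_zero_double => //.
case: v => [[up uh p0 h0] [<- hc _ _]]; have [mp mh] := hc m ml pm.
have rp0 : (nodal rp).[m] = 0 by apply/eqP; rewrite -/(root _ _) root_nodal.
have rh0 : (nodal rh).[m] = 0 by apply/eqP; rewrite -/(root _ _) root_nodal.
by rewrite derivM hornerD !hornerM rp0 rh0 mulr0 mul0r addr0.
Qed.

Lemma splitting_neq0 rp rh m : splitting rp rh -> Q.[m] = 0 -> m != 0.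
Proof.
move=> v /eqP; rewrite (splitting_root _ v); case: v => [[_ _ p0 h0] _].
by apply: contraTneq => ->; rewrite mem_cat negb_or p0.
Qed.

Lemma prod_pos_seq (s : seq R) (f : R -> R) : (forall m, m \in s -> 0 < f m) ->
  0 < \prod_(m <- s) f m.
Proof. by move=> h; rewrite big_seq; apply: prodr_gt0 => m /h. Qed.

(** Take the eigenvalues with phi <> 0 that are adjacent to m on either side.  No
    other root lies between them, so the product of the values of nodal rp at the
    two is negative if m belongs to rp and positive if not; its sign is that of the
    product of the two values of phi. *)
Lemma splitting_inner rp rh rp' rh' m : splitting rp rh -> splitting rp' rh' -> m \in rp ->
  ~ outer m -> m \in rp'.
Proof.
move=> v v' mp no.
have Qm : Q.[m] = 0 by apply/eqP; rewrite (splitting_root _ v) mem_cat mp.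
have zm := splitting_green_zero v Qm; have m0 := splitting_neq0 v Qm.
case: (boolP (m \in lam)) => [ml|mnl].
  by case: v' => [_ [_ hc _ _]]; case: (hc m ml (phi_root_lam ml Qm)).
apply/negPn/negP => mp'.
have hne l : l \in lam -> phi l != 0 -> l / m != 1.
  by move=> hl pl; rewrite -subr_eq0 -(mulrI_eq0 _ (mulfI m0)) mulrBr mulr1 mulrC divfK // subr_eq0
    zm.1.
have has2 : has (fun l => (phi l != 0) && (1 < l / m)) lam.
  apply/negPn/negP => /hasPn h; apply: no => l hl pl.
  by have := h l hl; rewrite pl /= -leNgt le_eqVlt (negPf (hne _ hl pl)).
have has1 : has (fun l => (phi l != 0) && (l / m < 1)) lam.
  have [[l [hl pl h]] _] := separation zm green_zero0 m0; apply/hasP; exists l => //; rewrite pl /=.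
  rewrite subr0 in h; rewrite ltNge; apply/negP => h1.
  have : 0 <= (l - m) * l.
    have -> : (l - m) * l = m ^+ 2 * ((l / m - 1) * (l / m)) by field.
    by rewrite mulr_ge0 ?sqr_ge0 // mulr_ge0 ?subr_ge0 // (le_trans ler01).
  by rewrite leNgt h.
(* The neighbours of m among the eigenvalues with phi <> 0, on the ray from 0 through m. *)
have [l1 [hl1 /andP[pl1 x1] max1]] := seq_argmax (fun l => l / m) has1.
have [l2 [hl2 /andP[pl2 x2] min2]] := seq_argmax (fun l => - (l / m)) has2.
(* A root n not equal to m cannot lie between l1 and l2, as nothing would separate it from m. *)
have pair_pos n : Q.[n] = 0 -> n != m -> 0 < (1 - l1 / n) * (1 - l2 / n).
  move=> Qn nm; have zn := splitting_green_zero v Qn; have n0 := splitting_neq0 v Qn.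
  have f0 l : l \in lam -> phi l != 0 -> 1 - l / n != 0.
    by move=> hl pl; rewrite -(mulrI_eq0 _ (mulfI n0)) mulrBr mulr1 mulrC divfK // subr_eq0 eq_sym
      zn.1.
  rewrite lt0r mulf_neq0 ?f0 //= leNgt; apply/negP => hneg.
  have mn : m != n by rewrite eq_sym.
  have [[l [hl pl hlt]] _] := separation zm zn mn.
  move: hlt; apply/negP; rewrite -leNgt; apply: ltW.
  have -> : (l - m) * (l - n) = m ^+ 2 * ((l / m - 1) * (l / m - n / m)) by field.
  rewrite mulr_gt0 ?exprn_even_gt0 //.
  have {}hneg : (n / m - l1 / m) * (n / m - l2 / m) < 0.
    have -> : (n / m - l1 / m) * (n / m - l2 / m) = (n / m) ^+ 2 * ((1 - l1 / n) * (1 - l2 / n)).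
      by field; rewrite m0 n0.
    by rewrite pmulr_rlt0 // exprn_even_gt0 //= mulf_neq0 // invr_eq0.
  have [w1 w2] : l1 / m < n / m /\ n / m < l2 / m by move: hneg x1 x2; clear; move: (n/m) (l1/m)
    (l2/m) => w x y h xl ly; split; nra.
  have := hne _ hl pl; rewrite neq_lt => /orP[h|h].
    have h' : l / m <= l1 / m by apply: max1 => //; rewrite pl.
    by rewrite nmulr_rgt0 subr_lt0 // (le_lt_trans h').
  have h' : l2 / m <= l / m by rewrite -lerN2; apply: min2 => //; rewrite pl.
  by rewrite pmulr_rgt0 subr_gt0 // (lt_le_trans w2).
have evalprod (s : seq R) : (nodal s).[l1] * (nodal s).[l2] = \prod_(n <- s) ((1 - l1 / n) * (1 -
  l2 / n)).
  by rewrite !nodal_eval big_split.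
have neg : (nodal rp).[l1] * (nodal rp).[l2] < 0.
  rewrite evalprod (perm_big _ (perm_to_rem mp)) big_cons nmulr_rlt0.
    apply: prod_pos_seq => n nr; apply: pair_pos.
      by apply/eqP; rewrite (splitting_root _ v) mem_cat (mem_rem nr).
    by move: nr; case: v => [[up _ _ _] _]; rewrite mem_rem_uniq // inE => /andP[].
  by rewrite pmulr_rlt0 ?subr_gt0 // subr_lt0.
have ppos : 0 < (nodal rp').[l1] * (nodal rp').[l2].
  rewrite evalprod; apply: prod_pos_seq => n nr; apply: pair_pos.
    by apply/eqP; rewrite (splitting_root _ v') mem_cat nr.
  by apply: contraNneq mp' => <-.
case: v v' => [_ [_ _ sg _]] [_ [_ _ sg' _]].
have a1 := sg _ hl1 pl1; have a2 := sg _ hl2 pl2.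
have b1 := sg' _ hl1 pl1; have b2 := sg' _ hl2 pl2.
have : 0 < (phi l1 * phi l2) * ((nodal rp).[l1] * (nodal rp).[l2]).
  by rewrite mulrACA mulr_gt0.
have : 0 < (phi l1 * phi l2) * ((nodal rp').[l1] * (nodal rp').[l2]).
  by rewrite mulrACA mulr_gt0.
rewrite (pmulr_lgt0 _ ppos) => h; rewrite (pmulr_rgt0 _ h) => h'.
by move: (lt_trans neg h'); rewrite ltxx.
Qed.

Lemma splitting_eq rp rh rp' rh' : (forall m, Q.[m] = 0 -> outer m -> m \in lam) ->
  splitting rp rh -> splitting rp' rh' -> nodal rp = nodal rp'.
Proof.
move=> no; have sub rp1 rh1 rp2 rh2 m : splitting rp1 rh1 -> splitting rp2 rh2 -> m \in rp1 -> m
  \in rp2.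
  move=> v v' mp; have Qm : Q.[m] = 0 by apply/eqP; rewrite (splitting_root _ v) mem_cat mp.
  have [om|om] := pselect (outer m); last exact: splitting_inner v v' mp om.
  have ml := no _ Qm om; case: v' => [_ [_ hc _ _]].
  by case: (hc m ml (phi_root_lam ml Qm)).
move=> v v'; apply: nodal_perm; apply: uniq_perm.
- by case: v => [[]].
- by case: v' => [[]].
- by move=> m; apply/idP/idP; [exact: sub v v'|exact: sub v' v].
Qed.

Section Outer.
Variable m0 : R.
Hypotheses (Qm0 : Q.[m0] = 0) (om0 : outer m0) (m0l : m0 \notin lam).

Let drop (r : seq R) := [seq m <- r | m != m0].

Let nodal_drop r : uniq r -> 0 \notin r ->
  nodal r = (if m0 \in r then 1 - m0^-1 *: 'X else 1) * nodal (drop r).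
Proof.
move=> u r0; case: ifP => h; last first.
  rewrite mul1r /drop; congr nodal; apply/esym/all_filterP/allP => m mr.
  by apply: contraFneq h => <-.
rewrite -nodal_cons; apply: nodal_perm; apply: uniq_perm => //.
  by rewrite /= filter_uniq // mem_filter eqxx.
move=> m; rewrite inE mem_filter; case: eqP => [->|_] //=.
Qed.

(** Away from m0 two splittings coincide, by splitting_inner. *)
Lemma splitting_cases rp rh rp' rh' : splitting rp rh -> splitting rp' rh' ->
  nodal rp = nodal (drop rp') \/ nodal rp = (1 - m0^-1 *: 'X) * nodal (drop rp').
Proof.
move=> v v'; have sub rp1 rh1 rp2 rh2 m : splitting rp1 rh1 -> splitting rp2 rh2 -> m != m0 ->
    m \in rp1 -> m \in rp2.
  move=> w w' mm mp; have Qm : Q.[m] = 0 by apply/eqP; rewrite (splitting_root _ w) mem_cat mp.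
  apply: (splitting_inner w w' mp) => om; case/eqP: mm.
  by apply: outer_unique => //; [exact: splitting_neq0 w Qm|exact: splitting_neq0 w Qm0|
    exact: splitting_green_zero w Qm|exact: splitting_green_zero w Qm0].
have -> : nodal (drop rp') = nodal (drop rp).
  apply: nodal_perm; apply: uniq_perm.
  - by rewrite filter_uniq //; case: v' => [[]].
  - by rewrite filter_uniq //; case: v => [[]].
  - move=> m; rewrite !mem_filter; case: (boolP (m != m0)) => //= h.
    by apply/idP/idP; [exact: sub v' v h|exact: sub v v' h].
case: v => [[up _ p0 _] _]; rewrite (nodal_drop up p0).
by case: ifP => _; [right|left; rewrite mul1r].
Qed.

(** The factor 1 - l / m0 is positive at every eigenvalue with phi l <> 0, so moving m0
    from one side to the other changes no sign. *)
Lemma splitting_drop rp rh : splitting rp rh ->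
  splitting (drop rp) (m0 :: drop rh) /\ splitting (m0 :: drop rp) (drop rh).
Proof.
move=> v; have m00 := splitting_neq0 v Qm0.
have := splitting_root m0 v; rewrite Qm0 eqxx mem_cat => /esym min.
case: v => [[up uh p0 h0] [eQ hc sg cm]].
have eP : (1 - m0^-1 *: 'X) * (nodal (drop rp) * nodal (drop rh)) = Q.
  rewrite -eQ (nodal_drop up p0) (nodal_drop uh h0).
  case: (boolP (m0 \in rp)) (boolP (m0 \in rh)) min => [h1|h1] [h2|h2] // _.
  - by case/negP: m0l; exact: cm.
  - by ring.
  - by ring.
have ud r : uniq r -> uniq (drop r) by exact: filter_uniq.
have d0 (r : seq R) : 0 \notin r -> 0 \notin drop r by rewrite mem_filter negb_and => ->; rewrite
  orbT.
have umd r : uniq r -> uniq (m0 :: drop r) by move=> u; rewrite /= ud // mem_filter eqxx.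
have md0 (r : seq R) : 0 \notin r -> 0 \notin m0 :: drop r.
  by move=> r0; rewrite inE negb_or eq_sym m00 d0.
have neq l : l \in lam -> l != m0 by apply: contraTneq => ->.
have sgd l : l \in lam -> phi l != 0 -> 0 < phi l * (nodal (drop rp)).[l].
  move=> hl pl; have := sg l hl pl; rewrite (nodal_drop up p0); case: ifP => _; last by rewrite
    mul1r.
  rewrite hornerM mulrCA pmulr_rgt0 // !horner_ops mulrC subr_gt0; exact: om0.
split; split => //; try (split; auto).
- by rewrite nodal_cons -eP; ring.
- move=> l hl pl; have [lp lh] := hc l hl pl.
  by rewrite inE !mem_filter lp lh (neq l hl) orbT.
- move=> m; rewrite inE !mem_filter => /andP[mm mp] /predU1P[e|/andP[_ mh]].
    by rewrite e eqxx in mm.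
  exact: cm.
- by rewrite nodal_cons -eP; ring.
- move=> l hl pl; have [lp lh] := hc l hl pl.
  by rewrite inE !mem_filter lp lh (neq l hl) orbT.
- move=> l hl pl; rewrite nodal_cons hornerM mulrCA pmulr_rgt0; first exact: sgd.
  rewrite !horner_ops mulrC subr_gt0; exact: om0.
- move=> m; rewrite inE !mem_filter => /predU1P[e|/andP[_ mp]] /andP[mm mh].
    by rewrite e eqxx in mm.
  exact: cm.
Qed.

End Outer.

(** Along the ray e (1 + t), t > 0, the function z G(z) tends to a nonzero constant at
    infinity and to infinity with the other sign at e, so it vanishes somewhere. *)
Lemma outer_exists (e : R) : e \in lam -> phi e != 0 ->
  e * (\sum_(l <- lam) l * phi l ^+ 2) < 0 -> (forall l, l \in lam -> l / e <= 1) ->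
  exists m, [/\ Q.[m] = 0, outer m & m \notin lam].
Proof.
move=> el pe; set B := \sum_(l <- lam) _ => eB hle.
have e0 := lam_neq0 lam0 el.
pose k := - (e * B); have k0 : 0 < k by rewrite oppr_gt0.
pose L := \sum_(l <- lam) l ^+ 2 * phi l ^+ 2.
pose x t := e * (1 + t).
have lx t l : 0 < t -> l \in lam -> l / x t < 1.
  move=> t0 hl; rewrite /x invfM mulrA ltr_pdivrMr ?mul1r; last by rewrite addr_gt0.
  by apply: le_lt_trans (hle _ hl) _; rewrite ltrDl.
have xn0 t : 0 < t -> x t != 0 by move=> t0; rewrite mulf_neq0 // gt_eqF // addr_gt0.
have xl t : 0 < t -> x t \notin lam.
  move=> t0; apply/negP => /(lx t _ t0); rewrite mulfV ?ltxx //; exact: xn0.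
have ot t : 0 < t -> outer (x t) by move=> t0 l hl _; exact: lx.
pose S t := \sum_(l <- lam) l * phi l ^+ 2 / (l - x t).
have QS t : 0 < t -> Q.[x t] = (nodal lam).[x t] * S t.
  move=> t0; rewrite /Q /green_num pfnum_eval //; last exact: xl.
  congr (_ * _); rewrite /S !big_seq; apply: eq_bigr => l hl.
  have : l != x t by apply: contraNneq (xl t t0) => <-.
  by move=> h; field; rewrite !subr_eq0 h eq_sym h.
have gS t : 0 < t -> (e * x t) * S t = k - \sum_(l <- lam) l ^+ 2 * phi l ^+ 2 / (1 + t - l / e).
  move=> t0; rewrite /S /k /B !mulr_sumr -opprD -big_split -sumrN /= !big_seq.
  apply: eq_bigr => l hl; have h : l != x t by apply: contraNneq (xl t t0) => <-.
  have h2 : e * (1 + t) - l != 0 by rewrite subr_eq0 eq_sym.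
  have h3 : l - e * (1 + t) != 0 by rewrite subr_eq0.
  by rewrite /x; field; rewrite e0 [(1 + t) * e]mulrC h2 h3.
clearbody k.
have term_ge0 t l : 0 < t -> l \in lam -> 0 <= l ^+ 2 * phi l ^+ 2 / (1 + t - l / e).
  move=> t0 hl; apply: divr_ge0; first by rewrite mulr_ge0 ?sqr_ge0.
  by rewrite subr_ge0; apply: le_trans (hle _ hl) _; rewrite lerDl ltW.
have L0 : e ^+ 2 * phi e ^+ 2 <= L.
  rewrite /L (bigD1_seq e) //= lerDl; apply: sumr_ge0 => l _.
  by rewrite mulr_ge0 // sqr_ge0.
have M0 : 0 < e ^+ 2 * phi e ^+ 2 by rewrite mulr_gt0 // exprn_even_gt0.
(* At t0 the term of e alone exceeds k, while at t1 all the terms together are at most k / 2. *)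
pose t0 := e ^+ 2 * phi e ^+ 2 / (2 * k); pose t1 := 2 * L / k.
have t00 : 0 < t0 by rewrite divr_gt0 // mulr_gt0.
have t10 : 0 < t1 by rewrite divr_gt0 // mulr_gt0 // (lt_le_trans M0).
have t01 : t0 <= t1.
  rewrite /t0 /t1 ler_pdivrMr ?mulr_gt0 //.
  have -> : 2 * L / k * (2 * k) = 4 * L by field; rewrite gt_eqF.
  lra.
have S0 : S t0 < 0.
  rewrite -(pmulr_rlt0 _ (_ : 0 < e * x t0)); last first.
    by rewrite /x mulrA -expr2 mulr_gt0 ?exprn_even_gt0 // addr_gt0.
  rewrite gS // subr_lt0 (bigD1_seq e) //=.
  have -> : e ^+ 2 * phi e ^+ 2 / (1 + t0 - e / e) = 2 * k.
    by rewrite mulfV // addrAC subrr add0r /t0; field; rewrite (gt_eqF k0) pe e0.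
  have : 0 <= \sum_(i <- lam | i != e) i ^+ 2 * phi i ^+ 2 / (1 + t0 - i / e).
    by rewrite big_seq_cond; apply: sumr_ge0 => l /andP[hl _]; exact: term_ge0.
  move=> h; lra.
have S1 : 0 < S t1.
  rewrite -(pmulr_rgt0 _ (_ : 0 < e * x t1)); last first.
    by rewrite /x mulrA -expr2 mulr_gt0 ?exprn_even_gt0 // addr_gt0.
  rewrite gS // subr_gt0; apply: le_lt_trans (_ : L / t1 < k).
    rewrite /L mulr_suml big_seq [leRHS]big_seq; apply: ler_sum => l hl.
    apply: ler_wpM2l; first by rewrite mulr_ge0 ?sqr_ge0.
    have := hle _ hl; move: (l / e) => w hw.
    have w1 : t1 <= 1 + t1 - w by lra.
    by rewrite lef_pV2 // posrE (lt_le_trans t10).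
  have Lp : 0 < L := lt_le_trans M0 L0.
  have -> : L / t1 = k / 2 by rewrite /t1; field; rewrite !gt_eqF.
  lra.
have PP : 0 < (nodal lam).[x t0] * (nodal lam).[x t1].
  rewrite !nodal_eval -big_split /=; apply: prod_pos_seq => l hl.
  have l0 := lam_neq0 lam0 hl.
  have -> : (1 - x t0 / l) * (1 - x t1 / l) =
     (x t0 * x t1) / l ^+ 2 * ((1 - l / x t0) * (1 - l / x t1)).
    by field; rewrite l0 !xn0.
  rewrite mulr_gt0 //; last by rewrite mulr_gt0 // subr_gt0 lx.
  rewrite divr_gt0 ?exprn_even_gt0 // /x mulrACA -expr2 mulr_gt0 ?exprn_even_gt0 //.
  by rewrite mulr_gt0 // addr_gt0.
pose P := Q \Po (e%:P * (1 + 'X)).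
have PE t : P.[t] = Q.[x t] by rewrite /P horner_comp !horner_ops.
have neg : P.[t0] * P.[t1] < 0.
  rewrite !PE !QS // mulrACA pmulr_rlt0 // pmulr_llt0 //.
have [w wI wr] : exists2 w, w \in `[t0, t1] & root P w.
  case: (ltP P.[t0] 0) => h.
    have h1 : 0 <= P.[t1] by rewrite -(nmulr_rle0 _ h) ltW.
    have hin : 0 \in `[P.[t0], P.[t1]] by rewrite in_itv /= ltW.
    by have [w w1 w2] := poly_ivt t01 hin; exists w.
  have h0 : 0 < P.[t0].
    by rewrite lt0r h andbT; apply: contraTneq neg => ->; rewrite mul0r ltxx.
  have h1 : P.[t1] <= 0 by rewrite -(pmulr_rle0 _ h0) ltW.
  have hin : 0 \in `[(- P).[t0], (- P).[t1]].
    by rewrite in_itv /= !hornerN oppr_le0 oppr_ge0 h.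
  by have [w w1 w2] := poly_ivt t01 hin; exists w => //; rewrite -rootN.
have w0 : 0 < w by move: wI; rewrite in_itv /= => /andP[h _]; exact: lt_le_trans h.
exists (x w); split; [by apply/eqP; rewrite -PE|exact: ot|exact: xl].
Qed.

End Gap.

(** * Pairs with given interior data and norming constants *)

Section Exist.
Context {R : realType}.
Implicit Types (p : coef_pair R) (rp rh : seq R).
Variables (a : R) (lam : seq R) (phi : R -> R).
Hypotheses (ulam : uniq lam) (lam0 : 0 \notin lam) (phi1 : \sum_(l <- lam) phi l ^+ 2 = 1).

Let b := expR a.
Let b0 : 0 < b. Proof. exact: expR_gt0. Qed.
Let bn0 : b != 0. Proof. by rewrite gt_eqF. Qed.

Lemma rslope_neq0 p l : intercept (string_of p) = nodal lam -> l \in lam -> (rslope (string_of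
  p)).[l] != 0.
Proof.
move=> hp hl; have [e] := normingE lam0 hp hl; rewrite e.
by apply: contraTneq => ->; rewrite !mulr0 ltxx.
Qed.

Lemma has_data_splitting p : has_data a lam phi p ->
  exists rp rh, [/\ splitting lam phi rp rh, right_sol a p = nodal rp & left_sol a p = nodal rh].
Proof.
move=> hd; have [hp _] := hd.
have [rp [up p0 eP _ _]] := data_right a p; have [rh [uh h0 eH _ _]] := data_left a p.
exists rp, rh; split => //; split => //; split.
- by rewrite -eP -eH; exact: has_data_green_num.
- move=> l hl pl; have [e _] := has_data_phi2 lam0 hd hl.
  have P0 : (right_sol a p).[l] = 0.
    by move/eqP: e; rewrite pl expr0n /= mul0r eq_sym sqrf_eq0 => /eqP.
  split; first by rewrite -root_nodal // -eP; apply/eqP.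
  rewrite -root_nodal // -eH /root; have := data_root a lam0 hp hl.
  rewrite P0 => /esym/eqP; rewrite oppr_eq0 !mulf_eq0 (negPf bn0) (negPf (rslope_neq0 hp hl)).
  by rewrite (negPf (lam_neq0 lam0 hl)).
- move=> l hl pl; have [e h] := has_data_phi2 lam0 hd hl; rewrite -eP lt0r h andbT.
  rewrite mulf_neq0 // -sqrf_eq0 -e mulf_neq0 ?sqrf_eq0 // mulf_neq0 //.
  by have [_ n0] := normingE lam0 hp hl; rewrite gt_eqF.
- move=> m mp mh; rewrite -root_nodal // /root (data_intercept a hp) eP eH.
  have P0 : (nodal rp).[m] = 0 by apply/eqP; rewrite -/(root _ _) root_nodal.
  have H0 : (nodal rh).[m] = 0 by apply/eqP; rewrite -/(root _ _) root_nodal.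
  move: (nodal rp) (nodal rh) (node_sum a p) (left_slope a p) (right_slope a p) P0 H0 => P H q C J
    P0 H0.
  by rewrite !(hornerD, hornerM, hornerZ) P0 H0 !(mul0r, mulr0, addr0).
Qed.

Lemma has_data_norming p l : has_data a lam phi p -> l \in lam -> phi l != 0 ->
  norming p l = (right_sol a p).[l] ^+ 2 / (b * phi l ^+ 2).
Proof.
move=> hd hl pl; have [<- _] := has_data_phi2 lam0 hd hl.
by rewrite -/b; field; rewrite pl bn0.
Qed.

Lemma glue_is_string c s1 (sb s2 : seq (R * R * R)) (d : R) : c < d -> is_string c s1 ->
  (forall t, t \in s1 -> pos t < d) -> is_string d s2 -> all good_node sb ->
  sb = [::] \/ (exists2 t, sb = [:: t] & pos t = d) -> is_string c (s1 ++ sb ++ s2).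
Proof.
move=> cd h1 hlt h2 hg hb; elim: s1 c cd h1 hlt => [|t s1 IH] c cd.
  move=> _ _; case: hb hg => [-> _|[t -> et]] /=; first exact: is_string_weaken (ltW cd) h2.
  by rewrite andbT et cd h2 => ->.
case/and3P => ct gt h1 hlt; rewrite /= ct gt IH //.
  by apply: hlt; exact: mem_head.
by move=> u us; apply: hlt; rewrite inE us orbT.
Qed.

(** With C and C' the reduced slopes of the two halves, the residue at m of
    b C / P + C' / (b H); by glue_intercept, W depends on the halves only through
    P H and these residues. *)
Definition total_residue rp rh (kp kh : R -> R) m :=
  (if m \in rp then b * kp m else 0) + (if m \in rh then b^-1 * kh m else 0).

Lemma sum_sub (r r' : seq R) (F : R -> R) : uniq r -> uniq r' -> {subset r <= r'} ->
  \sum_(m <- r) F m = \sum_(m <- r') (if m \in r then F m else 0).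
Proof.
move=> u u' h; rewrite -big_mkcond -big_filter; apply: perm_big; apply: uniq_perm => //.
  exact: filter_uniq.
by move=> m; rewrite mem_filter; case: (boolP (m \in r)) => //= /h.
Qed.

Lemma residues_eval rp rh kp kh x : uniq rp -> uniq rh -> 0 \notin rp -> 0 \notin rh ->
  x \notin rp -> x \notin rh ->
  (b^-1 *: (nodal rp * pfnum rh kh) + b *: (nodal rh * pfnum rp kp)).[x] =
  (nodal rp * nodal rh).[x] * \sum_(m <- undup (rp ++ rh)) total_residue rp rh kp kh m / (x - m).
Proof.
move=> up uh p0 h0 xp xh.
rewrite hornerD !hornerZ !hornerM !pfnum_eval //.
rewrite (@sum_sub rp (undup (rp ++ rh))) ?undup_uniq //; last first.
  by move=> m mp; rewrite mem_undup mem_cat mp.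
rewrite (@sum_sub rh (undup (rp ++ rh))) ?undup_uniq //; last first.
  by move=> m mh; rewrite mem_undup mem_cat mh orbT.
set u := undup _; rewrite mulrCA addrC [X in _ + X]mulrCA.
have -> : \sum_(m <- u) total_residue rp rh kp kh m / (x - m) =
    b * (\sum_(m <- u) (if m \in rp then kp m / (x - m) else 0)) +
    b^-1 * (\sum_(m <- u) (if m \in rh then kh m / (x - m) else 0)).
  rewrite !mulr_sumr -big_split /=; apply: eq_bigr => m _; rewrite /total_residue.
  by case: ifP => _; case: ifP => _; rewrite ?mulr0 ?addr0 ?add0r ?mulrDl ?mul0r -?mulrA.
ring.
Qed.

Lemma uniq_seq_of_size (n : nat) : exists l : seq R, uniq l /\ size l = n.
Proof.
exists [seq i%:R | i <- iota 0 n]; rewrite size_map size_iota; split => //.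
rewrite map_inj_uniq ?iota_uniq // => i j /eqP; rewrite eqr_nat => /eqP //.
Qed.

(** Keep the node at b and the total residues of p0.  A root of one side only takes the
    whole residue; at a common root l the residue is divided in the ratio tau : 1,
    and the norming constant of l is then a fixed multiple of tau.  Both halves
    exist by inverse_string, and W does not change as it depends only on nodal rp *
    nodal rh, on the total residues and on the node at b. *)
Theorem has_data_exists p0 rp rh (c : R -> R) : has_data a lam phi p0 -> splitting lam phi rp rh ->
  (forall l, l \in lam -> 0 < c l) ->
  (forall l, l \in lam -> phi l != 0 -> c l = (nodal rp).[l] ^+ 2 / (b * phi l ^+ 2)) ->
  exists p, has_data a lam phi p /\ forall l, l \in lam -> norming p l = c l.
Proof.
move=> hd0 v cpos cact; have [hp0 _] := hd0.
have [rp0 [up0 np0 eP0 sC0 pos0]] := data_right a p0.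
have [rh0 [uh0 nh0 eH0 sD0 posh0]] := data_left a p0.
have eQ0 := has_data_green_num ulam lam0 phi1 hd0; rewrite eP0 eH0 in eQ0.
have vr := splitting_root _ v.
have [[up uh np nh] [eQ hc sg cm]] := v.
pose kp0 m := (right_slope a p0).[m] / (nodal rp0)^`().[m].
pose kh0 m := (left_slope a p0).[m] / (nodal rh0)^`().[m].
have quot_pos (x y : R) : 0 < x * y -> 0 < x / y.
  move=> h; have y0 : y != 0 by apply: contraTneq h => ->; rewrite mulr0 ltxx.
  have -> : x / y = x * y / y ^+ 2 by field.
  by rewrite divr_gt0 // exprn_even_gt0.
have kp0p m : m \in rp0 -> 0 < kp0 m by move=> h; apply: quot_pos; exact: pos0.
have kh0p m : m \in rh0 -> 0 < kh0 m by move=> h; apply: quot_pos; exact: posh0.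
pose rt := total_residue rp0 rh0 kp0 kh0.
have mem0 m : (m \in rp0 ++ rh0) = (m \in rp ++ rh).
  by rewrite -vr -eQ0 hornerM mulf_eq0 -!/(root _ _) !root_nodal // mem_cat.
have rtp m : m \in rp ++ rh -> 0 < rt m.
  rewrite -mem0 mem_cat /rt /total_residue; case: ifP => h1; case: ifP => h2 //= _.
  - by rewrite addr_gt0 // mulr_gt0 ?invr_gt0 // ?kp0p ?kh0p.
  - by rewrite addr0 mulr_gt0 // kp0p.
  - by rewrite add0r mulr_gt0 ?invr_gt0 // kh0p.
have dP m : m \in rp -> (nodal rp)^`().[m] != 0 by move=> h; rewrite nodal_deriv // nodal_part_self.
have dH m : m \in rh -> (nodal rh)^`().[m] != 0 by move=> h; rewrite nodal_deriv // nodal_part_self.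
(* The ratio of the residues that makes the norming constant at m equal to c m. *)
pose tau m := c m * b / (m ^+ 2 * (nodal rp)^`().[m] ^+ 2 * rt m).
have tau0 m : m \in rp -> m \in rh -> 0 < tau m.
  move=> mp mh; have ml := cm m mp mh.
  have m2 : 0 < m ^+ 2 by rewrite exprn_even_gt0 //= (lam_neq0 lam0 ml).
  have P2 : 0 < (nodal rp)^`().[m] ^+ 2 by rewrite exprn_even_gt0 //= dP.
  have r0 : 0 < rt m by apply: rtp; rewrite mem_cat mp.
  have c0 := cpos m ml.
  apply: divr_gt0; first exact: mulr_gt0.
  by apply: mulr_gt0 => //; exact: mulr_gt0.
pose kp m := if m \in rh then rt m * tau m / (1 + tau m) / b else rt m / b.
pose kh m := if m \in rp then rt m / (1 + tau m) * b else rt m * b.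
have kpp m : m \in rp -> 0 < kp m.
  move=> mp; have r0 : 0 < rt m by apply: rtp; rewrite mem_cat mp.
  rewrite /kp; case: ifP => mh; last exact: divr_gt0.
  have t0 := tau0 m mp mh.
  by apply: divr_gt0 => //; apply: divr_gt0; [exact: mulr_gt0|exact: addr_gt0].
have khp m : m \in rh -> 0 < kh m.
  move=> mh; have r0 : 0 < rt m by apply: rtp; rewrite mem_cat mh orbT.
  rewrite /kh; case: ifP => mp; last exact: mulr_gt0.
  have t0 := tau0 m mp mh.
  by apply: mulr_gt0 => //; apply: divr_gt0 => //; exact: addr_gt0.
(* The new residues add up to the old ones. *)
have rtE m : m \in rp ++ rh -> total_residue rp rh kp kh m = rt m.
  rewrite mem_cat /total_residue /kp /kh; case: ifP => mp; case: ifP => mh //= _.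
  - have t1 : 1 + tau m != 0 by rewrite gt_eqF // addr_gt0 //; exact: tau0.
    by field; rewrite bn0 t1.
  - by field.
  - by field.
have node_pos (r : seq R) (k : R -> R) m : uniq r -> 0 \notin r -> m \in r -> 0 < k m ->
    0 < (pfnum r k).[m] * (nodal r)^`().[m].
  move=> u r0 mr k0; rewrite pfnum_node // -mulrA -expr2 mulr_gt0 // exprn_even_gt0 //=.
  by rewrite nodal_deriv // nodal_part_self.
have bV : 0 < b^-1 by rewrite invr_gt0.
have [s2 [hs2 es2 cs2]] := inverse_string up np (size_pfnum kp np)
  (fun m h => node_pos rp kp m up np h (kpp m h)) (ltW b0).
have [s1r [hs1 es1 cs1]] := inverse_string uh nh (size_pfnum kh nh)
  (fun m h => node_pos rh kh m uh nh h (khp m h)) (ltW bV).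
pose s1 := reflect s1r.
have es1r : reflect s1 = s1r by exact: reflectK.
have s1lt t : t \in s1 -> pos t < b.
  rewrite /s1 /reflect mem_rev => /mapP[u us ->]; have h := is_string_all hs1 us.
  by change ((pos u)^-1 < b); rewrite invf_plt ?posrE // (lt_trans bV).
have hs1' : is_string 0 s1.
  have [X hX] := exists_right s1r.
  have X1 : 0 < Num.max X 0 + 1 by rewrite ltr_wpDl // le_max lexx orbT.
  apply: (@is_string_weaken _ _ ((Num.max X 0 + 1)^-1)); first by rewrite invr_ge0 ltW.
  apply: (is_string_reflect X1 (ltW bV) hs1) => t ts; rewrite ltr_pwDr //.
  by rewrite le_max (allP hX).
pose sb := at_node b (string_of p0).
have [_ _ _ hsb] := split_string b (string_of_is_string p0).
have gsb : all good_node sb.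
  apply/allP => t; rewrite mem_filter => /andP[_ ts].
  by have := string_of_is_string p0; rewrite is_stringE => /andP[_ /allP]; apply.
have hs : is_string 0 (s1 ++ sb ++ s2) by exact: glue_is_string b0 hs1' s1lt hs2 gsb hsb.
have icE : intercept (s1 ++ sb ++ s2) = nodal lam.
  rewrite (glue_intercept b0 hs hsb) es1r es2 es1 cs2 cs1 (data_intercept a hp0) -/b.
  rewrite eP0 eH0 -[\sum_(t <- sb) node_poly t]/(node_sum a p0) eQ0 eQ; congr (_ + 'X * _).
  apply: (@poly_eq_off _ (rp ++ rh)) uniq_seq_of_size => x xr.
  have := xr; rewrite -mem0 mem_cat negb_or => /andP[xp0 xh0].
  move: xr; rewrite mem_cat negb_or => /andP[xp xh].
  have -> : right_slope a p0 = pfnum rp0 kp0 by exact: nodal_lagrange.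
  have -> : left_slope a p0 = pfnum rh0 kh0 by exact: nodal_lagrange.
  rewrite !residues_eval // eQ eQ0; congr (_ * _).
  transitivity (\sum_(m <- undup (rp ++ rh)) rt m / (x - m)).
    by rewrite !big_seq; apply: eq_bigr => m; rewrite mem_undup => /rtE ->.
  apply: perm_big; apply: uniq_perm; rewrite ?undup_uniq // => m.
  by rewrite !mem_undup mem0.
have sn : s1 ++ sb ++ s2 != [::].
  apply/eqP => e; move: icE; rewrite e /intercept /= => /(congr1 (fun P : {poly R} => size P)).
  rewrite size_poly1 size_nodal // => -[] /esym/size0nil e2.
  by move: phi1; rewrite e2 big_nil => /esym/eqP; rewrite oner_eq0.
have [p eps] := pair_of_string hs sn.
have sbb t : t \in sb -> pos t = b by rewrite mem_filter => /andP[/eqP].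
have hp : intercept (string_of p) = nodal lam by rewrite eps.
have eR : right_of b (string_of p) = s2 by rewrite eps; exact: right_of_cat.
have eL : left_of b (string_of p) = s1 by rewrite eps; exact: left_of_cat.
have ePp : right_sol a p = nodal rp by rewrite /right_sol -/b eR.
have ePh : left_sol a p = nodal rh by rewrite /left_sol -/b eL es1r.
have eCp : right_slope a p = pfnum rp kp by rewrite /right_slope -/b eR.
have eCh : left_slope a p = pfnum rh kh by rewrite /left_slope -/b eL es1r.
have hd : has_data a lam phi p.
  split => // l hl; rewrite -/b -/(right_sol a p) ePp; have [_ n0] := normingE lam0 hp hl.
  have [pl|pl] := eqVneq (phi l) 0.
    have [lp _] := hc l hl pl; have -> : (nodal rp).[l] = 0.
      by apply/eqP; rewrite -/(root _ _) root_nodal.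
    by rewrite pl mulr0 mul0r.
  have := norming_right_sol a lam0 hp hl; rewrite -/b ePp ePh eQ green_num_at_lam // => e.
  have {}e : phi l ^+ 2 * (b * norming p l) = (nodal rp).[l] ^+ 2.
    apply: (mulfI (_ : - l * (nodal lam)^`().[l] != 0)).
      by rewrite mulf_neq0 ?oppr_eq0 ?(lam_neq0 lam0 hl) // nodal_deriv // nodal_part_self.
    by rewrite -e; ring.
  have sgl := sg l hl pl.
  set w := decay a * (nodal rp).[l] / Num.sqrt (norming p l).
  have w2 : phi l ^+ 2 = w ^+ 2.
    rewrite /w !exprMn decay_sqr exprVn sqr_sqrtr ?ltW // -e -/b; field.
    by rewrite bn0 gt_eqF.
  have wp : 0 < phi l * w.
    have -> : phi l * w = decay a / Num.sqrt (norming p l) * (phi l * (nodal rp).[l]).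
      by rewrite /w; ring.
    by apply: mulr_gt0 => //; apply: divr_gt0; rewrite ?decay_gt0 ?sqrtr_gt0.
  move/eqP: w2; rewrite eqf_sqr => /orP[/eqP //|/eqP ew].
  by move: wp; rewrite ew mulNr oppr_gt0 ltNge -expr2 sqr_ge0.
exists p; split => // l hl.
have [pl|pl] := eqVneq (phi l) 0; last by rewrite has_data_norming // ePp cact.
have [lp lh] := hc l hl pl.
have P0 : (right_sol a p).[l] = 0 by apply/eqP; rewrite ePp -/(root _ _) root_nodal.
have H0 : (left_sol a p).[l] = 0 by apply/eqP; rewrite ePh -/(root _ _) root_nodal.
have [-> _] := normingE lam0 hp hl.
have e1 := data_deriv hp P0 H0; have e2 := data_root2 lam0 hp hl P0 H0.
have t0 := tau0 l lp lh; have r0 : 0 < rt l by apply: rtp; rewrite mem_cat lp.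
have dPl := dP l lp; have dHl := dH l lh; have l0 := lam_neq0 lam0 hl.
have kpl : kp l = rt l * tau l / (1 + tau l) / b by rewrite /kp lh.
have khl : kh l = rt l / (1 + tau l) * b by rewrite /kh lp.
have kh0' : kh l != 0 by rewrite gt_eqF // khp.
rewrite eCp eCh ePp ePh !pfnum_node // -/b in e1 e2.
have tE : c l = tau l * (l ^+ 2 * (nodal rp)^`().[l] ^+ 2 * rt l) / b.
  rewrite /tau; field; rewrite bn0 dPl l0 /=; by rewrite gt_eqF.
rewrite e1 tE.
move: (rslope (string_of p)).[l] (nodal rp)^`().[l] (nodal rh)^`().[l] e2 dPl dHl => C P H e2 P0'
  H0'.
have eC : C = b * (kp l * P) / (l * (kh l * H)).
  by rewrite e2; field; rewrite bn0 l0 kh0' H0'.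
rewrite eC kpl khl; move: (rt l) (tau l) r0 t0 => r t r0 t0.
have t1 : 1 + t != 0 by rewrite gt_eqF // addr_gt0.
by field; rewrite bn0 l0 H0' t1 gt_eqF.
Qed.

End Exist.

(** * Orthants as manifolds *)

Section Topology.
Context {R : realType}.

Lemma continuous_matrix (T : topologicalType) m n (f : T -> 'M[R]_(m, n)) :
  (forall i j, continuous (fun x => f x i j)) -> continuous f.
Proof.
move=> h x A [P MP sub].
have : \forall y \near x, forall i, forall j, P i j (f y i j).
  by apply: filter_forall => i; apply: filter_forall => j; apply: h; exact: MP.
by apply: filterS => y hy; apply: sub => i j; exact: hy.
Qed.

Lemma star_connected m n (A : set 'M[R]_(m, n)) (x0 : 'M[R]_(m, n)) : A x0 ->
  (forall x t, A x -> 0 <= t <= 1 -> A ((1 - t) *: x0 + t *: x)) -> connected A.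
Proof.
move=> Ax0 hA; pose g (x : 'M[R]_(m, n)) (t : R) := (1 - t) *: x0 + t *: x.
have gc x : continuous (g x).
  apply: continuous_matrix => i j.
  have -> : (fun t => g x t i j) = (fun t => (1 - t) * x0 i j + t * x i j).
    by apply/funext => t; rewrite /g !mxE.
  move=> t; apply: cvgD; apply: cvgM; try exact: cvg_cst.
    by apply: cvgB; [exact: cvg_cst|exact: cvg_id].
  exact: cvg_id.
have -> : A = \bigcup_(x in A) (g x @` `[0, 1]).
  apply/seteqP; split => [x Ax|y [x Ax [t]]].
    by exists x => //; exists 1; rewrite /= ?in_itv /= ?ler01 ?lexx // /g subrr scale0r add0r
      scale1r.
  by rewrite /= in_itv /= => t01 <-; exact: hA.
apply: bigcup_connected.
  exists x0 => x _; exists 0; rewrite /= ?in_itv /= ?ler01 ?lexx //.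
  by rewrite /g subr0 scale1r scale0r addr0.
move=> x _; apply: connected_continuous_connected; first exact: segment_connected.
exact: continuous_subspaceT.
Qed.

Section Orth.
Variables (N : nat) (lamr : 'I_N -> R) (Z : pred 'I_N) (d : 'I_N -> R).

(** The coordinates in Z range over the positive half-line, the others are fixed. *)
Definition orthant : set 'rV[R]_(N + N) := [set s | forall i,
  s 0 (lshift N i) = lamr i /\
  if Z i then is_true (0 < s 0 (rshift N i)) else s 0 (rshift N i) = d i].

Definition orthant_pt (c : 'I_N -> R) : 'rV[R]_(N + N) :=
  row_mx (\row_i lamr i) (\row_i (if Z i then c i else d i)).

Lemma orthant_ptP c : (forall i, Z i -> 0 < c i) -> orthant (orthant_pt c).
Proof.
move=> h i; rewrite /orthant_pt row_mxEl row_mxEr !mxE; split => //.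
by move: (h i); case: (Z i) => //; exact.
Qed.

Lemma orthant_connected : connected orthant.
Proof.
apply: (@star_connected _ _ _ (orthant_pt (fun=> 1))); first exact: orthant_ptP.
move=> x t Ax /andP[t0 t1] i; have [x1 x2] := Ax i.
have := orthant_ptP (c := fun=> 1) (fun _ _ => ltr01) i.
move: (orthant_pt _) => y [y1 y2]; rewrite !mxE.
rewrite x1 y1; split; first by ring.
move: x2 y2; case: ifP => _; last by move=> -> ->; ring.
move=> x2 y2; case: (ltP 0 t) => ht.
  by apply: ltr_wpDl; [rewrite mulr_ge0 ?subr_ge0 // ltW|exact: mulr_gt0].
have -> : t = 0 by apply/eqP; rewrite eq_le ht t0.
by rewrite subr0 mul1r mul0r addr0.
Qed.

(** A single chart, the projection to the coordinates in Z. *)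
Lemma orthant_manifold k (e : 'I_k -> 'I_N) (r : 'I_N -> 'I_k) :
  (forall j, Z (e j)) -> (forall j, r (e j) = j) -> (forall i, Z i -> e (r i) = i) ->
  manifold k orthant.
Proof.
move=> he hr her x Ax; exists setT, [set w : 'rV[R]_k | forall j, 0 < w 0 j],
  (fun s => \row_j s 0 (rshift N (e j))), (fun w => orthant_pt (fun i => w 0 (r i))).
split; split => //.
- exact: openT.
- rewrite openE => w hw; exists (fun _ _ => [set y : R | 0 < y]).
    by move=> i j; rewrite (ord1 i); apply: open_nbhs_nbhs; split; [exact: open_gt|exact: hw].
  by move=> v hv j; exact: hv.
- apply: continuous_subspaceT; apply: continuous_matrix => i j.
  have -> : (fun s : 'rV[R]_(N + N) => (\row_j s 0 (rshift N (e j))) i j) = 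
            (fun s : 'rV[R]_(N + N) => s 0 (rshift N (e j))).
    by apply/funext => s; rewrite !mxE.
  exact: coord_continuous.
- apply: continuous_subspaceT; apply: continuous_matrix => i j; rewrite (ord1 i).
  rewrite /orthant_pt; case: (splitP j) => l hl.
    have -> : j = lshift N l by apply: val_inj.
    under eq_fun do rewrite row_mxEl mxE.
    exact: cst_continuous.
  have -> : j = rshift N l by apply: val_inj.
  under eq_fun do rewrite row_mxEr mxE.
  by case: (Z l); [exact: coord_continuous|exact: cst_continuous].
- move=> y [Ay _]; split.
    by move=> j; rewrite mxE; have [_] := Ay (e j); rewrite he.
  apply/rowP => j; rewrite /orthant_pt; case: (splitP j) => l hl.
    have -> : j = lshift N l by apply: val_inj.
    by rewrite row_mxEl mxE; have [] := Ay l.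
  have -> : j = rshift N l by apply: val_inj.
  rewrite row_mxEr !mxE; have [_] := Ay l; case: ifP => // Zl _.
  by rewrite her.
- move=> w hw; split; last by apply/rowP => j; rewrite mxE /orthant_pt row_mxEr mxE he hr.
  by split => //; apply: orthant_ptP => i _; exact: hw.
Qed.

End Orth.

(** A coordinate outside Z takes two values on the union; on a connected subset its
    range is an interval, so only one of them occurs. *)
Lemma two_components N (lamr : 'I_N -> R) (Z : pred 'I_N) (d1 d2 : 'I_N -> R) i0 k :
  ~~ Z i0 -> d1 i0 != d2 i0 -> manifold k (orthant lamr Z d1) -> manifold k (orthant lamr Z d2) ->
  disjoint_manifolds 2 k (orthant lamr Z d1 `|` orthant lamr Z d2).
Proof.
move=> Zi0 dne m1 m2; set O1 := orthant _ _ d1; set O2 := orthant _ _ d2.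
have val_of dd s : orthant lamr Z dd s -> s 0 (rshift N i0) = dd i0.
  by move=> /(_ i0)[_]; rewrite (negbTE Zi0).
have comp da db x : da i0 != db i0 -> orthant lamr Z da x ->
    connected_component (orthant lamr Z da `|` orthant lamr Z db) x = orthant lamr Z da.
  move=> dab Ax; apply/seteqP; split; last first.
    apply: (connected_component_max Ax); first exact: subsetUl.
    exact: orthant_connected.
  move=> y cy; have := connected_component_sub cy => -[//|By]; exfalso.
  set C := connected_component _ x in cy; pose h (s : 'rV[R]_(N + N)) := s 0 (rshift N i0).
  have /connected_intervalP itv : connected (h @` C).
    apply: connected_continuous_connected; first exact: component_connected.
    apply: continuous_subspaceT; exact: coord_continuous.
  have Cx : C x by apply: connected_component_refl; left.
  pose mid := (da i0 + db i0) / 2.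
  have [s Cs hs] : (h @` C) mid.
    case: (ltgtP (da i0) (db i0)) => [lt|lt|e]; last by rewrite e eqxx in dab.
      apply: (itv (da i0) (db i0)).
      + by exists x => //; exact: val_of.
      + by exists y => //; exact: val_of.
      + by rewrite /mid; apply/andP; split; lra.
    apply: (itv (db i0) (da i0)).
    + by exists y => //; exact: val_of.
    + by exists x => //; exact: val_of.
    + by rewrite /mid; apply/andP; split; lra.
  have := connected_component_sub Cs; case => /val_of; rewrite -/(h s) hs /mid => e.
    by case/eqP: dab; lra.
  by case/eqP: dab; lra.
have c1 x : O1 x -> connected_component (O1 `|` O2) x = O1 by exact: comp.
have c2 x : O2 x -> connected_component (O1 `|` O2) x = O2.
  by rewrite setUC; apply: comp; rewrite eq_sym.
have p1 : O1 (orthant_pt lamr Z d1 (fun=> 1)) by exact: orthant_ptP.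
have p2 : O2 (orthant_pt lamr Z d2 (fun=> 1)) by exact: orthant_ptP.
split; last first.
  by move=> x [/c1 ->|/c2 ->].
have O12 : O1 <> O2.
  by move=> e; case/eqP: dne; rewrite -(val_of _ _ p1); apply: val_of; rewrite -/O2 -e.
have -> : [set connected_component (O1 `|` O2) x | x in O1 `|` O2] = [set O1; O2].
  apply/seteqP; split => [_ [x [/[dup] h /c1 ->|/[dup] h /c2 ->] <-]|X].
  - by left.
  - by right.
  - case=> ->; [exists (orthant_pt lamr Z d1 (fun=> 1)); [by left|exact: c1]|
      exists (orthant_pt lamr Z d2 (fun=> 1)); [by right|exact: c2]].
apply/eq_cardSP; exists O1; first by left.
have -> : [set O1; O2] `\ O1 = [set O2].
  apply/seteqP; split => [X [[->|->] ne]|X ->] //=; last by split; [right|exact: nesym].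
  by case: ne.
exact: card_set1.
Qed.

End Topology.

(** * Spectral data compatible with the interior data *)

Section Final.
Context {R : realType}.
Variables (a : R) (N : nat) (lam : N.-tuple R) (phia : N.-tuple R[i]).

(** The data as a function on the reals; its values off lam do not matter. *)
Definition phi_fun (l : R) : R := complex.Re (phia`_(index l lam)).
Let phi := phi_fun.
Let b := expR a.
Let b0 : 0 < b. Proof. exact: expR_gt0. Qed.

Lemma index_tnth (u : uniq lam) i : index (tnth lam i) lam = i.
Proof. by rewrite (tnth_nth 0) index_uniq // size_tuple. Qed.

Lemma phi_tnth (u : uniq lam) i : phi (tnth lam i) = complex.Re (tnth phia i).
Proof. by rewrite /phi /phi_fun index_tnth // -tnth_nth. Qed.

Lemma eigenfunE (p : coef_pair R) (l : R) : eigenfun p l a =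
  (decay a * (profile (right_of b (string_of p)) b).[l] / Num.sqrt (norming p l))%:C.
Proof. by rewrite /eigenfun eigenfun_num right_of_string_of [RHS]rmorphM /= fmorphV. Qed.

Lemma sorted_tuple_uniq : sorted <%R lam -> uniq lam.
Proof. by apply: sorted_uniq; [exact: lt_trans|exact: ltxx]. Qed.

Section Real.
Hypotheses (slam : sorted <%R lam) (lam0 : 0 \notin lam).
Hypothesis phiaR : forall i, tnth phia i = (phi (tnth lam i))%:C.

Let ulam := sorted_tuple_uniq slam.

Lemma interiorE p : interior_data p a lam phia <-> has_data a lam phi p.
Proof.
split.
  move=> [/spectrumP[_ _ hp] h]; split => // l /tnthP[i ->].
  by have := h i; rewrite phiaR eigenfunE => /(congr1 (@complex.Re R)).
move=> [hp h]; split; first by apply/spectrumP.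
by move=> i; rewrite phiaR eigenfunE h ?mem_tnth.
Qed.

Lemma spectral_dataE p s : has_data a lam phi p -> spectral_data p s <->
  forall i, s 0 (lshift N i) = tnth lam i /\ s 0 (rshift N i) = norming p (tnth lam i).
Proof.
move=> [hp h]; have sp : spectrum p lam by apply/spectrumP.
split.
  move=> [lam' [/spectrumP[s' r0' hp'] ->]] i.
  have -> : lam = lam'.
    apply: val_inj; apply: (irr_sorted_eq lt_trans ltxx) => // x /=.
    by rewrite -[LHS]root_nodal // -[RHS]root_nodal // -hp hp'.
  by rewrite row_mxEl row_mxEr !mxE.
move=> hs; exists lam; split => //; apply/rowP => j.
case: (splitP j) => l hl.
  have -> : j = lshift N l by apply: val_inj.
  by rewrite row_mxEl mxE; case: (hs l).
have -> : j = rshift N l by apply: val_inj.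
by rewrite row_mxEr mxE; case: (hs l).
Qed.

Hypothesis phi1 : \sum_(l <- lam) phi l ^+ 2 = 1.

Definition zero_idx : pred 'I_N := fun i => phi (tnth lam i) == 0.
Definition fixed_norming (P : {poly R}) (i : 'I_N) : R :=
  P.[tnth lam i] ^+ 2 / (b * phi (tnth lam i) ^+ 2).

Notation orthant_of P := (orthant (tnth lam) zero_idx (fixed_norming P)).

Lemma compatible_sub s : compatible_data a lam phia s ->
  exists rp rh, splitting lam phi rp rh /\ orthant_of (nodal rp) s.
Proof.
move=> [p [/interiorE hd /(spectral_dataE _ hd) hs]].
have [rp [rh [v eP _]]] := has_data_splitting ulam lam0 phi1 hd; exists rp, rh; split => // i.
have [-> ->] := hs i; split => //; rewrite /zero_idx.
have hl := mem_tnth i lam; case: eqP => [_|/eqP pl].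
  by have [hp _] := hd; have [_] := normingE lam0 hp hl.
by rewrite (has_data_norming lam0 hd hl pl) eP.
Qed.

Lemma compatible_sup p0 rp rh s : has_data a lam phi p0 -> splitting lam phi rp rh ->
  orthant_of (nodal rp) s -> compatible_data a lam phia s.
Proof.
move=> hd0 v hs; have [_ [_ _ sg _]] := v.
pose c (l : R) := nth 0 (mktuple (fun i => s 0 (rshift N i))) (index l lam).
have cE i : c (tnth lam i) = s 0 (rshift N i).
  by rewrite /c index_tnth // -tnth_nth tnth_mktuple.
have [||p [hd hn]] := has_data_exists ulam lam0 phi1 hd0 v (c := c).
- move=> l /tnthP[i ->]; rewrite cE; have [_] := hs i; rewrite /zero_idx; case: eqP => // /eqP pl
  ->.
  have hl := mem_tnth i lam; have := sg _ hl pl => sgl.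
  have P0 : (nodal rp).[tnth lam i] != 0 by apply: contraTneq sgl => ->; rewrite mulr0 ltxx.
  by apply: divr_gt0; [|apply: mulr_gt0 => //]; rewrite exprn_even_gt0.
- move=> l /tnthP[i ->] pl; rewrite cE; have [_] := hs i.
  by rewrite /zero_idx (negbTE pl).
exists p; split; first by apply/interiorE.
apply/(spectral_dataE _ hd) => i; have [e _] := hs i; split => //.
by rewrite hn ?mem_tnth // cE.
Qed.

(** The norming constant of an eigenvalue with phi l1 = 0 can be any positive number. *)
Lemma infinite_pairs p0 l1 : has_data a lam phi p0 -> l1 \in lam -> phi l1 = 0 ->
  infinite_set [set p : coef_pair R | interior_data p a lam phia].
Proof.
move=> hd0 hl1 pl1 fin.
have [rp [rh [v eP _]]] := has_data_splitting ulam lam0 phi1 hd0.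
have hx (x : R) : 0 < x -> exists2 p, interior_data p a lam phia & norming p l1 = x.
  move=> x0; pose c l := if phi l == 0 then x else (nodal rp).[l] ^+ 2 / (b * phi l ^+ 2).
  have [||p [hd hn]] := has_data_exists ulam lam0 phi1 hd0 v (c := c).
  - move=> l hl; rewrite /c; case: eqP => // /eqP pl.
    have [_ [_ _ sg _]] := v; have sgl := sg _ hl pl.
    have P0 : (nodal rp).[l] != 0 by apply: contraTneq sgl => ->; rewrite mulr0 ltxx.
    by apply: divr_gt0; [|apply: mulr_gt0 => //]; rewrite exprn_even_gt0.
  - by move=> l hl pl; rewrite /c (negbTE pl).
  by exists p; [apply/interiorE|rewrite hn // /c pl1 eqxx].
have fim := finite_image (fun p => norming p l1) fin.
pose f (n : nat) : R := n.+1%:R.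
have finj : {in f @^-1` ((fun p => norming p l1) @` [set p | interior_data p a lam phia]) &,
  injective f}.
  by move=> m n _ _ /eqP; rewrite /f eqr_nat => /eqP [].
apply: infinite_nat; apply: sub_finite_set (finite_preimage finj fim) => n _.
have [|p hp e] := hx (f n); first by rewrite ltr0n.
by exists p.
Qed.

End Real.

Lemma nth_le_sorted i j : sorted <%R lam -> (i <= j)%N -> (j < N)%N -> lam`_i <= lam`_j.
Proof.
move=> sl ij jN; apply: (sorted_leq_nth le_trans le_refl) => //.
- by apply: sub_sorted sl => x y; exact: ltW.
- by rewrite inE size_tuple (leq_ltn_trans ij).
- by rewrite inE size_tuple.
Qed.

Lemma lam_bounds l : sorted <%R lam -> l \in lam -> lam`_0 <= l <= lam`_N.-1.
Proof.
move=> sl /tnthP[i ->]; rewrite (tnth_nth 0).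
have N0 : (0 < N)%N by exact: leq_ltn_trans (ltn_ord i).
have iN : (i <= N.-1)%N by rewrite -ltnS prednK.
by rewrite !nth_le_sorted // prednK.
Qed.

End Final.

Section OuterCases.
Context {R : realType}.
Variables (lam : seq R) (phi : R -> R).
Hypotheses (ulam : uniq lam) (lam0 : 0 \notin lam) (phi1 : \sum_(l <- lam) phi l ^+ 2 = 1).

Lemma green_num_root_neq0 m : (green_num lam phi).[m] = 0 -> m != 0.
Proof.
apply: contra_eq_neq => ->; have [_ e] := green_zero0 phi lam0.
rewrite /green_num pfnum_eval // nodal0 mul1r; apply/eqP => h.
have : \sum_(l <- lam) phi l ^+ 2 = 0.
  rewrite -[RHS]h !big_seq; apply: eq_bigr => l hl.
  have l0 := lam_neq0 lam0 hl; by field; rewrite ?sub0r ?oppr_eq0 ?l0.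
by rewrite phi1 => /eqP; rewrite oner_eq0.
Qed.

(** Here 0 is itself beyond all eigenvalues, and the outer interval contains only one
    zero of z G(z). *)
Lemma no_outer_same_sign (sg : R) : (forall l, l \in lam -> 0 < sg * l) ->
  forall m, (green_num lam phi).[m] = 0 -> outer lam phi m -> m \in lam.
Proof.
move=> hs m Qm om; apply/negPn/negP => ml.
have m0 := green_num_root_neq0 Qm; have zm := green_zero_off lam0 ml Qm.
have [[l [hl pl h]] [l' [hl' pl' h']]] := separation lam0 phi1 zm (green_zero0 phi lam0) m0.
rewrite subr0 in h; rewrite subr0 in h'.
have o' := om l' hl' pl'.
have s1 := hs l hl; have s2 := hs l' hl'.
have e1 : (l - m) * l = m ^+ 2 * ((l / m) * (l / m - 1)) by field.
have e2 : (l' - m) * l' = m ^+ 2 * ((l' / m) * (l' / m - 1)) by field.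
have m2 : 0 < m ^+ 2 by rewrite exprn_even_gt0.
rewrite e1 pmulr_rlt0 // in h; rewrite e2 pmulr_rgt0 // in h'.
have e3 : (sg * l) * (sg * l') = (sg * m) ^+ 2 * ((l / m) * (l' / m)) by field.
have : 0 < (l / m) * (l' / m).
  have : 0 < (sg * l) * (sg * l') by exact: mulr_gt0.
  rewrite e3 => h3; rewrite -(pmulr_rgt0 _ (_ : 0 < (sg * m) ^+ 2)) //.
  rewrite exprn_even_gt0 //= mulf_neq0 //.
  by apply: contraTneq s1 => ->; rewrite mul0r ltxx.
move: h h' o'; clear; move: (l / m) (l' / m) => x y h1 h2 h3 h4.
have y0 : y < 0.
  rewrite ltNge; apply/negP => y0; move: h2; apply/negP; rewrite -leNgt.
  by apply: mulr_ge0_le0 => //; rewrite subr_le0 ltW.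
have x0 : x < 0 by rewrite -(nmulr_lgt0 _ y0).
by move: h1; apply/negP; rewrite -leNgt; apply: mulr_le0; [exact: ltW|rewrite subr_le0; lra].
Qed.

(** The extreme eigenvalue e is a root beyond all those with phi l <> 0, so it is the
    outer root. *)
Lemma no_outer_zero rp rh (e : R) : splitting lam phi rp rh -> e \in lam -> phi e = 0 ->
  (forall l, l \in lam -> l / e <= 1) ->
  forall m, (green_num lam phi).[m] = 0 -> outer lam phi m -> m \in lam.
Proof.
move=> v el pe he m Qm om; have e0 := lam_neq0 lam0 el.
have Qe : (green_num lam phi).[e] = 0 by rewrite green_num_at_lam // pe expr0n /= mulr0 mul0r.
have oe : outer lam phi e.
  move=> l hl pl; rewrite lt_neqAle he // andbT.
  apply: contraNneq pl => h; have -> : l = e by rewrite -[l](divfK e0) h mul1r.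
  by rewrite pe.
rewrite (outer_unique lam0 phi1 (green_num_root_neq0 Qm) e0 (splitting_green_zero ulam lam0 v Qm)
   (splitting_green_zero ulam lam0 v Qe) om oe) //.
Qed.

End OuterCases.

Theorem theorem4p5 (R : realType) (a : R) (N : nat)
    (lam : N.-tuple R) (phia : N.-tuple R[i]) (k : nat)
    (hdata : exists p : coef_pair R, interior_data p a lam phia)
    (halpha : alpha phia = 0) (hbeta : beta lam phia <> 0)
    (hk1 : (1 <= k)%N) (hk : count_mem 0 phia = k) :
  infinite_set [set p : coef_pair R | interior_data p a lam phia] /\
  [/\ 0 < lam`_0 \/ lam`_N.-1 < 0 ->
        connected_manifold k (compatible_data a lam phia),
      (exists2 j0 : nat, (j0.+1 < N)%N & lam`_j0 < 0 < lam`_j0.+1) ->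
        phia`_0 = 0 \/ phia`_N.-1 = 0 ->
        connected_manifold k (compatible_data a lam phia) &
      (exists2 j0 : nat, (j0.+1 < N)%N & lam`_j0 < 0 < lam`_j0.+1) ->
        phia`_0 <> 0 -> phia`_N.-1 <> 0 ->
        disjoint_manifolds 2 k (compatible_data a lam phia)].
Proof.
case: hdata => p0 hp0.
have [/spectrumP[slam lam0 hp0'] hphia] := hp0.
have ulam := sorted_tuple_uniq slam.
pose phi := phi_fun lam phia.
have phiaR i : tnth phia i = (phi (tnth lam i))%:C.
  by rewrite /phi phi_tnth // hphia eigenfunE.
have phi1 : \sum_(l <- lam) phi l ^+ 2 = 1.
  move/eqP: halpha; rewrite /alpha subr_eq0 => /eqP ->; rewrite big_tuple.
  by apply: eq_bigr => i _; rewrite phiaR modulus_sqr_real.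
have betaE : beta lam phia = - \sum_(l <- lam) l * phi l ^+ 2.
  rewrite /beta big_tuple; congr (- _).
  by apply: eq_bigr => i _; rewrite phiaR modulus_sqr_real.
have hd0 : has_data a lam phi p0 by apply/interiorE.
pose Z := zero_idx lam phia.
have Zcard : #|[pred i | Z i]| = k.
  rewrite -hk -[in RHS](map_tnth_enum phia) -sum1_card -sum1_count big_map big_enum_cond /=.
  apply: eq_bigl => i; rewrite /= !inE phiaR /Z /zero_idx -/phi.
  by rewrite eq_complex /= eqxx andbT.
have [i1 Zi1] : exists i, Z i.
  by apply/existsP; rewrite -[[exists _, _]]negbK negb_exists; apply/negP => /forallP h;
    move: hk1; rewrite -Zcard eq_card0 // => i; rewrite !inE; exact/negbTE.
have Npos : (0 < N)%N by exact: leq_ltn_trans (ltn_ord i1).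
have nthphi j : (j < N)%N -> phia`_j = (phi lam`_j)%:C.
  by move=> jN; have := phiaR (Ordinal jN); rewrite !(tnth_nth 0).
have nthlam j : (j < N)%N -> lam`_j \in lam by move=> jN; rewrite mem_nth // size_tuple.
have N1 : (N.-1 < N)%N by rewrite prednK.
split.
  by apply: (infinite_pairs slam lam0 phiaR phi1 hd0 (mem_tnth i1 lam)); exact/eqP.
pose e (j : 'I_k) : 'I_N := enum_val (cast_ord (esym Zcard) j).
pose r (i : 'I_N) : 'I_k := cast_ord Zcard (enum_rank_in (Zi1 : i1 \in [pred i | Z i]) i).
have he j : Z (e j) by have := enum_valP (cast_ord (esym Zcard) j).
have hr j : r (e j) = j by rewrite /r /e enum_valK_in cast_ordKV.
have her i : Z i -> e (r i) = i by move=> Zi; rewrite /r /e cast_ordK enum_rankK_in.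
have man d : manifold k (orthant (tnth lam) Z d) by exact: orthant_manifold he hr her.
have [rp [rh [v _ _]]] := has_data_splitting ulam lam0 phi1 hd0.
have single : (forall m, (green_num lam phi).[m] = 0 -> outer lam phi m -> m \in lam) ->
    connected_manifold k (compatible_data a lam phia).
  move=> no; suff -> : compatible_data a lam phia =
      orthant (tnth lam) Z (fixed_norming a lam phia (nodal rp)).
    by split; [exact: orthant_connected|exact: man].
  apply/seteqP; split => s.
    move=> /(compatible_sub slam lam0 phiaR phi1)[rp' [rh' [v' h]]].
    by rewrite -(splitting_eq ulam lam0 phi1 no v' v).
  exact: (compatible_sup slam lam0 phiaR phi1 hd0 v).
have bounds j0 : (j0.+1 < N)%N -> lam`_j0 < 0 < lam`_j0.+1 -> lam`_0 < 0 < lam`_N.-1.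
  move=> jN /andP[h1 h2]; apply/andP; split.
    by apply: le_lt_trans h1; apply: nth_le_sorted => //; exact: ltnW.
  by apply: (lt_le_trans h2); apply: nth_le_sorted => //; rewrite -ltnS prednK.
have divN l : 0 < lam`_N.-1 -> l \in lam -> l / lam`_N.-1 <= 1.
  by move=> h hl; rewrite ler_pdivrMr // mul1r; have /andP[] := lam_bounds slam hl.
have div0 l : lam`_0 < 0 -> l \in lam -> l / lam`_0 <= 1.
  by move=> h hl; rewrite ler_ndivrMr // mul1r; have /andP[] := lam_bounds slam hl.
split.
- case=> h; apply: single.
    apply: (no_outer_same_sign lam0 phi1 (sg := 1)) => l hl; rewrite mul1r.
    by apply: (lt_le_trans h); have /andP[] := lam_bounds slam hl.
  apply: (no_outer_same_sign lam0 phi1 (sg := -1)) => l hl; rewrite mulN1r oppr_gt0.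
  by apply: le_lt_trans h; have /andP[] := lam_bounds slam hl.
- move=> [j0 jN /(bounds _ jN)/andP[h0 hN]] [] hz; apply: single.
    apply: (no_outer_zero ulam lam0 phi1 v (nthlam 0 Npos)); last by move=> l; exact: div0.
    by move: hz; rewrite nthphi // => -[].
  apply: (no_outer_zero ulam lam0 phi1 v (nthlam N.-1 N1)); last by move=> l; exact: divN.
  by move: hz; rewrite nthphi // => -[].
move=> [j0 jN /(bounds _ jN)/andP[h0 hN]] z0 zN.
have p0n : phi lam`_0 != 0 by apply/eqP => h; apply: z0; rewrite nthphi // h.
have pNn : phi lam`_N.-1 != 0 by apply/eqP => h; apply: zN; rewrite nthphi // h.
set B := \sum_(l <- lam) l * phi l ^+ 2 in betaE.
have B0 : B != 0 by apply/eqP => h; apply: hbeta; rewrite betaE h oppr0.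
have [m0 [Qm0 om0 m0l]] : exists m, [/\ (green_num lam phi).[m] = 0, outer lam phi m & m \notin
  lam].
  case: (ltgtP B 0) B0 => // hB _.
    apply: (outer_exists ulam lam0 (nthlam _ N1) pNn) => [|l]; last exact: divN.
    by rewrite pmulr_rlt0.
  apply: (outer_exists ulam lam0 (nthlam _ Npos) p0n) => [|l]; last exact: div0.
  by rewrite nmulr_rlt0.
have [v1 v2] := splitting_drop Qm0 om0 m0l v.
pose P1 := nodal [seq m <- rp | m != m0]; pose P2 := (1 - m0^-1 *: 'X) * P1.
have -> : compatible_data a lam phia =
    orthant (tnth lam) Z (fixed_norming a lam phia P1) `|`
    orthant (tnth lam) Z (fixed_norming a lam phia P2).
  apply/seteqP; split => s.
    move=> /(compatible_sub slam lam0 phiaR phi1)[rp' [rh' [v' h]]].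
    by have [e1|e1] := splitting_cases ulam lam0 phi1 Qm0 om0 v' v; rewrite e1 in h; [left|right].
  case=> h; first exact: (compatible_sup slam lam0 phiaR phi1 hd0 v1).
  by apply: (compatible_sup slam lam0 phiaR phi1 hd0 v2); rewrite nodal_cons.
pose iN := Ordinal N1.
have tN : tnth lam iN = lam`_N.-1 by rewrite (tnth_nth 0).
apply: (two_components (i0 := iN)) => //; first by rewrite /Z /zero_idx tN.
rewrite /fixed_norming tN -/phi; apply/negP => /eqP hP.
have b0 : expR a * phi lam`_N.-1 ^+ 2 != 0 
  by apply: mulf_neq0; [rewrite gt_eqF ?expR_gt0|exact: expf_neq0].
have {hP} : P1.[lam`_N.-1] ^+ 2 = P2.[lam`_N.-1] ^+ 2 by apply: (mulIf (invr_neq0 b0)).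
have P10 : P1.[lam`_N.-1] != 0.
  case: v1 => [_ [_ _ sg _]]; have := sg _ (nthlam _ N1) pNn.
  by apply: contraTneq => h; rewrite /P1 in h; rewrite h mulr0 ltxx.
rewrite /P2 hornerM exprMn -{1}[P1.[_] ^+ 2]mul1r => /(mulIf (expf_neq0 2 P10)).
have m00 := green_num_root_neq0 lam0 phi1 Qm0.
rewrite !horner_ops => hh; have o := om0 _ (nthlam _ N1) pNn.
have ln0 := lam_neq0 lam0 (nthlam _ N1).
have w0 : lam`_N.-1 / m0 != 0 by rewrite mulf_neq0 // invr_eq0.
have : (lam`_N.-1 / m0) * (lam`_N.-1 / m0 - 2) = 0 by move: hh; rewrite [m0^-1 * _]mulrC => hh; lra.
move/eqP; rewrite mulf_eq0 (negbTE w0) /= subr_eq0 => /eqP e2.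
by move: o; rewrite e2; lra.
Qed.
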